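(* Let $k$ be an algebraically closed field and let $\mathsf{T}$ be a $k$-linear triangulated category with suspension functor $\Sigma$ and Serre functor $S$, which has finite dimensional $\operatorname{Hom}$ spaces and split idempotents. Let $\tau=\Sigma^{-1}\circ S$ be the Auslander-Reiten (AR) translation of $\mathsf{T}$. Let $\mathbb{X}$ be a class of objects of $\mathsf{T}$, closed under isomorphisms, direct sums, and direct summands, which is both precovering and preenveloping. Suppose $\tau\mathbb{X}=\mathbb{X}$. Then: (i) The triangulated category $\mathsf{T}_{\mathbb{X}}$ has AR triangles. (ii) As a translation quiver, the AR quiver $\Gamma'$ of $\mathsf{T}_{\mathbb{X}}$ is obtained from the AR quiver $\Gamma$ of $\mathsf{T}$ by deleting the vertices corresponding to objects of $\mathbb{X}$ along with the arrows into or out of such vertices. (iii) If $\mathsf{T}$ is standard, then so is $\mathsf{T}_{\mathbb{X}}$.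
   Context: Serre functor: an autoequivalence $S$ of $\mathsf{T}$ with natural isomorphisms $\mathsf{T}(A,B)\cong\operatorname{Hom}_k(\mathsf{T}(B,SA),k)$. The notation $\tau\mathbb{X}=\mathbb{X}$ means that the class of objects isomorphic to objects in $\tau\mathbb{X}$ equals $\mathbb{X}$. Quotient category: $\mathsf{T}_{\mathbb{X}}$ has the same objects as $\mathsf{T}$, and $\mathsf{T}_{\mathbb{X}}(A,B)=\mathsf{T}(A,B)/\mathbb{X}(A,B)$, where $\mathbb{X}(A,B)$ is the set of morphisms $A\to B$ which factor through an object of $\mathbb{X}$. The image of a morphism $\mu$ in $\mathsf{T}_{\mathbb{X}}$ is denoted $\underline{\mu}$. $\mathbb{X}$ is preenveloping if each object $M$ has an $\mathbb{X}$-preenvelope, i.e. a morphism $M\to X_M$ with $X_M\in\mathbb{X}$ through which each morphism $M\to X$ with $X\in\mathbb{X}$ factors; dually, $\mathbb{X}$ is precovering if each $M$ has an $\mathbb{X}$-precover $X^M\to M$ (with $X^M\in\mathbb{X}$, and each morphism $X\to M$ with $X\in\mathbb{X}$ factors through it). A morphism $M\to N$ is an $\mathbb{X}$-monomorphism if each morphism $M\to X$ with $X\in\mathbb{X}$ factors through $M\to N$. Triangulated structure of $\mathsf{T}_{\mathbb{X}}$: when $\tau\mathbb{X}=\mathbb{X}$, the category $\mathsf{T}_{\mathbb{X}}$ is triangulated as follows. For each $M$ choose an $\mathbb{X}$-preenvelope and complete it to a distinguished triangle $M\to X_M\to\sigma M\to\Sigma M$ in $\mathsf{T}$. For $\mu:M\to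 N$ in $\mathsf{T}$, choose $\xi:X_M\to X_N$ and $s:\sigma M\to\sigma N$ such that $(\mu,\xi,s,\Sigma\mu)$ is a morphism of distinguished triangles, and set $\sigma(\underline{\mu})=\underline{s}$. The functor $\sigma$ is the suspension of $\mathsf{T}_{\mathbb{X}}$. If $\mu:M\to N$ is an $\mathbb{X}$-monomorphism, extend it to a distinguished triangle $M\xrightarrow{\mu}N\xrightarrow{\nu}P\to\Sigma M$ and choose a morphism of distinguished triangles $(\mathrm{id}_M,n,\pi,\mathrm{id}_{\Sigma M})$ to $M\to X_M\to\sigma M\to\Sigma M$; the distinguished triangles of $\mathsf{T}_{\mathbb{X}}$ are, up to isomorphism, the diagrams $M\xrightarrow{\underline{\mu}}N\xrightarrow{\underline{\nu}}P\xrightarrow{\underline{\pi}}\sigma M$. AR quiver of a Krull-Schmidt $k$-linear category: one vertex for each isomorphism class of indecomposable objects and $\dim_k\operatorname{Irr}(M,N)$ arrows from the vertex of $M$ to that of $N$, where $\operatorname{Irr}(M,N)=\operatorname{rad}(M,N)/\operatorname{rad}^2(M,N)$. For a triangulated category with AR triangles it is a translation quiver, with translation given by the AR translation. Both $\mathsf{T}$ and $\mathsf{T}_{\mathbb{X}}$ are Krull-Schmidt, and isomorphism classes of indecomposables of $\mathsf{T}_{\mathbb{X}}$ correspond to isomorphism classes of indecomposables of $\mathsf{T}$ not in $\mathbb{X}$. Standard: a category with AR quiver $\Gamma$ is standard if it is equivalent to $\operatorname{add}k(\Gamma)$, the additive closure of the mesh category $k(\Gamma)$. *)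

(* Defs.v *)
From HB Require Import structures.
From mathcomp Require Import all_boot all_order all_algebra.
From mathcomp Require Import boolp classical_sets fsbigop.
From mathcomp Require Import finmap monalg.

Set Implicit Arguments.
Unset Strict Implicit.
Unset Printing Implicit Defensive.

Import GRing.Theory.
Local Open Scope ring_scope.
Local Open Scope quotient_scope.

Record klincat (k : fieldType) := KLinCat {
  obj :> Type;
  hom : obj -> obj -> lmodType k;
  idm : forall A, hom A A;
  comp : forall A B C, hom B C -> hom A B -> hom A C;
  comp_linl : forall A B C (a : k) (g g' : hom B C) (f : hom A B),
    comp (a *: g + g') f = a *: comp g f + comp g' f;
  comp_linr : forall A B C (a : k) (g : hom B C) (f f' : hom A B),
    comp g (a *: f + f') = a *: comp g f + comp g f';
  comp1m : forall A B (f : hom A B), comp (idm B) f = f;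
  compm1 : forall A B (f : hom A B), comp f (idm A) = f;
  compA : forall A B C D (h : hom C D) (g : hom B C) (f : hom A B),
    comp h (comp g f) = comp (comp h g) f }.

Arguments hom {k} c A B : rename.
Arguments idm {k c} A : rename.
Arguments comp {k c A B C} g f : rename.
Notation "g \oc f" := (comp g f)
  (at level 40, left associativity, format "g  \oc  f").

Section KLinTheory.
Variables (k : fieldType) (C : klincat k).
Implicit Types A B D : C.

Lemma comp0r A B D (g : hom C B D) : g \oc (0 : hom C A B) = 0.
Proof.
by have:= comp_linr 1 g (0 : hom C A B) 0; rewrite !scale1r addr0 => /eqP;
   rewrite -subr_eq0 opprD addNKr oppr_eq0 => /eqP.
Qed.

Lemma comp0l A B D (f : hom C A B) : (0 : hom C B D) \oc f = 0.
Proof.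
by have:= comp_linl 1 (0 : hom C B D) 0 f; rewrite !scale1r addr0 => /eqP;
   rewrite -subr_eq0 opprD addNKr oppr_eq0 => /eqP.
Qed.

Lemma compBr A B D (g : hom C B D) (f f' : hom C A B) :
  g \oc (f - f') = g \oc f - g \oc f'.
Proof. by rewrite addrC -scaleN1r comp_linr scaleN1r addrC. Qed.

Lemma compBl A B D (g g' : hom C B D) (f : hom C A B) :
  (g - g') \oc f = g \oc f - g' \oc f.
Proof. by rewrite addrC -scaleN1r comp_linl scaleN1r addrC. Qed.

Definition is_iso A B (f : hom C A B) :=
  exists g : hom C B A, g \oc f = idm A /\ f \oc g = idm B.

Definition iso A B := exists f : hom C A B, is_iso f.

Definition is_zero A := idm A = 0.

Definition is_biproduct A B D (i : hom C A D) (j : hom C B D)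
    (p : hom C D A) (q : hom C D B) :=
  [/\ p \oc i = idm A, q \oc j = idm B, p \oc j = 0, q \oc i = 0
    & i \oc p + j \oc q = idm D].

Definition direct_sum A B D := exists i j p q, @is_biproduct A B D i j p q.

Definition additive_cat :=
  (exists Z, is_zero Z) /\ (forall A B, exists D, direct_sum A B D).

Definition hom_finite := forall A B,
  exists s : seq (hom C A B), forall f : hom C A B,
    exists c : nat -> k, f = \sum_(i < size s) c i *: s`_i.

Definition split_idempotents := forall A (e : hom C A A), e \oc e = e ->
  exists B (r : hom C A B) (s : hom C B A), r \oc s = idm B /\ s \oc r = e.

Definition indecomposable A :=
  ~ is_zero A /\ forall B D, direct_sum B D A -> is_zero B \/ is_zero D.

Definition rad A B (f : hom C A B) :=
  forall g : hom C B A, is_iso (idm A - g \oc f).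

Definition rad2 A B (h : hom C A B) :=
  exists (n : nat) (Z : 'I_n -> C)
         (g : forall i, hom C (Z i) B) (f : forall i, hom C A (Z i)),
    (forall i, rad (f i) /\ rad (g i)) /\ h = \sum_i g i \oc f i.

End KLinTheory.

(* For subspaces Q <= P of V: P / Q has a basis of n elements. *)
Definition quotient_has_dim (k : fieldType) (V : lmodType k)
    (P Q : V -> Prop) (n : nat) :=
  exists b : 'I_n -> V, (forall i, P (b i)) /\
    forall v, P v -> exists! c : 'rV[k]_n, Q (v - \sum_i c 0 i *: b i).

(* dim_k Irr(A, B); the junk value 0 is only used when it is infinite. *)
Definition irr_dim (k : fieldType) (C : klincat k) (A B : C) : nat :=
  xget 0%N [set n | quotient_has_dim (@rad k C A B) (@rad2 k C A B) n]%classic.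

Record klinfunctor (k : fieldType) (C D : klincat k) := KLinFunctor {
  fobj :> C -> D;
  fmap : forall A B, hom C A B -> hom D (fobj A) (fobj B);
  fmap_lin : forall A B (a : k) (f g : hom C A B),
    fmap (a *: f + g) = a *: fmap f + fmap g;
  fmap1 : forall A, fmap (idm A) = idm (fobj A);
  fmapM : forall A B E (g : hom C B E) (f : hom C A B),
    fmap (g \oc f) = fmap g \oc fmap f }.
Arguments fmap {k C D} _ {A B} _.

Definition id_functor (k : fieldType) (C : klincat k) : klinfunctor C C.
Proof. by exists id (fun A B f => f). Defined.

Definition comp_functor (k : fieldType) (C D E : klincat k)
  (G : klinfunctor D E) (F : klinfunctor C D) : klinfunctor C E.
Proof.
exists (fun A => G (F A)) (fun A B f => fmap G (fmap F f)).
- by move=> *; rewrite !fmap_lin.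
- by move=> *; rewrite !fmap1.
- by move=> *; rewrite !fmapM.
Defined.

Record nat_iso (k : fieldType) (C D : klincat k) (F G : klinfunctor C D) :=
  NatIso {
  nt :> forall A, hom D (F A) (G A);
  nt_iso : forall A, is_iso (nt A);
  nt_nat : forall A B (f : hom C A B), fmap G f \oc nt A = nt B \oc fmap F f }.

Record equivalence (k : fieldType) (C D : klincat k) := Equivalence {
  eqv_fun :> klinfunctor C D;
  eqv_inv : klinfunctor D C;
  eqv_unit : nat_iso (id_functor C) (comp_functor eqv_inv eqv_fun);
  eqv_counit : nat_iso (comp_functor eqv_fun eqv_inv) (id_functor D) }.

Record submodule (k : fieldType) (V : lmodType k) := Submodule {
  submod_set :> V -> Prop;
  submod0 : submod_set 0;
  submodP : forall (a : k) (u v : V),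
    submod_set u -> submod_set v -> submod_set (a *: u + v) }.

Section LmodQuotient.
Variables (k : fieldType) (V : lmodType k) (S : submodule V).

Lemma submodD u v : S u -> S v -> S (u + v).
Proof. by move=> Su Sv; rewrite -[u]scale1r; apply: submodP. Qed.

Lemma submodZ a u : S u -> S (a *: u).
Proof. by move=> Su; rewrite -[_ *: _]addr0; apply/submodP/submod0. Qed.

Lemma submodN u : S u -> S (- u).
Proof. by rewrite -scaleN1r; apply: submodZ. Qed.

Definition lequiv (u v : V) : bool := `[< S (u - v) >].

Lemma lequiv_class : equiv_class_of lequiv.
Proof.
split=> [u|u v|v u w].
- by apply/asboolP; rewrite subrr; apply: submod0.
- by apply/asboolP/asboolP => /submodN; rewrite opprB.
- move=> /asboolP uv /asboolP vw; apply/asboolP.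
  by rewrite -[u](subrK v) -addrA; apply: submodD.
Qed.

Canonical lequiv_equiv := EquivRelPack lequiv_class.
Canonical lequiv_encModRel := defaultEncModRel lequiv.

Definition lquot := {eq_quot lequiv}.
HB.instance Definition _ := Choice.on lquot.

Definition lpi (u : V) : lquot := \pi_lquot u.

Lemma lpi_eq u v : lpi u = lpi v <-> S (u - v).
Proof.
rewrite /lpi; split=> [/eqP|Suv].
  by rewrite eqmodE => /asboolP.
by apply/eqP; rewrite eqmodE; apply/asboolP.
Qed.

Lemma lpi_repr x : lpi (repr x) = x. Proof. exact: reprK. Qed.

Lemma repr_lpi u : S (repr (lpi u) - u).
Proof. by apply/lpi_eq; rewrite lpi_repr. Qed.

Definition lquot_add (x y : lquot) := lpi (repr x + repr y).
Definition lquot_opp (x : lquot) := lpi (- repr x).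
Definition lquot_scale (a : k) (x : lquot) := lpi (a *: repr x).

Lemma lquot_addE u v : lquot_add (lpi u) (lpi v) = lpi (u + v).
Proof. by apply/lpi_eq; rewrite opprD addrACA; apply: submodD; apply: repr_lpi. Qed.

Lemma lquot_oppE u : lquot_opp (lpi u) = lpi (- u).
Proof. by apply/lpi_eq; rewrite -opprD; apply/submodN/repr_lpi. Qed.

Lemma lquot_scaleE a u : lquot_scale a (lpi u) = lpi (a *: u).
Proof. by apply/lpi_eq; rewrite -scalerBr; apply/submodZ/repr_lpi. Qed.

Let lqE := (lquot_addE, lquot_oppE, lquot_scaleE).

Let addA : associative lquot_add.
Proof.
by move=> x y z; rewrite -(lpi_repr x) -(lpi_repr y) -(lpi_repr z) !lqE addrA.
Qed.
Let addC : commutative lquot_add.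
Proof. by move=> x y; rewrite /lquot_add addrC. Qed.
Let add0 : left_id (lpi 0) lquot_add.
Proof. by move=> x; rewrite -(lpi_repr x) lqE add0r. Qed.
Let addN : left_inverse (lpi 0) lquot_opp lquot_add.
Proof. by move=> x; rewrite -(lpi_repr x) !lqE addNr. Qed.

HB.instance Definition _ := GRing.isZmodule.Build lquot addA addC add0 addN.

Let scaleA a b (x : lquot) :
  lquot_scale a (lquot_scale b x) = lquot_scale (a * b) x.
Proof. by rewrite -(lpi_repr x) !lqE scalerA. Qed.
Let scale1 : left_id 1 lquot_scale.
Proof. by move=> x; rewrite -(lpi_repr x) lqE scale1r. Qed.
Let scaleDr : right_distributive lquot_scale +%R.
Proof.
move=> a x y; rewrite -(lpi_repr x) -(lpi_repr y).
by rewrite [_ + _]lquot_addE !lqE scalerDr -lquot_addE.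
Qed.
Let scaleDl (x : lquot) : {morph lquot_scale^~ x : a b / a + b}.
Proof.
by move=> a b; rewrite -(lpi_repr x) !lqE scalerDl -lquot_addE.
Qed.

HB.instance Definition _ := GRing.Zmodule_isLmodule.Build k lquot
  scaleA scale1 scaleDr scaleDl.

Lemma lpi_is_linear : linear lpi.
Proof.
by move=> a u v; rewrite -lquot_addE -lquot_scaleE.
Qed.
HB.instance Definition _ := GRing.isLinear.Build k V lquot _ lpi lpi_is_linear.

End LmodQuotient.

Record ideal (k : fieldType) (C : klincat k) := Ideal {
  ideal_submod :> forall A B : C, submodule (hom C A B);
  ideal_compl : forall A B D (g : hom C B D) (f : hom C A B),
    ideal_submod A B f -> ideal_submod A D (g \oc f);
  ideal_compr : forall A B D (g : hom C B D) (f : hom C A B),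
    ideal_submod B D g -> ideal_submod A D (g \oc f) }.

Section QuotientCategory.
Variables (k : fieldType) (C : klincat k) (I : ideal C).

Definition qhom (A B : C) : lmodType k := lquot (I A B).
Definition qpi (A B : C) (f : hom C A B) : qhom A B := lpi (I A B) f.
Definition qcomp (A B D : C) (g : qhom B D) (f : qhom A B) : qhom A D :=
  qpi (repr g \oc repr f).

Lemma qcompE A B D (g : hom C B D) (f : hom C A B) :
  qcomp (qpi g) (qpi f) = qpi (g \oc f).
Proof.
apply/lpi_eq; set g' := repr _; set f' := repr _.
have -> : g' \oc f' - g \oc f = g' \oc (f' - f) + (g' - g) \oc f.
  by rewrite compBr compBl addrA subrK.
apply: submodD; first by apply/ideal_compl/repr_lpi.
by apply/ideal_compr/repr_lpi.
Qed.

Lemma qpi_repr A B (x : qhom A B) : qpi (repr x) = x.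
Proof. exact: lpi_repr. Qed.

Lemma qpi_lin A B a (f g : hom C A B) : qpi (a *: f + g) = a *: qpi f + qpi g.
Proof. exact: lpi_is_linear. Qed.

Definition quotient_category : klincat k.
Proof.
exists C qhom (fun A => qpi (idm A)) qcomp.
- move=> A B D a g g' f.
  rewrite -(qpi_repr g) -(qpi_repr g') -(qpi_repr f).
  by rewrite -qpi_lin !qcompE comp_linl qpi_lin.
- move=> A B D a g f f'.
  rewrite -(qpi_repr g) -(qpi_repr f') -(qpi_repr f).
  by rewrite -qpi_lin !qcompE comp_linr qpi_lin.
- by move=> A B f; rewrite -(qpi_repr f) qcompE comp1m.
- by move=> A B f; rewrite -(qpi_repr f) qcompE compm1.
- move=> A B D E h g f.
  by rewrite -(qpi_repr f) -(qpi_repr g) -(qpi_repr h) !qcompE compA.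
Defined.

End QuotientCategory.

Section GeneratedIdeal.
Variables (k : fieldType) (C : klincat k).
Variable R : forall A B : C, hom C A B -> Prop.

Definition gen_ideal_set A B (f : hom C A B) :=
  forall I : ideal C, (forall A' B' (r : hom C A' B'), R r -> I A' B' r) -> I A B f.

Definition gen_ideal : ideal C.
Proof.
unshelve eexists (fun A B => @Submodule k _ (@gen_ideal_set A B) _ _).
- by move=> I _; apply: submod0.
- by move=> a u v Iu Iv I RI; apply: submodP; [apply: Iu|apply: Iv].
- by move=> A B D g f If I RI; apply/ideal_compl/If.
- by move=> A B D g f Ig I RI; apply/ideal_compr/Ig.
Defined.

End GeneratedIdeal.

Section DProdLmod.
Variables (k : fieldType) (I : Type) (V : I -> lmodType k).

Definition dprod := forall i, V i.
HB.instance Definition _ := gen_eqMixin dprod.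
HB.instance Definition _ := gen_choiceMixin dprod.

Definition dprod0 : dprod := fun=> 0.
Definition dprod_add (f g : dprod) : dprod := fun i => f i + g i.
Definition dprod_opp (f : dprod) : dprod := fun i => - f i.
Definition dprod_scale (a : k) (f : dprod) : dprod := fun i => a *: f i.

Let addA : associative dprod_add.
Proof. by move=> f g h; apply/functional_extensionality_dep=> i; apply: addrA. Qed.
Let addC : commutative dprod_add.
Proof. by move=> f g; apply/functional_extensionality_dep=> i; apply: addrC. Qed.
Let add0 : left_id dprod0 dprod_add.
Proof. by move=> f; apply/functional_extensionality_dep=> i; apply: add0r. Qed.
Let addN : left_inverse dprod0 dprod_opp dprod_add.
Proof. by move=> f; apply/functional_extensionality_dep=> i; apply: addNr. Qed.
HB.instance Definition _ := GRing.isZmodule.Build dprod addA addC add0 addN.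

Let scaleA a b (f : dprod) :
  dprod_scale a (dprod_scale b f) = dprod_scale (a * b) f.
Proof. by apply/functional_extensionality_dep=> i; apply: scalerA. Qed.
Let scale1 : left_id 1 dprod_scale.
Proof. by move=> f; apply/functional_extensionality_dep=> i; apply: scale1r. Qed.
Let scaleDr : right_distributive dprod_scale +%R.
Proof. by move=> a f g; apply/functional_extensionality_dep=> i; apply: scalerDr. Qed.
Let scaleDl (f : dprod) : {morph dprod_scale^~ f : a b / a + b}.
Proof. by move=> a b; apply/functional_extensionality_dep=> i; apply: scalerDl. Qed.
HB.instance Definition _ := GRing.Zmodule_isLmodule.Build k dprod
  scaleA scale1 scaleDr scaleDl.

End DProdLmod.

Section AdditiveClosure.
Variables (k : fieldType) (C : klincat k).

Record add_obj := AddObj { add_size : nat; add_fun :> 'I_add_size -> C }.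

Definition add_hom (s t : add_obj) : lmodType k :=
  dprod (fun i : 'I_(add_size s) =>
    dprod (fun j : 'I_(add_size t) => hom C (s i) (t j))).

Definition add_idm (s : add_obj) : add_hom s s := fun i j =>
  match i =P j with
  | ReflectT e => ecast j (hom C (s i) (s j)) e (idm (s i))
  | ReflectF _ => 0
  end.

Definition add_comp (s t u : add_obj) (g : add_hom t u) (f : add_hom s t)
  : add_hom s u := fun i l => \sum_j g j l \oc f i j.

Arguments add_idm s : clear implicits.

Lemma add_idmE (s : add_obj) i : add_idm s i i = idm (s i).
Proof. by rewrite /add_idm; case: eqP => // e; rewrite (eq_axiomK e). Qed.

Lemma add_idm_neq (s : add_obj) i j : i != j -> add_idm s i j = 0.
Proof. by rewrite /add_idm /=; case: eqP. Qed.

Lemma add_homP (s t : add_obj) (f g : add_hom s t) :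
  (forall i j, f i j = g i j) -> f = g.
Proof.
by move=> fg; do 2 (apply/functional_extensionality_dep => ?).
Qed.

Lemma comp_suml (I : Type) (r : seq I) (A B D : C) (g : I -> hom C B D)
    (f : hom C A B) :
  (\sum_(i <- r) g i) \oc f = \sum_(i <- r) g i \oc f.
Proof.
elim: r => [|i r IH]; first by rewrite !big_nil comp0l.
by rewrite !big_cons -IH -[X in (X + _) \oc _]scale1r comp_linl scale1r.
Qed.

Lemma comp_sumr (I : Type) (r : seq I) (A B D : C) (g : hom C B D)
    (f : I -> hom C A B) :
  g \oc (\sum_(i <- r) f i) = \sum_(i <- r) g \oc f i.
Proof.
elim: r => [|i r IH]; first by rewrite !big_nil comp0r.
by rewrite !big_cons -IH -[X in _ \oc (X + _)]scale1r comp_linr scale1r.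
Qed.

Definition add_closure : klincat k.
Proof.
exists add_obj add_hom add_idm add_comp.
- move=> s t u a g g' f; apply: add_homP => i l.
  rewrite [RHS](_ : _ = a *: (\sum_j g j l \oc f i j) +
    \sum_j g' j l \oc f i j) // scaler_sumr -big_split /=.
  by apply: eq_bigr => j _; rewrite -comp_linl.
- move=> s t u a g f f'; apply: add_homP => i l.
  rewrite [RHS](_ : _ = a *: (\sum_j g j l \oc f i j) +
    \sum_j g j l \oc f' i j) // scaler_sumr -big_split /=.
  by apply: eq_bigr => j _; rewrite -comp_linr.
- move=> s t f; apply: add_homP => i l.
  rewrite /add_comp (bigD1 l) //= add_idmE comp1m big1 ?addr0 // => j jl.
  by rewrite add_idm_neq // comp0l.
- move=> s t f; apply: add_homP => i l.
  rewrite /add_comp (bigD1 i) //= add_idmE compm1 big1 ?addr0 // => j ji.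
  by rewrite add_idm_neq 1?eq_sym // comp0r.
- move=> s t u v h g f; apply: add_homP => i l; rewrite /add_comp.
  under eq_bigr do rewrite comp_sumr.
  rewrite exchange_big /=; apply: eq_bigr => j _; rewrite comp_suml.
  by apply: eq_bigr => m _; rewrite compA.
Defined.

End AdditiveClosure.

Section LinearExtension.
Variables (k : fieldType) (K : choiceType) (V : lmodType k) (F : K -> V).

Definition lext (g : {malg k[K]}) : V := \sum_(p <- msupp g) g@_p *: F p.

Lemma lextEw (g : {malg k[K]}) (d : {fset K}) : (msupp g `<=` d)%fset ->
  lext g = \sum_(p <- d) g@_p *: F p.
Proof.
move=> /fsubsetP gd; rewrite /lext.
rewrite [RHS](bigID (fun p => p \in msupp g)) /= [X in _ + X]big1 => [|p].
  rewrite addr0 -[RHS]big_filter; apply: perm_big; apply: uniq_perm.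
  - exact: fset_uniq.
  - exact/filter_uniq/fset_uniq.
  - move=> p; rewrite mem_filter; case: (boolP (p \in msupp g)) => //= /gd.
    by move=> ->.
by move=> /mcoeff_outdom ->; rewrite scale0r.
Qed.

Lemma lext_lin a (g h : {malg k[K]}) : lext (a *: g + h) = a *: lext g + lext h.
Proof.
pose d := (msupp g `|` msupp h `|` msupp (a *: g + h))%fset.
rewrite !(@lextEw _ d); try by apply/fsubsetP=> x; rewrite !inE => ->; rewrite ?orbT.
rewrite scaler_sumr -big_split; apply: eq_bigr => p _ /=.
by rewrite mcoeffD mcoeffZ scalerDl scalerA.
Qed.

Lemma lextU p : lext << p >> = F p.
Proof. by rewrite (lextEw msuppU_le) big_seq_fset1 mcoeffUU scale1r. Qed.

Lemma lext0 : lext 0 = 0.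
Proof. by rewrite /lext msupp0 big_seq_fset0. Qed.

Lemma malg_lin_ind (P : {malg k[K]} -> Prop) : P 0 ->
  (forall a p g, P g -> P (a *: << p >> + g)) -> forall g, P g.
Proof.
move=> P0 PS g; rewrite (monalgE g); elim: (enum_fset _) => [|p r IH].
  by rewrite big_nil.
rewrite big_cons; set c := g@_p.
have -> : << c *g p >> = c *: << p >> :> {malg k[K]}.
  by apply/malgP => q; rewrite mcoeffZ !mcoeffU mulr_natr.
exact: PS.
Qed.

Lemma malg_lin_eq (L L' : {malg k[K]} -> V) :
  (forall a g h, L (a *: g + h) = a *: L g + L h) ->
  (forall a g h, L' (a *: g + h) = a *: L' g + L' h) ->
  (forall p, L << p >> = L' << p >>) -> forall g, L g = L' g.
Proof.
move=> linL linL' LL'.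
have L0 (M : {malg k[K]} -> V) :
    (forall a g h, M (a *: g + h) = a *: M g + M h) -> M 0 = 0.
  by move=> linM; have /eqP := linM 1 0 0;
     rewrite !scale1r addr0 -subr_eq0 opprD addNKr oppr_eq0 => /eqP.
by apply: malg_lin_ind => [|a p g IH]; rewrite ?L0 // linL linL' LL' IH.
Qed.

End LinearExtension.

(* tq_arr x y is the number of arrows x -> y; tq_trans x z says that z is the
   translate of x. *)
Record tquiver := TQuiver {
  vert :> Type;
  tq_arr : vert -> vert -> nat;
  tq_trans : vert -> vert -> Prop }.

Definition arrow (G : tquiver) (x y : G) := 'I_(tq_arr x y).

Definition tq_delete (G : tquiver) (D : G -> Prop) : tquiver :=
  @TQuiver {x : G | ~ D x}
    (fun x y => tq_arr (sval x) (sval y))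
    (fun x y => tq_trans (sval x) (sval y)).

Definition tq_isom (G H : tquiver) (phi : G -> H) :=
  [/\ bijective phi,
      forall x y, tq_arr (phi x) (phi y) = tq_arr x y
    & forall x z, tq_trans (phi x) (phi z) <-> tq_trans x z].

(* A choice, for all vertices x with translate z and all y, of a bijection from
   the arrows y -> x to the arrows z -> y: the mesh relations refer to one. *)
Record polarization (G : tquiver) := Polarization {
  pol :> forall x z : G, tq_trans x z -> forall y, arrow y x -> arrow z y;
  pol_bij : forall x z (t : tq_trans x z) y, bijective (@pol x z t y) }.

Section PathCategory.
Variables (k : fieldType) (G : tquiver).

Inductive qpath : G -> G -> Type :=
| PNil x : qpath x x
| PCons x y z : arrow x y -> qpath y z -> qpath x z.

HB.instance Definition _ x y := gen_eqMixin (qpath x y).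
HB.instance Definition _ x y := gen_choiceMixin (qpath x y).

Fixpoint pcat x y z (p : qpath x y) : qpath y z -> qpath x z :=
  match p with
  | PNil _ => id
  | PCons _ _ _ a p' => fun q => PCons a (pcat p' q)
  end.

Lemma pcat0 x y (p : qpath x y) : pcat p (PNil y) = p.
Proof. by elim: p => //= ? ? ? a p ->. Qed.

Lemma pcatA x y z w (p : qpath x y) (q : qpath y z) (r : qpath z w) :
  pcat p (pcat q r) = pcat (pcat p q) r.
Proof. by elim: p q => //= ? ? ? a p IH q; rewrite IH. Qed.

Definition path_hom (x y : G) : lmodType k := {malg k[qpath x y]}.

Definition path_comp x y z (g : path_hom y z) (f : path_hom x y) : path_hom x z :=
  lext (fun q => lext (fun p => << pcat p q >> : path_hom x z) f) g.

Lemma path_comp_linl x y z a (g g' : path_hom y z) (f : path_hom x y) :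
  path_comp (a *: g + g') f = a *: path_comp g f + path_comp g' f.
Proof. exact: lext_lin. Qed.

Lemma path_comp_linr x y z a (g : path_hom y z) (f f' : path_hom x y) :
  path_comp g (a *: f + f') = a *: path_comp g f + path_comp g f'.
Proof.
rewrite /path_comp /lext scaler_sumr -big_split; apply: eq_bigr => q _ /=.
by rewrite [X in _ *: X]lext_lin scalerDr !scalerA mulrC.
Qed.

Lemma path_compU x y z (p : qpath x y) (q : qpath y z) :
  path_comp (<< q >> : path_hom y z) (<< p >> : path_hom x y) = << pcat p q >>.
Proof. by rewrite /path_comp !lextU. Qed.

Lemma path_compA x y z w (h : path_hom z w) (g : path_hom y z) (f : path_hom x y) :
  path_comp h (path_comp g f) = path_comp (path_comp h g) f.
Proof.
move: f; apply: malg_lin_eq => [a f f'|a f f'|p].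
- by rewrite -path_comp_linr -path_comp_linr.
- exact: path_comp_linr.
move: g; apply: malg_lin_eq => [a g g'|a g g'|q].
- by rewrite -path_comp_linr -path_comp_linl.
- by rewrite -path_comp_linl -path_comp_linr.
move: h; apply: malg_lin_eq => [a h h'|a h h'|r].
- exact: path_comp_linl.
- by rewrite -path_comp_linl -path_comp_linl.
by rewrite !path_compU pcatA.
Qed.

Definition path_category : klincat k.
Proof.
exists G path_hom (fun x => << PNil x >>) path_comp.
- exact: path_comp_linl.
- exact: path_comp_linr.
- move=> x y; apply: malg_lin_eq => // [a f f'|p]; first exact: path_comp_linr.
  by rewrite path_compU pcat0.
- move=> x y; apply: malg_lin_eq => // [a f f'|p]; first exact: path_comp_linl.
  by rewrite path_compU.
- exact: path_compA.
Defined.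

(* The sum of the paths z -> y -> x over all arrows a : y -> x, the first arrow
   being the one attached to a by the polarization. For a quiver which is not
   locally finite, a finitely supported sum with infinite support is 0. *)
Definition mesh (s : polarization G) (x z : G) (t : tq_trans x z)
    : hom path_category z x :=
  \sum_(y \in [set: {classic G}]%classic) \sum_(a < tq_arr y x)
    (<< PCons (s x z t y a) (PCons a (PNil x)) >> : path_hom z x).

Definition is_mesh (s : polarization G) (z x : G) (f : hom path_category z x) :=
  exists t : tq_trans x z, f = mesh s t.

Definition mesh_category (s : polarization G) : klincat k :=
  quotient_category (@gen_ideal k path_category (is_mesh s)).

End PathCategory.

Record tricat (k : fieldType) := TriCat {
  tcat :> klincat k;
  tadd : additive_cat tcat;
  susp : equivalence tcat tcat;
  tri : forall A B C : tcat,
    hom tcat A B -> hom tcat B C -> hom tcat C (susp A) -> Prop;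
  tri_iso : forall A B C A' B' C'
      (f : hom tcat A B) (g : hom tcat B C) (h : hom tcat C (susp A))
      (f' : hom tcat A' B') (g' : hom tcat B' C') (h' : hom tcat C' (susp A'))
      (a : hom tcat A A') (b : hom tcat B B') (c : hom tcat C C'),
    is_iso a -> is_iso b -> is_iso c ->
    b \oc f = f' \oc a -> c \oc g = g' \oc b -> fmap susp a \oc h = h' \oc c ->
    tri f g h -> tri f' g' h';
  tri_id : forall A Z : tcat, is_zero Z ->
    tri (idm A) (0 : hom tcat A Z) (0 : hom tcat Z (susp A));
  tri_cone : forall A B (f : hom tcat A B),
    exists C (g : hom tcat B C) (h : hom tcat C (susp A)), tri f g h;
  tri_rot : forall A B C
      (f : hom tcat A B) (g : hom tcat B C) (h : hom tcat C (susp A)),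
    tri f g h <-> tri g h (- fmap susp f);
  tri_mor : forall A B C A' B' C'
      (f : hom tcat A B) (g : hom tcat B C) (h : hom tcat C (susp A))
      (f' : hom tcat A' B') (g' : hom tcat B' C') (h' : hom tcat C' (susp A'))
      (a : hom tcat A A') (b : hom tcat B B'),
    tri f g h -> tri f' g' h' -> b \oc f = f' \oc a ->
    exists c : hom tcat C C',
      c \oc g = g' \oc b /\ fmap susp a \oc h = h' \oc c;
  tri_oct : forall A B C A' B' C' (f : hom tcat A B) (g : hom tcat B C)
      (f1 : hom tcat B C') (f2 : hom tcat C' (susp A))
      (g1 : hom tcat C A') (g2 : hom tcat A' (susp B))
      (h1 : hom tcat C B') (h2 : hom tcat B' (susp A)),
    tri f f1 f2 -> tri g g1 g2 -> tri (g \oc f) h1 h2 ->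
    exists (a : hom tcat C' B') (b : hom tcat B' A'),
      [/\ tri a b (fmap susp f1 \oc g2),
          a \oc f1 = h1 \oc g, h2 \oc a = f2,
          b \oc h1 = g1 & g2 \oc b = fmap susp f \oc h2] }.

Arguments susp {k} _.
Arguments tri {k _ A B C} f g h.

(* spair A B is the natural isomorphism C(A, B) -> Hom_k(C(B, S A), k). *)
Record serre_functor (k : fieldType) (C : klincat k) := SerreFunctor {
  serre :> equivalence C C;
  spair : forall A B, hom C A B -> {scalar hom C B (serre A)};
  spair_lin : forall A B (a : k) (f f' : hom C A B) (u : hom C B (serre A)),
    spair (a *: f + f') u = a * spair f u + spair f' u;
  spair_inj : forall A B (f f' : hom C A B),
    (forall u, spair f u = spair f' u) -> f = f';
  spair_surj : forall A B (phi : {scalar hom C B (serre A)}),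
    exists f : hom C A B, forall u, spair f u = phi u;
  spair_natr : forall A B B' (b : hom C B B') (f : hom C A B)
      (u : hom C B' (serre A)),
    spair (b \oc f) u = spair f (u \oc b);
  spair_natl : forall A A' B (a : hom C A' A) (f : hom C A B)
      (u : hom C B (serre A')),
    spair (f \oc a) u = spair f (fmap serre a \oc u) }.

Section Triangles.
Variables (k : fieldType) (T : tricat k).

Definition ar_tau (S : serre_functor T) (A : T) : T := eqv_inv (susp T) (S A).

Definition tri_morphism A B C A' B' C'
    (f : hom T A B) (g : hom T B C) (h : hom T C (susp T A))
    (f' : hom T A' B') (g' : hom T B' C') (h' : hom T C' (susp T A'))
    (a : hom T A A') (b : hom T B B') (c : hom T C C') :=
  [/\ b \oc f = f' \oc a, c \oc g = g' \oc b & fmap (susp T) a \oc h = h' \oc c].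

End Triangles.

(* The part of a triangulated category to which AR triangles refer: the action
   of the suspension on morphisms plays no role. *)
Record pretri (k : fieldType) := PreTri {
  ptcat :> klincat k;
  ptsusp : ptcat -> ptcat;
  pttri : forall A B C : ptcat,
    hom ptcat A B -> hom ptcat B C -> hom ptcat C (ptsusp A) -> Prop }.

Section AR.
Variables (k : fieldType) (P : pretri k).

Definition ar_triangle A B C
    (u : hom P A B) (v : hom P B C) (w : hom P C (ptsusp A)) :=
  [/\ pttri u v w, indecomposable A, indecomposable C, w <> 0
    & forall D (t : hom P D C),
        ~ (exists s : hom P C D, t \oc s = idm C) ->
        exists t' : hom P D B, t = v \oc t'].

(* Both on the right (ending in C) and on the left (starting in A). *)
Definition has_ar_triangles :=
  (forall C : P, indecomposable C ->
    exists A B (u : hom P A B) (v : hom P B C) (w : hom P C (ptsusp A)),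
      ar_triangle u v w) /\
  (forall A : P, indecomposable A ->
    exists B C (u : hom P A B) (v : hom P B C) (w : hom P C (ptsusp A)),
      ar_triangle u v w).

(* The second argument A is the AR translate of the first one, C. *)
Definition ar_translate (C A : P) :=
  exists B (u : hom P A B) (v : hom P B C) (w : hom P C (ptsusp A)),
    ar_triangle u v w.

End AR.

Section ARQuiver.
Variables (k : fieldType) (C : klincat k) (tr : C -> C -> Prop).

Definition ind_class :=
  {c : C -> Prop | exists A, indecomposable A /\ c = iso A}.

Definition ind_repr (c : ind_class) : C := projT1 (cid (svalP c)).

Definition ar_quiver : tquiver := @TQuiver ind_class
  (fun x y => irr_dim (ind_repr x) (ind_repr y))
  (fun x z => exists A B, [/\ sval x A, sval z B & tr A B]).

End ARQuiver.

(* G stands for the AR quiver of C. *)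
Definition standard (k : fieldType) (C : klincat k) (G : tquiver) :=
  exists s : polarization G,
    inhabited (equivalence C (add_closure (mesh_category k s))).

Section Approximations.
Variables (k : fieldType) (C : klincat k) (X : C -> Prop).

Definition preenvelope M N (e : hom C M N) :=
  X N /\ forall N', X N' -> forall f : hom C M N',
    exists g : hom C N N', f = g \oc e.

Definition precover N M (e : hom C N M) :=
  X N /\ forall N', X N' -> forall f : hom C N' M,
    exists g : hom C N' N, f = e \oc g.

Definition preenveloping := forall M, exists N (e : hom C M N), preenvelope e.
Definition precovering := forall M, exists N (e : hom C N M), precover e.

Definition X_mono M N (mu : hom C M N) :=
  forall N', X N' -> forall f : hom C M N', exists g : hom C N N', f = g \oc mu.

Definition factors_through A B (f : hom C A B) :=
  exists N, X N /\ exists (u : hom C A N) (v : hom C N B), f = v \oc u.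

End Approximations.

Record Xclass (k : fieldType) (T : tricat k) := XClass {
  Xobj :> T -> Prop;
  X_iso : forall A B : T, iso A B -> Xobj A -> Xobj B;
  X_sum : forall A B D : T, direct_sum A B D -> Xobj A -> Xobj B -> Xobj D;
  X_summand : forall A B D : T, direct_sum A B D -> Xobj D -> Xobj A;
  X_precovering : precovering Xobj;
  X_preenveloping : preenveloping Xobj }.

Section Quotient.
Variables (k : fieldType) (T : tricat k) (X : Xclass T).

Definition factor_submod (A B : T) : submodule (hom T A B).
Proof.
exists (@factors_through k T X A B).
- have [N [e [XN _]]] := X_preenveloping X A.
  by exists N; split=> //; exists 0, 0; rewrite comp0l.
- move=> a f g [M [XM [u [v ->]]]] [N [XN [u' [v' ->]]]].
  have [D MND] := (tadd T).2 M N; exists D; split; first exact: X_sum MND XM XN.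
  have [i [j [p [q [pi1 qj1 pj0 qi0 _]]]]] := MND.
  exists (a *: (i \oc u) + j \oc u'), (v \oc p + v' \oc q).
  rewrite comp_linr -[v \oc p]scale1r !comp_linl !scale1r.
  rewrite -!compA !(compA p) !(compA q) pi1 qj1 pj0 qi0.
  by rewrite !comp1m !comp0l !comp0r addr0 add0r.
Defined.

Definition factor_ideal : ideal T.
Proof.
exists factor_submod.
- move=> A B D g f [N [XN [u [v ->]]]].
  by exists N; split=> //; exists u, (g \oc v); rewrite compA.
- move=> A B D g f [N [XN [u [v ->]]]].
  by exists N; split=> //; exists (u \oc f), v; rewrite compA.
Defined.

Definition TX_cat : klincat k := quotient_category factor_ideal.

Definition under_X (A B : T) (f : hom T A B) : hom TX_cat A B :=
  qpi factor_ideal f.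

(* A chosen triangle M -> X_M -> sigma M -> Susp M for every M, in which the
   first morphism is an X-preenvelope. *)
Record envelopes := Envelopes {
  env : T -> T;
  sigma : T -> T;
  env1 : forall M, hom T M (env M);
  env2 : forall M, hom T (env M) (sigma M);
  env3 : forall M, hom T (sigma M) (susp T M);
  env_pre : forall M, preenvelope X (env1 M);
  env_tri : forall M, tri (env1 M) (env2 M) (env3 M) }.

Variable E : envelopes.

Definition sigma_lift M N (mu : hom T M N) (s : hom T (sigma E M) (sigma E N)) :=
  exists xi : hom T (env E M) (env E N),
    tri_morphism (env1 E M) (env2 E M) (env3 E M)
                 (env1 E N) (env2 E N) (env3 E N) mu xi s.

(* Any two choices of mu, xi and s give the same morphism of T_X. *)
Definition sigma_map M N (f : hom TX_cat M N) : hom TX_cat (sigma E M) (sigma E N) :=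
  under_X (xget 0 [set s | exists mu, under_X mu = f /\ sigma_lift mu s]%classic).

Definition TX_std_tri (M N P : T) (u : hom TX_cat M N) (v : hom TX_cat N P)
    (w : hom TX_cat P (sigma E M)) :=
  exists (mu : hom T M N) (nu : hom T N P) (p : hom T P (susp T M))
         (n : hom T N (env E M)) (pi : hom T P (sigma E M)),
    [/\ X_mono X mu, tri mu nu p,
        tri_morphism mu nu p (env1 E M) (env2 E M) (env3 E M) (idm M) n pi
      & [/\ u = under_X mu, v = under_X nu & w = under_X pi]].

Definition TX_tri (M N P : TX_cat) (u : hom TX_cat M N) (v : hom TX_cat N P)
    (w : hom TX_cat P (sigma E M)) :=
  exists (M' N' P' : TX_cat) (u' : hom TX_cat M' N') (v' : hom TX_cat N' P')
         (w' : hom TX_cat P' (sigma E M'))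
         (a : hom TX_cat M' M) (b : hom TX_cat N' N) (c : hom TX_cat P' P),
    TX_std_tri u' v' w' /\ [/\ is_iso a, is_iso b & is_iso c] /\
    [/\ b \oc u' = u \oc a, c \oc v' = v \oc b & sigma_map a \oc w' = w \oc c].

Definition TX : pretri k := @PreTri k TX_cat (sigma E) TX_tri.

End Quotient.

(* Main.v *)
From HB Require Import structures.
From mathcomp Require Import all_boot all_algebra.
From mathcomp Require Import boolp classical_sets fsbigop.
From mathcomp Require Import finmap monalg.
Require Import Defs.

Set Implicit Arguments.
Unset Strict Implicit.
Unset Printing Implicit Defensive.

Import GRing.Theory.
Local Open Scope ring_scope.

(** Let [C] be indecomposable in T. The nonisomorphisms form the radical of [End C],
    with residue field k, and the Serre dual of the residue functional is a morphism
    [C -> susp (tau C)]. Serre duality on both sides shows that it vanishes on every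
    nonretraction into [C] and is killed by every morphism out of [susp (tau C)] of
    the form [susp f], where [f : tau C -> tau D] and [C] is not a summand of [D]; it
    is the connecting morphism of the AR triangle ending in [C] ([ar_exists]).

    Suppose that [C] is not in X. As tau X = X, the second property makes the first
    morphism of this triangle an X-monomorphism, so that the triangle descends to T_X.
    It remains an AR triangle there: nonretractions of T_X come from nonretractions
    of T, and a morphism into [sigma M] is zero in T_X exactly when its composite
    with [sigma M -> susp M] is zero ([to_sigma_eq0], again by Serre duality). Every
    indecomposable of T_X is isomorphic to one of T outside X ([quot_indec_lift]),
    which gives all AR triangles.

    For the quivers, isomorphisms between indecomposables outside X lift from T_X to
    T, and the AR translate is unique in T_X ([ar_triangle_unique]), hence given by
    tau. A morphism between such indecomposables that factors through X is a product
    of two radical morphisms, so passing to T_X changes neither rad / rad^2 nor the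
    numbers of arrows ([quot_irr_dim]).

    If T is standard, it receives a full functor [W] from the path category of its AR
    quiver [G], with kernel the mesh ideal. This functor need not send the vertex of
    an object to that object, so the structure is recovered from [W]: the mesh
    relations are homogeneous, which makes every [W u] indecomposable ([W_local]) and
    identifies rad and rad^2 with the combinations of paths of length at least 1 and
    at least 2 ([W_rad], [W_rad2]); and at a vertex with an arrow into it the
    translation of [G] agrees with tau ([W_translate]). In T_X the paths through
    vertices sent to X vanish. What is left of a mesh at a remaining vertex is the
    mesh of the smaller quiver ([mesh_split]), and no further relations arise
    ([restr_mesh], [del_functor_ker]), so T_X is the additive closure of the mesh
    category of the smaller quiver. *)

(** * Isomorphisms, idempotents and finite direct sums *)

(** Head and tail of a dependent family; the transport along equalities of indices
    stays inside this proof. *)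
Lemma ord_family_cons n (P : 'I_n.+1 -> Type) (x0 : P ord0)
    (xs : forall l, P (lift ord0 l)) :
  {f : forall l, P l | f ord0 = x0 /\ forall l, f (lift ord0 l) = xs l}.
Proof.
have f l : {x : P l | (forall e : ord0 = l, x = ecast l (P l) e x0) /\
                      forall j (e : lift ord0 j = l), x = ecast l (P l) e (xs j)}.
  case: (unliftP ord0 l) => [j|] ->.
    exists (xs j); split=> [e|j' e]; first by have /eqP := e; rewrite -val_eqE.
    by have e' := lift_inj e; rewrite e' in e *; rewrite eq_axiomK.
  exists x0; split=> [e|j e]; first by rewrite eq_axiomK.
  by have /eqP := e; rewrite -val_eqE.
exists (fun l => sval (f l)); split=> [|l].
  by have [/(_ erefl)] := svalP (f ord0).
by have [_ /(_ l erefl)] := svalP (f (lift ord0 l)).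
Qed.

Section Basics.
Variables (k : fieldType) (C : klincat k).
Implicit Types A B D : C.

Lemma compDl A B D (g g' : hom C B D) (f : hom C A B) :
  (g + g') \oc f = g \oc f + g' \oc f.
Proof. by rewrite -[g]scale1r comp_linl !scale1r. Qed.

Lemma compDr A B D (g : hom C B D) (f f' : hom C A B) :
  g \oc (f + f') = g \oc f + g \oc f'.
Proof. by rewrite -[f]scale1r comp_linr !scale1r. Qed.

Lemma compZl A B D a (g : hom C B D) (f : hom C A B) :
  (a *: g) \oc f = a *: (g \oc f).
Proof. by rewrite -[a *: g]addr0 comp_linl comp0l addr0. Qed.

Lemma compZr A B D a (g : hom C B D) (f : hom C A B) :
  g \oc (a *: f) = a *: (g \oc f).
Proof. by rewrite -[a *: f]addr0 comp_linr comp0r addr0. Qed.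

Lemma compNl A B D (g : hom C B D) (f : hom C A B) : (- g) \oc f = - (g \oc f).
Proof. by rewrite -scaleN1r compZl scaleN1r. Qed.

Lemma compNr A B D (g : hom C B D) (f : hom C A B) : g \oc (- f) = - (g \oc f).
Proof. by rewrite -scaleN1r compZr scaleN1r. Qed.

Lemma is_iso_idm A : is_iso (idm A).
Proof. by exists (idm A); rewrite comp1m. Qed.

Lemma is_iso_comp A B D (g : hom C B D) (f : hom C A B) :
  is_iso g -> is_iso f -> is_iso (g \oc f).
Proof.
move=> [g' [g'g gg']] [f' [f'f ff']]; exists (f' \oc g').
by rewrite !compA -(compA f') g'g compm1 -(compA g) ff' compm1.
Qed.

Lemma is_iso_scale A B c (f : hom C A B) : c != 0 -> is_iso f -> is_iso (c *: f).
Proof.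
move=> c0 [g [gf fg]]; exists (c^-1 *: g).
by rewrite !compZl !compZr !scalerA mulVf // mulfV // !scale1r.
Qed.

Lemma is_iso_lr A B (f : hom C A B) (g h : hom C B A) :
  g \oc f = idm A -> f \oc h = idm B -> is_iso f.
Proof.
move=> gf fh; exists h; split=> //.
by rewrite -[h]comp1m -gf -(compA g) fh compm1.
Qed.

Lemma is_iso_two_sided A B (f : hom C A B) (g h : hom C B A) :
  is_iso (g \oc f) -> is_iso (f \oc h) -> is_iso f.
Proof.
move=> [u [ugf _]] [v [_ fhv]].
by apply: (@is_iso_lr _ _ _ (u \oc g) (h \oc v)); rewrite -?compA // compA.
Qed.

Lemma iso_refl A : iso A A.
Proof. by exists (idm A); apply: is_iso_idm. Qed.

Lemma iso_sym A B : iso A B -> iso B A.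
Proof. by move=> [f [g [gf fg]]]; exists g, f. Qed.

Lemma iso_trans A B D : iso A B -> iso B D -> iso A D.
Proof. by move=> [f fi] [g gi]; exists (g \oc f); apply: is_iso_comp. Qed.

Lemma iso_classE A B : iso A B -> iso A = iso B.
Proof.
move=> AB; apply/funext => D; apply/propext; split; last exact: iso_trans.
exact/iso_trans/iso_sym.
Qed.

Lemma zero_hom A B (f : hom C A B) : is_zero A \/ is_zero B -> f = 0.
Proof. by case=> z; [rewrite -[f]compm1 z comp0r|rewrite -[f]comp1m z comp0l]. Qed.

Fixpoint epow A (f : hom C A A) n : hom C A A :=
  if n is m.+1 then f \oc epow f m else idm A.

Lemma idem_epow A (e : hom C A A) n : e \oc e = e -> epow e n.+1 = e.
Proof. by move=> ee; elim: n => [|n IH]; [rewrite /= compm1|rewrite /= -/(epow e n.+1) IH]. Qed.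

Lemma epow_iso A (f : hom C A A) n : is_iso f -> is_iso (epow f n).
Proof.
by move=> fi; elim: n => [|n IH]; [apply: is_iso_idm|apply: is_iso_comp].
Qed.

Lemma nilpotent_not_iso A (f : hom C A A) n :
  ~ is_zero A -> epow f n = 0 -> ~ is_iso f.
Proof.
move=> nzA fn0 /(epow_iso n); rewrite fn0 => -[g [g0 _]]; apply: nzA.
by rewrite /is_zero -g0 comp0r.
Qed.

(** The inverse is the finite geometric series. *)
Lemma nilpotent_1B_iso A (f : hom C A A) n : epow f n = 0 -> is_iso (idm A - f).
Proof.
have comm m : f \oc epow f m = epow f m \oc f.
  by elim: m => [|m IH]; rewrite /= ?comp1m ?compm1 // {1}IH compA.
pose s m : hom C A A := \sum_(i < m) epow f i.
have s1 m : (idm A - f) \oc s m = idm A - epow f m.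
  elim: m => [|m IH]; first by rewrite /s big_ord0 comp0r subrr.
  by rewrite /s big_ord_recr /= compDr -/(s m) IH compBl comp1m addrA subrK.
have s2 m : s m \oc (idm A - f) = idm A - epow f m.
  elim: m => [|m IH]; first by rewrite /s big_ord0 comp0l subrr.
  rewrite /s big_ord_recr /= compDl -/(s m) IH compBr compm1 -comm.
  by rewrite addrA subrK.
by move=> fn0; exists (s n); rewrite s1 s2 fn0 subr0.
Qed.

(** The form of indecomposability that full and faithful functors transport; the
    two agree when idempotents split. *)
Definition idem_trivial A :=
  ~ is_zero A /\ forall e : hom C A A, e \oc e = e -> e = 0 \/ e = idm A.

Lemma idem_trivial_indec A : idem_trivial A -> indecomposable A.
Proof.
move=> [nz tr]; split=> // B D [i [j [p [q [pi qj pj qi ipjq]]]]].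
have ee : (i \oc p) \oc (i \oc p) = i \oc p by rewrite compA -(compA i) pi compm1.
have [e0|e1] := tr _ ee; [left|right].
  by rewrite /is_zero -pi -[p]compm1 -ipjq e0 add0r -compA -(compA j) qi !comp0r.
have jq : j \oc q = 0 by apply: (addrI (i \oc p)); rewrite ipjq addr0 e1.
by rewrite /is_zero -qj -[q]compm1 -e1 !compA qi !comp0l.
Qed.

Lemma idem_complement A (e : hom C A A) : e \oc e = e ->
  [/\ (idm A - e) \oc (idm A - e) = idm A - e,
      e \oc (idm A - e) = 0 & (idm A - e) \oc e = 0].
Proof.
move=> ee; rewrite !(compBl, compBr, comp1m, compm1) ee !subrr.
by split=> //; rewrite subr0.
Qed.

Lemma split_pair_direct_sum A B D (e : hom C A A)
    (r : hom C A B) (s : hom C B A) (r' : hom C A D) (s' : hom C D A) :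
  e \oc e = e -> r \oc s = idm B -> s \oc r = e ->
  r' \oc s' = idm D -> s' \oc r' = idm A - e -> direct_sum B D A.
Proof.
move=> ee rs sr rs' sr'; have [_ ef fe] := idem_complement ee.
exists s, s', r, r'; split=> //; last by rewrite sr sr' addrC subrK.
  have -> : r \oc s' = r \oc (s \oc r) \oc (s' \oc r') \oc s'.
    by rewrite !compA rs comp1m -!compA rs' compm1.
  by rewrite sr sr' -(compA r) ef comp0r comp0l.
have -> : r' \oc s = r' \oc (s' \oc r') \oc (s \oc r) \oc s.
  by rewrite !compA rs' comp1m -!compA rs compm1.
by rewrite sr sr' -(compA r') fe comp0r comp0l.
Qed.

Lemma indec_idem_trivial A :
  split_idempotents C -> indecomposable A -> idem_trivial A.
Proof.
move=> spl [nz ind]; split=> // e ee; have [ff _ _] := idem_complement ee.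
have [B [r [s [rs sr]]]] := spl A e ee.
have [D [r' [s' [rs' sr']]]] := spl A _ ff.
have [z|z] := ind B D (split_pair_direct_sum ee rs sr rs' sr').
  by left; rewrite -sr (zero_hom r) ?comp0r //; right.
right; apply/esym/eqP; rewrite -subr_eq0 -sr' (zero_hom r') ?comp0r //.
by right.
Qed.

(** The complement is the image of the idempotent [idm D - i \oc p]. *)
Lemma retract_direct_sum A D (i : hom C A D) (p : hom C D A) :
  split_idempotents C -> p \oc i = idm A -> exists B, direct_sum A B D.
Proof.
move=> spl pi.
have ee : (i \oc p) \oc (i \oc p) = i \oc p by rewrite compA -(compA i) pi compm1.
have [ff _ _] := idem_complement ee.
have [B [r [s [rs sr]]]] := spl D _ ff; exists B.
exact: (split_pair_direct_sum ee pi _ rs sr).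
Qed.

Definition is_nsum n (t : 'I_n -> C) A :=
  exists (i : forall l, hom C (t l) A) (p : forall l, hom C A (t l)),
    [/\ forall l, p l \oc i l = idm (t l),
        forall l m, l != m -> p l \oc i m = 0
      & \sum_l i l \oc p l = idm A].

Lemma nsum_unique n (t : 'I_n -> C) A B : is_nsum t A -> is_nsum t B -> iso A B.
Proof.
move=> [i [p [pi pi0 ip]]] [j [q [qj qj0 jq]]].
have key A' B' (i1 : forall l, hom C (t l) A') p1 (j1 : forall l, hom C (t l) B') q1 :
    (forall l, q1 l \oc j1 l = idm (t l)) -> (forall l m, l != m -> q1 l \oc j1 m = 0) ->
    \sum_l i1 l \oc p1 l = idm A' ->
    (\sum_l i1 l \oc q1 l) \oc (\sum_l j1 l \oc p1 l) = idm A'.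
  move=> h1 h2 <-; rewrite comp_suml; apply: eq_bigr => l _.
  rewrite comp_sumr (bigD1 l) //= compA -(compA (i1 l)) h1 compm1 big1 ?addr0 //.
  by move=> m ml; rewrite compA -(compA (i1 l)) h2 1?eq_sym // comp0r comp0l.
by exists (\sum_l j l \oc p l), (\sum_l i l \oc q l); split; apply: key.
Qed.

Lemma nsum_exists : additive_cat C -> forall n (t : 'I_n -> C), exists A, is_nsum t A.
Proof.
move=> [[Z z] dsum]; elim=> [|n IH] t.
  exists Z, (fun=> 0), (fun=> 0); split; first by case.
    by case.
  by rewrite big_ord0 z.
have [A [i [p [pi pi0 ip]]]] := IH (fun l => t (lift ord0 l)).
have [D [a [b [c [d [ca db cb da abE]]]]]] := dsum (t ord0) A.
have [i' [i'0 i'S]] := ord_family_cons (P := fun l => hom C (t l) D) a (fun l => b \oc i l).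
have [p' [p'0 p'S]] := ord_family_cons (P := fun l => hom C D (t l)) c (fun l => p l \oc d).
exists D, i', p'; split.
- move=> l; case: (unliftP ord0 l) => [j|] ->; rewrite ?i'0 ?p'0 // i'S p'S.
  by rewrite compA -(compA (p j)) db compm1 pi.
- move=> l m; case: (unliftP ord0 l) => [l'|] ->; case: (unliftP ord0 m) => [m'|] ->;
    rewrite ?eqxx // ?i'0 ?p'0 ?i'S ?p'S.
  + rewrite (inj_eq lift_inj) => lm.
    by rewrite compA -(compA (p l')) db compm1 pi0.
  + by rewrite -compA da comp0r.
  + by rewrite compA cb comp0l.
- rewrite big_ord_recl i'0 p'0 -abE; congr (_ + _).
  under eq_bigr => l _ do rewrite i'S p'S compA -(compA b).
  by rewrite -comp_suml -comp_sumr ip compm1.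
Qed.

(** For images in a quotient category, where some summands vanish. *)
Lemma nsum_drop_zero n (t : 'I_n -> C) A : is_nsum t A ->
  exists m (f : 'I_m -> 'I_n), (forall l, ~ is_zero (t (f l))) /\ is_nsum (fun l => t (f l)) A.
Proof.
move=> [i [p [pi pi0 ip]]].
pose D := [set l : 'I_n | `[< ~ is_zero (t l) >]]; exists #|D|, enum_val; split.
  by move=> l; have := enum_valP l; rewrite inE => /asboolP.
exists (fun l => i (enum_val l)), (fun l => p (enum_val l)); split=> // [l m lm|].
  by apply: pi0; rewrite (inj_eq enum_val_inj).
rewrite -(big_enum_val (fun l => i l \oc p l)) -ip [RHS](bigID [in D]) /=.
rewrite [X in _ = _ + X]big1 ?addr0 // => l; rewrite inE => /asboolPn/contrapT z.
by rewrite (zero_hom (p l)) ?comp0r //; right.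
Qed.

(** The idempotents [i l \oc p l] add up to the identity, so they are not all 0;
    one that is nonzero must be the identity. *)
Lemma idem_trivial_nsum n (t : 'I_n -> C) A : idem_trivial A ->
  is_nsum t A -> exists l, iso (t l) A.
Proof.
move=> [nz tr] [i [p [pi _ ip]]].
have [l lnz] : exists l, i l \oc p l <> 0.
  apply/not_existsP => ip0; apply: nz; rewrite /is_zero -ip big1 // => l _.
  by apply: contrapT => h; apply: (ip0 l).
have idem : (i l \oc p l) \oc (i l \oc p l) = i l \oc p l.
  by rewrite compA -(compA (i l)) pi compm1.
exists l; have [/lnz//|ip1] := tr _ idem.
by exists (i l), (p l).
Qed.

End Basics.

(** * Linear functors and equivalences *)

Section Functors.
Variables (k : fieldType) (C D : klincat k) (F : klinfunctor C D).
Implicit Types A B : C.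

Lemma fmapD A B (f g : hom C A B) : fmap F (f + g) = fmap F f + fmap F g.
Proof. by rewrite -[f]scale1r fmap_lin !scale1r. Qed.

Lemma fmap0 A B : fmap F (0 : hom C A B) = 0.
Proof. by apply: (addrI (fmap F 0)); rewrite -fmapD !addr0. Qed.

Lemma fmapZ A B a (f : hom C A B) : fmap F (a *: f) = a *: fmap F f.
Proof. by rewrite -[a *: f]addr0 fmap_lin fmap0 addr0. Qed.

Lemma fmapN A B (f : hom C A B) : fmap F (- f) = - fmap F f.
Proof. by rewrite -scaleN1r fmapZ scaleN1r. Qed.

Lemma fmapB A B (f g : hom C A B) : fmap F (f - g) = fmap F f - fmap F g.
Proof. by rewrite fmapD fmapN. Qed.

Lemma fmap_sum (I : Type) (r : seq I) (P : pred I) A B (f : I -> hom C A B) :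
  fmap F (\sum_(i <- r | P i) f i) = \sum_(i <- r | P i) fmap F (f i).
Proof.
by elim/big_rec2: _ => [|i x y _ <-]; [apply: fmap0|apply: fmapD].
Qed.

Lemma fmap_is_iso A B (f : hom C A B) : is_iso f -> is_iso (fmap F f).
Proof. by move=> [g [gf fg]]; exists (fmap F g); rewrite -!fmapM gf fg !fmap1. Qed.

Lemma fmap_iso A B : iso A B -> iso (F A) (F B).
Proof. by move=> [f fi]; exists (fmap F f); apply: fmap_is_iso. Qed.

Lemma fmap_epow A (f : hom C A A) n : fmap F (epow f n) = epow (fmap F f) n.
Proof. by elim: n => [|n IH] /=; rewrite ?fmap1 // fmapM IH. Qed.

Lemma fmap_zero A : is_zero A -> is_zero (F A).
Proof. by rewrite /is_zero -fmap1 => ->; apply: fmap0. Qed.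

Lemma fmap_nsum n (t : 'I_n -> C) A : is_nsum t A -> is_nsum (fun l => F (t l)) (F A).
Proof.
move=> [i [p [pi pi0 ip]]]; exists (fun l => fmap F (i l)), (fun l => fmap F (p l)).
split=> [l|l m lm|]; rewrite -?fmapM ?pi ?fmap1 //; first by rewrite pi0 // fmap0.
by under eq_bigr => l _ do rewrite -fmapM; rewrite -fmap_sum ip fmap1.
Qed.

Lemma fmap_direct_sum A B E : direct_sum A B E -> direct_sum (F A) (F B) (F E).
Proof.
move=> [i [j [p [q [pi qj pj qi E1]]]]].
exists (fmap F i), (fmap F j), (fmap F p), (fmap F q).
by split; rewrite -!fmapM ?pi ?qj ?pj ?qi ?fmap1 ?fmap0 // -fmapD E1 fmap1.
Qed.

Definition full := forall A B (g : hom D (F A) (F B)), exists f, fmap F f = g.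
Definition faithful := forall A B (f : hom C A B), fmap F f = 0 -> f = 0.

Lemma faithful_inj A B (f g : hom C A B) : faithful -> fmap F f = fmap F g -> f = g.
Proof. by move=> fF fg; apply/eqP; rewrite -subr_eq0; apply/eqP/fF; rewrite fmapB fg subrr. Qed.

Lemma ff_reflect_iso A B (f : hom C A B) :
  full -> faithful -> is_iso (fmap F f) -> is_iso f.
Proof.
move=> fu fa [g [gf fg]]; have [h hg] := fu _ _ g; subst g.
by exists h; split; apply: (faithful_inj fa); rewrite fmapM fmap1.
Qed.

Lemma ff_reflect A B : full -> faithful -> iso (F A) (F B) -> iso A B.
Proof.
move=> fu fa [g gi]; have [f fg] := fu _ _ g; subst g.
by exists f; apply: ff_reflect_iso.
Qed.

Lemma ff_idem_trivial A : full -> faithful -> idem_trivial A -> idem_trivial (F A).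
Proof.
move=> fu fa [nz tr]; split=> [z|e ee].
  by apply: nz; apply: fa; rewrite fmap1.
have [f fe] := fu _ _ e; subst e.
have ff : f \oc f = f by apply: (faithful_inj fa); rewrite fmapM.
by have [->|->] := tr _ ff; [left; apply: fmap0|right; apply: fmap1].
Qed.

Lemma faithful_idem_trivial A : faithful -> idem_trivial (F A) -> idem_trivial A.
Proof.
move=> fa [nz tr]; split=> [/fmap_zero//|e ee].
have FeFe : fmap F e \oc fmap F e = fmap F e by rewrite -fmapM ee.
by have [e0|e1] := tr _ FeFe; [left; apply: fa|right; apply: (faithful_inj fa); rewrite fmap1].
Qed.

End Functors.

Lemma cancel_iso_l k (C : klincat k) (A B D : C) (g : hom C B D) (f f' : hom C A B) :
  is_iso g -> g \oc f = g \oc f' -> f = f'.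
Proof. by move=> [h [hg _]] e; rewrite -[f]comp1m -[f']comp1m -hg -!compA e. Qed.

Lemma cancel_iso_r k (C : klincat k) (A B D : C) (g g' : hom C B D) (f : hom C A B) :
  is_iso f -> g \oc f = g' \oc f -> g = g'.
Proof. by move=> [h [_ fh]] e; rewrite -[g]compm1 -[g']compm1 -fh !compA e. Qed.

Lemma full_comp k (C D E : klincat k) (G : klinfunctor D E) (F : klinfunctor C D) :
  full G -> full F -> full (comp_functor G F).
Proof.
by move=> fG fF A B h; have [g <-] := fG _ _ h; have [f <-] := fF _ _ g; exists f.
Qed.

Section QuotientFunctor.
Variables (k : fieldType) (C : klincat k) (I : ideal C).

Definition quotient_functor : klinfunctor C (quotient_category I) :=
  @KLinFunctor k C (quotient_category I) (fun A => A) (fun A B f => qpi I f)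
    (fun A B a f g => qpi_lin I a f g) (fun A => erefl)
    (fun A B D g f => esym (qcompE I g f)).

Lemma quotient_full : full quotient_functor.
Proof. by move=> A B g; exists (repr g); apply: qpi_repr. Qed.

Lemma quotient_eq0 A B (f : hom C A B) : fmap quotient_functor f = 0 <-> I A B f.
Proof.
split=> [f0|fI]; last by apply/(lpi_eq (I A B) f 0); rewrite subr0.
by rewrite -[f]subr0; apply/(lpi_eq (I A B)).
Qed.

End QuotientFunctor.

Section Equivalences.
Variables (k : fieldType) (C D : klincat k) (F : equivalence C D).

Lemma eqv_fun_faithful : faithful (eqv_fun F).
Proof.
move=> A B f f0; have /= := nt_nat (eqv_unit F) f.
rewrite f0 fmap0 comp0l => /esym h.
by apply: (cancel_iso_l (nt_iso (eqv_unit F) B)); rewrite h comp0r.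
Qed.

Lemma eqv_inv_faithful : faithful (eqv_inv F).
Proof.
move=> A B f f0; have /= := nt_nat (eqv_counit F) f.
rewrite f0 fmap0 comp0r => h.
by apply: (cancel_iso_r (nt_iso (eqv_counit F) A)); rewrite h comp0l.
Qed.

(** Conjugating [eqv_inv F g] by the unit gives a preimage of [g], as the faithful
    functor [eqv_inv F] sees by naturality; dually with the counit. *)
Lemma eqv_fun_full : full (eqv_fun F).
Proof.
move=> A B g; pose u := eqv_unit F; have [v [vu uv]] := nt_iso u B.
exists (v \oc fmap (eqv_inv F) g \oc u A).
apply: (faithful_inj eqv_inv_faithful); apply: (cancel_iso_r (nt_iso u A)).
by rewrite [LHS](nt_nat u) /= !compA uv comp1m.
Qed.

Lemma eqv_inv_full : full (eqv_inv F).
Proof.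
move=> A B g; pose u := eqv_counit F; have [v [vu uv]] := nt_iso u A.
exists (u B \oc fmap F g \oc v).
apply: (faithful_inj eqv_fun_faithful); apply: (cancel_iso_l (nt_iso u B)).
by rewrite -[LHS](nt_nat u) /= -!compA vu compm1.
Qed.

End Equivalences.

(** The inverse is a choice of preimages of objects, with morphisms transported by
    the chosen isomorphisms. *)
Lemma ff_ess_equivalence k (C D : klincat k) (H : klinfunctor C D) :
  full H -> faithful H -> (forall d : D, exists c, iso (H c) d) ->
  inhabited (equivalence D C).
Proof.
move=> fu fa ess.
pose G0 d : C := projT1 (cid (ess d)).
pose eP d : iso (H (G0 d)) d := projT2 (cid (ess d)).
pose e d : hom D (H (G0 d)) d := projT1 (cid (eP d)).
have eI d : is_iso (e d) := projT2 (cid (eP d)).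
pose e' d : hom D d (H (G0 d)) := projT1 (cid (eI d)).
have e'e d : e' d \oc e d = idm _ by have [] := projT2 (cid (eI d)).
have ee' d : e d \oc e' d = idm _ by have [] := projT2 (cid (eI d)).
pose G1 A B (f : hom D A B) := projT1 (cid (fu _ _ (e' B \oc f \oc e A))).
have G1E A B (f : hom D A B) : fmap H (G1 A B f) = e' B \oc f \oc e A.
  exact: (projT2 (cid (fu _ _ (e' B \oc f \oc e A)))).
have G1lin A B a f g : G1 A B (a *: f + g) = a *: G1 A B f + G1 A B g.
  by apply: (faithful_inj fa); rewrite fmap_lin !G1E comp_linr comp_linl.
have G1id A : G1 A A (idm A) = idm (G0 A).
  by apply: (faithful_inj fa); rewrite fmap1 G1E compm1 e'e.
have G1M A B E g f : G1 A E (g \oc f) = G1 B E g \oc G1 A B f.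
  by apply: (faithful_inj fa); rewrite fmapM !G1E -!compA (compA (e B)) ee' comp1m.
pose G := KLinFunctor G1lin G1id G1M.
have ei d : is_iso (e' d) by exists (e d).
have unit : nat_iso (id_functor D) (comp_functor H G).
  exists e' => [//|A B f] /=.
  by rewrite G1E -!compA ee' compm1.
pose c A : hom C (G0 (H A)) A := projT1 (cid (fu _ _ (e (H A)))).
have cE A : fmap H (c A) = e (H A) := projT2 (cid (fu _ _ (e (H A)))).
have counit : nat_iso (comp_functor G H) (id_functor C).
  exists c => [A|A B f] /=; first by apply: (ff_reflect_iso fu fa); rewrite cE.
  apply: (faithful_inj fa); rewrite !fmapM !cE G1E !compA ee' comp1m //.
by constructor; apply: (@Equivalence k D C G H).
Qed.

(** * Finite dimensional spaces *)

Section LinearAlgebra.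
Variables (k : fieldType).
Implicit Types V W : lmodType k.

Definition spanned n V :=
  exists b : 'I_n -> V, forall v, exists c : 'I_n -> k, v = \sum_i c i *: b i.

(** A relation with a nonzero coefficient at [j] expresses [b j] by the others. *)
Lemma spanned_drop n V (b : 'I_n.+1 -> V) (c : 'I_n.+1 -> k) j :
  (forall v, exists c' : 'I_n.+1 -> k, v = \sum_i c' i *: b i) ->
  \sum_i c i *: b i = 0 -> c j != 0 -> spanned n V.
Proof.
move=> sp c0 cj; exists (fun l => b (lift j l)) => v; have [d ->] := sp v.
have bj : b j = - \sum_l (c j)^-1 *: (c (lift j l) *: b (lift j l)).
  rewrite -scaler_sumr; apply: (scalerI cj); rewrite scalerN scalerA divff // scale1r.
  by apply/eqP; rewrite -addr_eq0 -[X in _ == X]c0 [X in _ == X](bigD1_ord j).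
exists (fun l => d (lift j l) - d j * (c j)^-1 * c (lift j l)).
rewrite (bigD1_ord j) //= bj scalerN scaler_sumr addrC -sumrB.
by apply: eq_bigr => l _; rewrite scalerBl !scalerA.
Qed.

Lemma spanned_hom_finite (C : klincat k) (A B : C) :
  hom_finite C -> exists n, spanned n (hom C A B).
Proof.
move=> /(_ A B) [s sP]; exists (size s), (fun i => s`_i) => v.
by have [c cE] := sP v; exists (fun i => c i).
Qed.

(** A nonzero vector of the kernel is a relation between the images of a basis. *)
Lemma spanned_quotient n V W (L : V -> W) v0 :
  (forall a u v, L (a *: u + v) = a *: L u + L v) ->
  (forall w, exists v, L v = w) -> v0 <> 0 -> L v0 = 0 -> spanned n V ->
  exists2 m, n = m.+1 & spanned m W.
Proof.
move=> linL surL nz0 L0 [b bP].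
have Lz : L 0 = 0.
  by apply: (addrI (L 0)); have := linL 1 0 0; rewrite !scale1r !addr0 => <-.
have Lsum (c : 'I_n -> k) : L (\sum_i c i *: b i) = \sum_i c i *: L (b i).
  by elim/big_rec2: _ => [//|i x y _ <-]; rewrite linL.
have [c cE] := bP v0.
have [j cj] : exists j, c j != 0.
  apply: contrapT => /forallNP c0; apply: nz0; rewrite cE big1 // => i _.
  by move/negP: (c0 i); rewrite negbK => /eqP ->; rewrite scale0r.
case: n b bP Lsum c cE j cj => [b bP Lsum c cE [] //|n b bP Lsum c cE j cj].
exists n => //; apply: (@spanned_drop n W (fun l => L (b l)) c j) => //; last first.
  by rewrite -Lsum -cE.
by move=> w; have [v <-] := surL w; have [c' ->] := bP v; exists c'; rewrite Lsum.
Qed.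

Lemma scalar_of_linear V (phi : V -> k) :
  (forall a u v, phi (a *: u + v) = a * phi u + phi v) ->
  exists psi : {scalar V}, forall v, psi v = phi v.
Proof.
move=> lin; pose M := GRing.isLinear.Build k V k _ phi lin.
by pose psi : {scalar V} := HB.pack phi M; exists psi.
Qed.

(** Dropping dependent vectors one at a time leaves a basis. *)
Lemma coordinates n V : spanned n V -> exists m (b : 'I_m -> V) (c : 'I_m -> {scalar V}),
  forall v, v = \sum_i c i v *: b i.
Proof.
elim: n => [|n IH] [b bP].
  exists 0%N, b, (fun=> \0) => v.
  by have [c ->] := bP v; rewrite !big_ord0.
have [[c [j [c0 cj]]]|ind] :=
    pselect (exists (c : 'I_n.+1 -> k) j, \sum_i c i *: b i = 0 /\ c j != 0).
  exact/IH/(spanned_drop bP c0 cj).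
pose c v := projT1 (cid (bP v)).
have cE v : v = \sum_i c v i *: b i := projT2 (cid (bP v)).
have uniq (d d' : 'I_n.+1 -> k) i : \sum_i d i *: b i = \sum_i d' i *: b i -> d i = d' i.
  move=> dd; apply/eqP/negPn/negP; rewrite -subr_eq0 => di; apply: ind.
  exists (fun l => d l - d' l), i; split=> //.
  under eq_bigr => l _ do rewrite scalerBl.
  by rewrite sumrB dd subrr.
have /choice [c' c'E] i : exists psi : {scalar V}, forall v, psi v = c v i.
  apply: scalar_of_linear => a u v; apply: (uniq (c (a *: u + v)) (fun l => a * c u l + c v l)).
  rewrite -cE {1}(cE u) {1}(cE v) scaler_sumr -big_split /=.
  by apply: eq_bigr => l _; rewrite scalerDl scalerA.
by exists n.+1, b, c' => v; rewrite {1}(cE v); apply: eq_bigr => i _; rewrite c'E.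
Qed.

(** The two matrices that express one basis of [P / Q] by the other have product 1,
    and the rank of that product is at most [m]. *)
Lemma quotient_dim_le V (P : V -> Prop) (Q : submodule V) n m :
  quotient_has_dim P Q n -> quotient_has_dim P Q m -> (n <= m)%N.
Proof.
move=> [b [bP bU]] [b' [bP' bU']].
have /choice [M ME] i : exists c : 'rV[k]_m, Q (b i - \sum_j c 0 j *: b' j).
  by have [c [cQ _]] := bU' _ (bP i); exists c.
have /choice [N NE] i : exists c : 'rV[k]_n, Q (b' i - \sum_j c 0 j *: b j).
  by have [c [cQ _]] := bU _ (bP' i); exists c.
pose MM := \matrix_(i, j) M i 0 j; pose NN := \matrix_(i, j) N i 0 j.
suff MN : MM *m NN = 1%:M.
  have := mxrankM_maxr MM NN; rewrite MN mxrank1 => nm.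
  exact: leq_trans nm (rank_leq_row NN).
apply/row_matrixP => i; have [c [cQ cU]] := bU _ (bP i).
have Qsum (I : Type) (r : seq I) (F : I -> V) : (forall i, Q (F i)) -> Q (\sum_(i <- r) F i).
  by move=> FQ; elim/big_ind: _ => // [|u v Qu Qv]; [apply: submod0|apply: submodD].
rewrite -(cU (row i (MM *m NN))); first rewrite -(cU (row i 1%:M)) //.
  rewrite (_ : \sum_j _ = b i) ?subrr; first exact: submod0.
  rewrite (bigD1 i) //= !mxE eqxx scale1r big1 ?addr0 // => j ji.
  by rewrite !mxE eq_sym (negbTE ji) scale0r.
have -> : b i - \sum_j (row i (MM *m NN)) 0 j *: b j =
    (b i - \sum_j M i 0 j *: b' j) +
    \sum_j M i 0 j *: (b' j - \sum_l N j 0 l *: b l).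
  rewrite -addrA; congr (_ + _).
  under [X in _ = _ + X]eq_bigr => j _ do rewrite scalerBr.
  rewrite sumrB addrA addNr add0r; congr (- _).
  under [RHS]eq_bigr => j _ do rewrite scaler_sumr.
  rewrite exchange_big /=; apply: eq_bigr => l _.
  rewrite !mxE scaler_suml; apply: eq_bigr => j _.
  by rewrite !mxE scalerA.
by apply: submodD => //; apply: Qsum => j; apply: submodZ.
Qed.

(** Moves the dimension of rad / rad^2 along functors that are full and reflect
    these subspaces. *)
Lemma quotient_dim_transfer V W (L : V -> W) (P Q : V -> Prop) (P' Q' : W -> Prop) n :
  (forall a u v, L (a *: u + v) = a *: L u + L v) ->
  (forall w, exists v, L v = w) ->
  (forall v, P v <-> P' (L v)) -> (forall v, Q v <-> Q' (L v)) ->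
  quotient_has_dim P Q n <-> quotient_has_dim P' Q' n.
Proof.
move=> linL surL PP QQ.
have Lz : L 0 = 0.
  by apply: (addrI (L 0)); have := linL 1 0 0; rewrite !scale1r !addr0 => <-.
have LB v (c : 'rV[k]_n) (b : 'I_n -> V) :
    L (v - \sum_i c 0 i *: b i) = L v - \sum_i c 0 i *: L (b i).
  have -> : L (v - \sum_i c 0 i *: b i) = L v - L (\sum_i c 0 i *: b i).
    by rewrite addrC -scaleN1r linL scaleN1r addrC.
  by congr (_ - _); elim/big_rec2: _ => [//|i x y _ <-]; rewrite linL.
split=> -[b [bP bU]].
  exists (fun i => L (b i)); split=> [i|w]; first exact/PP.
  have [v <-] := surL w => /PP Pv; have [c [cQ cU]] := bU v Pv.
  by exists c; split=> [|c']; rewrite -LB -QQ //; apply: cU.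
have /choice [b0 b0E] i := surL (b i); exists b0; split=> [i|v Pv].
  by apply/PP; rewrite b0E.
have bE : b = fun i => L (b0 i) by apply/funext => i.
have [c [cQ cU]] := bU _ ((PP v).1 Pv); rewrite bE in cQ cU.
exists c; split=> [|c']; first by apply/QQ; rewrite LB.
by move/QQ; rewrite LB; apply: cU.
Qed.

End LinearAlgebra.

(** * Local endomorphism rings and the radical *)

Section EndoPoly.
Variables (k : fieldType) (C : klincat k) (A : C) (f : hom C A A).

Definition peval (p : {poly k}) : hom C A A := \sum_(i < size p) p`_i *: epow f i.

Lemma pevalE n (p : {poly k}) : (size p <= n)%N -> peval p = \sum_(i < n) p`_i *: epow f i.
Proof.
move=> pn; rewrite /peval (big_ord_widen n (fun i => p`_i *: epow f i)) //.
rewrite big_mkcond /=; apply: eq_bigr => i _; case: ltnP => // /(nth_default _) ->.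
by rewrite scale0r.
Qed.

Lemma peval_lin a p q : peval (a *: p + q) = a *: peval p + peval q.
Proof.
pose n := maxn (size p) (size q).
have np : (size p <= n)%N by apply: leq_maxl.
have nq : (size q <= n)%N by apply: leq_maxr.
have npq : (size (a *: p + q)%R <= n)%N.
  rewrite (leq_trans (size_polyD _ _)) // geq_max nq andbT.
  exact: leq_trans (size_scale_leq _ _) np.
rewrite !(@pevalE n) // scaler_sumr -big_split; apply: eq_bigr => i _ /=.
by rewrite coefD coefZ scalerDl scalerA.
Qed.

Lemma pevalD p q : peval (p + q) = peval p + peval q.
Proof. by rewrite -[p]scale1r peval_lin !scale1r. Qed.

Lemma peval0 : peval 0 = 0.
Proof. by rewrite /peval size_poly0 big_ord0. Qed.

Lemma pevalZ a p : peval (a *: p) = a *: peval p.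
Proof. by rewrite -[a *: p]addr0 peval_lin peval0 addr0. Qed.

Lemma peval1 : peval 1 = idm A.
Proof. by rewrite /peval size_poly1 big_ord1 coefC eqxx scale1r. Qed.

Lemma pevalC c : peval c%:P = c *: idm A.
Proof. by rewrite -[c%:P]mulr1 mul_polyC pevalZ peval1. Qed.

Lemma pevalXM q : peval ('X * q) = f \oc peval q.
Proof.
rewrite (@pevalE (size q).+1) ?(leq_trans (size_polyMleq _ _)) ?size_polyX //.
rewrite big_ord_recl coefXM eqxx scale0r add0r comp_sumr.
by apply: eq_bigr => i _; rewrite coefXM compZr.
Qed.

Lemma pevalX : peval 'X = f.
Proof. by rewrite -['X]mulr1 pevalXM peval1 compm1. Qed.

Lemma pevalM p q : peval (p * q) = peval p \oc peval q.
Proof.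
elim/poly_ind: p q => [|p c IH] q; first by rewrite mul0r peval0 comp0l.
rewrite mulrDl -mulrA mul_polyC !pevalD IH pevalXM pevalZ pevalC compDl IH pevalX.
by rewrite compZl comp1m compA.
Qed.

Lemma pevalXn n : peval ('X ^+ n) = epow f n.
Proof. by elim: n => [|n IH]; rewrite ?expr0 ?peval1 // exprS pevalXM IH. Qed.

(** The powers of [f] up to the dimension of [End A] are linearly dependent. *)
Lemma annihilating_poly n : spanned n (hom C A A) -> exists2 p, p != 0 & peval p = 0.
Proof.
move=> [b bP]; have /choice [c cE] i := bP (epow f i).
pose M := \matrix_(i < n.+1, j < n) c i j.
have [v vM nzv] : exists2 v : 'rV_n.+1, v *m M = 0 & v != 0.
  have : kermx M != 0.
    rewrite -mxrank_eq0 mxrank_ker -lt0n subn_gt0 ltnS; exact: rank_leq_col.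
  by case/rowV0Pn => v /sub_kermxP ? ?; exists v.
exists (\poly_(i < n.+1) v 0 (inord i)).
  apply: contra nzv => /eqP p0; apply/eqP/rowP => i; rewrite mxE.
  have := coef_poly n.+1 (fun i => v 0 (inord i)) i; rewrite p0 coef0 ltn_ord.
  by rewrite inord_val => <-.
rewrite (@pevalE n.+1) ?size_poly //.
under eq_bigr => i _ do rewrite coef_poly ltn_ord inord_val cE scaler_sumr.
rewrite exchange_big big1 //= => j _.
have /rowP/(_ j) := vM; rewrite !mxE => vM0.
have vc0 : \sum_i v 0 i * c i j = 0.
  by rewrite -[RHS]vM0; apply: eq_bigr => i _; rewrite mxE.
under eq_bigr => i _ do rewrite scalerA.
by rewrite -scaler_suml vc0 scale0r.
Qed.

End EndoPoly.

Section Local.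
Variables (k : fieldType) (C : klincat k).
Implicit Types A B D : C.

(** For finite dimensional [End A], this says that [End A] is a local ring. *)
Definition local_obj A :=
  ~ is_zero A /\ forall f : hom C A A, is_iso f \/ exists n, epow f n = 0.

(** Fitting: factor a polynomial killing [f] as [q * 'X^m] with [q] prime to ['X]. A
    Bezout relation between [q] and ['X^m.+1] gives an idempotent of [k[f]], divisible
    by [f] thanks to the extra factor. If it is 0, then [f ^ m.+1 = 0]; if it is 1,
    then [f] is invertible. *)
Lemma fitting A n : spanned n (hom C A A) -> idem_trivial A -> local_obj A.
Proof.
move=> sp [nz tr]; split=> // f; have [p p0 pf] := annihilating_poly f sp.
have [m [q]] := multiplicity_XsubC p 0.
rewrite subr0 p0 /= => q0 pE.
have /Bezout_coprimepP [[u v] /= /eqpf_eq [c c0 cE]] : coprimep q ('X ^+ m.+1).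
  by apply: coprimep_expr; rewrite -['X]subr0 coprimep_XsubC.
have one : c^-1 *: (u * q) + (c^-1 *: v) * 'X ^+ m.+1 = 1.
  by rewrite -scalerAl -scalerDr cE scalerA mulVf // scale1r.
pose E := peval f ((c^-1 *: v) * 'X ^+ m.+1).
pose E' := peval f (c^-1 *: (u * q)).
have EE' : E' + E = idm A by rewrite -pevalD one peval1.
have qX : peval f (q * 'X ^+ m.+1) = 0.
  by rewrite exprSr mulrA -pE pevalM pf comp0l.
have E'E0 : E' \oc E = 0.
  by rewrite -pevalM -scalerAl mulrACA pevalZ pevalM qX comp0r scaler0.
have EE : E \oc E = E by rewrite -[RHS]comp1m -EE' compDl E'E0 add0r.
have [E0|E1] := tr E EE; [right|left].
  exists m.+1; rewrite -pevalXn -[LHS]compm1 -EE' E0 addr0 -pevalM -scalerAr.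
  by rewrite mulrCA pevalZ pevalM (mulrC _ q) qX comp0r scaler0.
apply: (@is_iso_lr _ _ _ _ f (peval f ((c^-1 *: v) * 'X ^+ m)) (peval f ((c^-1 *: v) * 'X ^+ m))).
  by rewrite -{2}[f]pevalX -pevalM -mulrA -exprSr.
by rewrite -{1}[f]pevalX -pevalM mulrC -mulrA -exprSr.
Qed.

Lemma local_idem_trivial A : local_obj A -> idem_trivial A.
Proof.
move=> [nz loc]; split=> // e ee; have [[g [ge eg]]|[[|n] en]] := loc e.
- by right; rewrite -[e]comp1m -ge -compA ee.
- by case: nz.
- by left; rewrite -(idem_epow n ee).
Qed.

Lemma local_indec A : local_obj A -> indecomposable A.
Proof. by move/local_idem_trivial/idem_trivial_indec. Qed.

Lemma local_not_iso A (f : hom C A A) : local_obj A -> ~ is_iso f -> is_iso (idm A - f).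
Proof. by move=> [nz loc] nf; have [//|[n fn]] := loc f; apply: nilpotent_1B_iso fn. Qed.

Lemma epow_swap A B (f : hom C A B) (g : hom C B A) n :
  g \oc epow (f \oc g) n \oc f = epow (g \oc f) n.+1.
Proof.
elim: n => [|n IH]; first by rewrite /= !compm1.
by rewrite -[RHS]/(g \oc f \oc epow (g \oc f) n.+1) -IH /= !compA.
Qed.

(** If [f \oc g] were nilpotent, so would be [g \oc f]. *)
Lemma local_iso A B (f : hom C A B) (g : hom C B A) :
  local_obj A -> local_obj B -> is_iso (g \oc f) -> is_iso f.
Proof.
move=> [nzA _] [_ locB] gf; have [fg|[n fgn]] := locB (f \oc g).
  exact: is_iso_two_sided gf fg.
case: (nilpotent_not_iso (n := n.+1) nzA _ gf).
by rewrite -epow_swap fgn comp0r comp0l.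
Qed.

Lemma iso_of_local A B : local_obj A -> iso A B -> local_obj B.
Proof.
move=> [nz loc] [f [g [gf fg]]]; split=> [z|h].
  by apply: nz; rewrite /is_zero -gf -[f]comp1m z comp0l comp0r.
have fi : is_iso f by exists g.
have gi : is_iso g by exists f.
have [ghf|[n ghf]] := loc (g \oc h \oc f); [left|right].
  have -> : h = f \oc (g \oc h \oc f) \oc g.
    by rewrite !compA fg comp1m -compA fg compm1.
  by apply: is_iso_comp gi; apply: is_iso_comp.
exists n.+1; have -> : h = f \oc (g \oc h) by rewrite compA fg comp1m.
by rewrite -epow_swap ghf comp0r comp0l.
Qed.

(** If no [g \oc f] is the identity, then none is invertible, so all of them are
    nilpotent. *)
Lemma radP A B (f : hom C A B) : local_obj A ->
  rad f <-> forall g : hom C B A, g \oc f <> idm A.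
Proof.
move=> locA; split=> [rf g gf|nf g].
  have := rf g; rewrite gf subrr => -[h [h0 _]]; apply: locA.1.
  by rewrite /is_zero -h0 comp0r.
by apply: local_not_iso => // -[u [ugf _]]; apply: (nf (u \oc g)); rewrite -compA.
Qed.

(** If [u] is inverse to [1 - g f], then [1 + f u g] is inverse to [1 - f g]. *)
Lemma rad_sym A B (f : hom C A B) : rad f <-> forall g, is_iso (idm B - f \oc g).
Proof.
have swap A' B' (f' : hom C A' B') (g : hom C B' A') :
    is_iso (idm A' - g \oc f') -> is_iso (idm B' - f' \oc g).
  move=> [u [ul ur]]; exists (idm B' + f' \oc u \oc g).
  split.
    rewrite compBr compm1 compDl comp1m.
    have -> : f' \oc u \oc g \oc (f' \oc g) = f' \oc (u \oc (g \oc f')) \oc g.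
      by rewrite !compA.
    have -> : u \oc (g \oc f') = u - idm A' by rewrite -ul compBr compm1 opprB addrC subrK.
    by rewrite compBr compBl compm1 (addrC (f' \oc g)) subrK addrK.
  rewrite compDr compm1 compBl comp1m.
  have -> : f' \oc g \oc (f' \oc u \oc g) = f' \oc (g \oc f' \oc u) \oc g.
    by rewrite !compA.
  have -> : g \oc f' \oc u = u - idm A' by rewrite -ur compBl comp1m opprB addrC subrK.
  by rewrite compBr compBl compm1 opprB (addrC (f' \oc u \oc g)) subrK subrK.
by split=> rf g; apply: swap.
Qed.

Lemma radP_r A B (f : hom C A B) : local_obj B ->
  rad f <-> forall g : hom C B A, f \oc g <> idm B.
Proof.
move=> locB; rewrite rad_sym; split=> [rf g gf|nf g].
  have := rf g; rewrite gf subrr => -[h [h0 _]]; apply: locB.1.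
  by rewrite /is_zero -h0 comp0r.
by apply: local_not_iso => // -[u [_ fgu]]; apply: (nf (g \oc u)); rewrite compA.
Qed.

Lemma rad_not_iso A B (f : hom C A B) : local_obj A -> local_obj B ->
  rad f <-> ~ is_iso f.
Proof.
move=> lA lB; rewrite radP //; split=> [nf [g [gf _]]|nf g gf]; first exact: (nf g).
by apply: nf; apply: (local_iso lA lB (g := g)); rewrite gf; apply: is_iso_idm.
Qed.

Lemma rad_comp_l A B D (g : hom C B D) (f : hom C A B) : rad f -> rad (g \oc f).
Proof. by move=> rf h; rewrite compA; apply: rf. Qed.

Lemma rad_comp_r A B D (g : hom C B D) (f : hom C A B) : rad g -> rad (g \oc f).
Proof. by rewrite !rad_sym => rg h; rewrite -compA; apply: rg. Qed.

Lemma rad2_add1 A B Z (h : hom C A B) (f : hom C A Z) (g : hom C Z B) :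
  rad f -> rad g -> rad2 h -> rad2 (g \oc f + h).
Proof.
move=> rf rg [n [Zs [gs [fs [rgfs ->]]]]].
pose P (l : 'I_n.+1) := {W : C & (hom C W B * hom C A W)%type}.
pose x0 : P ord0 := existT _ Z (g, f).
pose xs l : P (lift ord0 l) := existT _ (Zs l) (gs l, fs l).
have [F [F0 FS]] := ord_family_cons x0 xs.
exists n.+1, (fun l => tag (F l)), (fun l => (tagged (F l)).1), (fun l => (tagged (F l)).2).
split=> [l|]; first by case: (unliftP ord0 l) => [j|] ->; rewrite ?F0 ?FS //=.
by rewrite big_ord_recl F0; congr (_ + _); apply: eq_bigr => l _; rewrite FS.
Qed.

Lemma rad2_0 A B : rad2 (0 : hom C A B).
Proof. by exists 0%N, (fun=> A), (fun=> 0), (fun=> 0); split; [case|rewrite big_ord0]. Qed.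

Lemma rad2_comp A B Z (f : hom C A Z) (g : hom C Z B) : rad f -> rad g -> rad2 (g \oc f).
Proof. by move=> rf rg; rewrite -[_ \oc _]addr0; apply/(rad2_add1 rf rg)/rad2_0. Qed.

Lemma rad2_comp_l A B D (g : hom C B D) (h : hom C A B) : rad2 h -> rad2 (g \oc h).
Proof.
move=> [n [Z [gs [fs [rgf ->]]]]]; exists n, Z, (fun i => g \oc gs i), fs.
split=> [i|]; first by have [? ?] := rgf i; split=> //; apply: rad_comp_l.
by rewrite comp_sumr; apply: eq_bigr => i _; rewrite compA.
Qed.

Lemma direct_sum_zero_iso A B D :
  direct_sum A B D -> is_zero B -> iso A D.
Proof.
move=> [i [j [p [q [pi qj pj qi ipjq]]]]] z; exists i, p; split=> //.
by rewrite -ipjq (zero_hom q) ?comp0r ?addr0 //; right.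
Qed.

Lemma direct_sum_sym A B D : direct_sum A B D -> direct_sum B A D.
Proof.
move=> [i [j [p [q [pi qj pj qi ipjq]]]]]; exists j, i, q, p; split=> //.
by rewrite addrC.
Qed.

Lemma direct_sum_iso A B D (D' : C) :
  direct_sum A B D -> iso D D' -> direct_sum A B D'.
Proof.
move=> [i [j [p [q [pi qj pj qi ipjq]]]]] [f [g [gf fg]]].
have h A' B' (a : hom C A' D) (b : hom C D B') : (b \oc g) \oc (f \oc a) = b \oc a.
  by rewrite compA -(compA b) gf compm1.
exists (f \oc i), (f \oc j), (p \oc g), (q \oc g); split; rewrite ?h //.
by rewrite !compA -compDl -!(compA f) -compDr ipjq compm1.
Qed.

Lemma indec_iso A B : iso A B -> indecomposable A -> indecomposable B.
Proof.
move=> AB [nz ind]; split=> [z|D D' /direct_sum_iso/(_ (iso_sym AB))/ind//].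
by have [f [g [gf _]]] := AB; apply: nz; rewrite /is_zero -gf -[f]comp1m z comp0l comp0r.
Qed.

(** [f |-> p f i] maps [End D] onto [End A] and kills the nonzero idempotent of the
    other summand. *)
Lemma direct_sum_spanned A B D n : direct_sum A B D -> ~ is_zero B ->
  spanned n (hom C D D) -> exists2 m, n = m.+1 & spanned m (hom C A A).
Proof.
move=> [i [j [p [q [pi qj pj qi ipjq]]]]] nz.
apply: (spanned_quotient (L := fun f => p \oc f \oc i) (v0 := j \oc q)).
- by move=> a f g; rewrite comp_linr comp_linl.
- by move=> f; exists (i \oc f \oc p); rewrite !compA pi comp1m -compA pi compm1.
- move=> jq; apply: nz; rewrite /is_zero -qj -[q]compm1.
  by rewrite -[q \oc _]comp1m -qj -!compA (compA j) jq comp0l comp0r.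
by rewrite compA pj comp0l comp0l.
Qed.

End Local.

Lemma irr_dim_transfer (k : fieldType) (C D : klincat k) (A B : C) (A' B' : D)
    (L : hom C A B -> hom D A' B') :
  (forall a u v, L (a *: u + v) = a *: L u + L v) ->
  (forall w, exists v, L v = w) ->
  (forall v, rad v <-> rad (L v)) -> (forall v, rad2 v <-> rad2 (L v)) ->
  irr_dim A B = irr_dim A' B'.
Proof.
move=> linL surL radL rad2L; rewrite /irr_dim; congr (xget _ _); apply/funext => n.
exact/propext/(quotient_dim_transfer n linL surL radL rad2L).
Qed.

Lemma irr_dim_iso (k : fieldType) (C : klincat k) (A B A' B' : C) :
  iso A A' -> iso B B' -> irr_dim A B = irr_dim A' B'.
Proof.
move=> [a [a' [a'a aa']]] [b [b' [b'b bb']]].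
have key (A1 B1 A2 B2 : C) (a2 : hom C A2 A1) (b1 : hom C B1 B2) (f : hom C A1 B1) :
    (rad f -> rad (b1 \oc f \oc a2)) /\ (rad2 f -> rad2 (b1 \oc f \oc a2)).
  split=> [rf|]; first by apply/rad_comp_r/rad_comp_l.
  move=> [n [Z [g [h [rgh ->]]]]]; exists n, Z, (fun i => b1 \oc g i), (fun i => h i \oc a2).
  split=> [i|]; first by have [rh rg] := rgh i; split; [apply: rad_comp_r|apply: rad_comp_l].
  by rewrite comp_sumr comp_suml; apply: eq_bigr => i _; rewrite !compA.
have back f : f = b' \oc (b \oc f \oc a') \oc a.
  by rewrite !compA b'b comp1m -compA a'a compm1.
have there f : f = b \oc (b' \oc f \oc a) \oc a'.
  by rewrite !compA bb' comp1m -compA aa' compm1.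
apply: (irr_dim_transfer (L := fun f => b \oc f \oc a')) => [c f g|f|f|f].
- by rewrite comp_linr comp_linl.
- by exists (b' \oc f \oc a); rewrite -there.
- split=> [|h]; first by have [h _] := key _ _ _ _ a' b f.
  by have [h' _] := key _ _ _ _ a b' (b \oc f \oc a'); rewrite (back f); apply: h'.
- split=> [|h]; first by have [_ h] := key _ _ _ _ a' b f.
  by have [_ h'] := key _ _ _ _ a b' (b \oc f \oc a'); rewrite (back f); apply: h'.
Qed.

Section Eigenvalue.
Variables (k : closedFieldType) (C : klincat k).
Implicit Types A B : C.

(** Where the algebraic closure of the ground field enters: [End A] is spanned by
    the identity and the radical. *)
Lemma eigenvalue_exists A n (f : hom C A A) : ~ is_zero A -> spanned n (hom C A A) ->
  exists c, ~ is_iso (f - c *: idm A).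
Proof.
move=> nz sp; have [p p0 pf] := annihilating_poly f sp.
apply: contrapT => /forallNP all_iso; apply: nz; have [r pE] := closed_field_poly_normal p.
suff [g [g0 _]] : is_iso (peval f p) by rewrite /is_zero -g0 pf comp0r.
rewrite pE pevalZ; apply: is_iso_scale; first by rewrite lead_coef_eq0.
elim: (r) => [|z s IH]; first by rewrite big_nil peval1; apply: is_iso_idm.
rewrite big_cons pevalM; apply: is_iso_comp IH.
rewrite pevalD pevalX -scaleN1r pevalZ pevalC scaleN1r.
by apply: contrapT; apply: all_iso.
Qed.

(** The nonisomorphisms form a subspace, since [End A] is local, and each
    endomorphism differs from one by a unique multiple of the identity: this scalar
    is a linear function of the endomorphism. *)
Lemma residue_functional A n : local_obj A -> spanned n (hom C A A) ->
  exists phi : {scalar hom C A A},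
    phi (idm A) = 1 /\ forall f, ~ is_iso f -> phi f = 0.
Proof.
move=> locA sp; have /choice [c cE] f := eigenvalue_exists f locA.1 sp.
have niso_add (f g : hom C A A) : ~ is_iso f -> ~ is_iso g -> ~ is_iso (f + g).
  move=> nf ng [h [hfg _]]; apply: ng.
  have nhf : ~ is_iso (h \oc f).
    by move=> hf; apply: nf; apply: (local_iso locA locA (g := h)).
  have := local_not_iso locA nhf.
  have -> : idm A - h \oc f = h \oc g by rewrite -hfg compDr addrC addKr.
  exact: local_iso.
have niso_scale a (f : hom C A A) : ~ is_iso f -> ~ is_iso (a *: f).
  have [->|a0] := eqVneq a 0.
    rewrite scale0r => _ [h [h0 _]].
    by apply: locA.1; rewrite /is_zero -h0 comp0r.
  by move=> nf /(is_iso_scale (c := a^-1)); rewrite invr_eq0 scalerA mulVf // scale1r => /(_ a0).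
have cU f a : ~ is_iso (f - a *: idm A) -> c f = a.
  move=> nfa; apply/eqP/negPn/negP; rewrite -subr_eq0 => ca.
  have := niso_add _ _ nfa (niso_scale (-1) _ (cE f)); apply.
  rewrite scaleN1r opprB addrC addrA subrK -scalerBl.
  by apply: is_iso_scale ca (is_iso_idm A).
have clin a (f g : hom C A A) : c (a *: f + g) = a * c f + c g.
  apply: cU.
  have -> : a *: f + g - (a * c f + c g) *: idm A =
      a *: (f - c f *: idm A) + (g - c g *: idm A).
    by rewrite scalerBr scalerA scalerDl opprD addrACA.
  by apply: niso_add => //; apply: niso_scale.
have [phi phiE] := scalar_of_linear clin.
exists phi; split=> [|f nf]; rewrite phiE; apply: cU; last by rewrite scale0r subr0.
rewrite scale1r subrr => -[h [h0 _]]; apply: locA.1.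
by rewrite /is_zero -h0 comp0r.
Qed.

End Eigenvalue.

(** * Triangles and Serre duality *)

Section Triangulated.
Variables (k : fieldType) (T : tricat k).
Implicit Types A B C D : T.

Lemma tri_rotl A B C (f : hom T A B) (g : hom T B C) (h : hom T C (susp T A)) :
  tri f g h -> tri g h (- fmap (susp T) f).
Proof. by move/(tri_rot f g h). Qed.

Lemma tri_comp0 A B C (f : hom T A B) (g : hom T B C) (h : hom T C (susp T A)) :
  tri f g h -> g \oc f = 0.
Proof.
move=> t; have [[Z z] _] := tadd T.
have [|c [cE _]] := tri_mor (tri_id A z) t (a := idm A) (b := f).
  by rewrite !compm1.
by rewrite -cE comp0r.
Qed.

Lemma tri_comp0_2 A B C (f : hom T A B) (g : hom T B C) (h : hom T C (susp T A)) :
  tri f g h -> h \oc g = 0.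
Proof. by move/tri_rotl/tri_comp0. Qed.

Lemma tri_comp0_3 A B C (f : hom T A B) (g : hom T B C) (h : hom T C (susp T A)) :
  tri f g h -> fmap (susp T) f \oc h = 0.
Proof. by move/tri_rotl/tri_comp0_2 => /eqP; rewrite compNl oppr_eq0 => /eqP. Qed.

(** Compare with the triangle of [idm D], rotated, and use that the suspension is
    full and faithful. *)
Lemma tri_lift A B C D (f : hom T A B) (g : hom T B C) (h : hom T C (susp T A))
    (x : hom T D B) :
  tri f g h -> g \oc x = 0 -> exists y, x = f \oc y.
Proof.
move=> /tri_rotl t gx; have [[Z z] _] := tadd T.
have [|c [_ cE]] := tri_mor (tri_rotl (tri_id D z)) t (a := x) (b := 0).
  by rewrite gx !comp0l.
have [y yE] := eqv_fun_full c; exists y.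
apply: (faithful_inj (@eqv_fun_faithful _ _ _ (susp T))); rewrite fmapM yE.
by move: cE; rewrite fmap1 compNl !compNr compm1 => /oppr_inj.
Qed.

Lemma tri_lift2 A B C D (f : hom T A B) (g : hom T B C) (h : hom T C (susp T A))
    (x : hom T D C) :
  tri f g h -> h \oc x = 0 -> exists y, x = g \oc y.
Proof. by move/tri_rotl; apply: tri_lift. Qed.

(** Compare with the triangle [0 -> D -> D -> 0]. *)
Lemma tri_extend A B C D (f : hom T A B) (g : hom T B C) (h : hom T C (susp T A))
    (x : hom T B D) :
  tri f g h -> x \oc f = 0 -> exists y, x = y \oc g.
Proof.
move=> t xf; have [[Z z] _] := tadd T.
have sz : is_zero (susp T Z) by apply: fmap_zero.
have t0 : tri (0 : hom T Z D) (idm D) (0 : hom T D (susp T Z)).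
  by apply/tri_rot; rewrite fmap0 oppr0; apply: tri_id.
have [|c [cE _]] := tri_mor t t0 (a := 0) (b := x); first by rewrite xf comp0r.
by exists c; rewrite cE comp1m.
Qed.

Lemma tri_extend2 A B C D (f : hom T A B) (g : hom T B C) (h : hom T C (susp T A))
    (x : hom T C D) :
  tri f g h -> x \oc g = 0 -> exists y, x = y \oc h.
Proof. by move/tri_rotl; apply: tri_extend. Qed.

Lemma tri_extend0 A B C D (f : hom T A B) (g : hom T B C) (h : hom T C (susp T A))
    (x : hom T A D) :
  tri f g h -> fmap (susp T) x \oc h = 0 -> exists y, x = y \oc f.
Proof.
move=> /tri_rotl t xh; have [y yE] := tri_extend2 t xh.
have [z zE] := eqv_fun_full y; subst y; exists (- z).
apply: (faithful_inj (@eqv_fun_faithful _ _ _ (susp T))).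
by rewrite fmapM fmapN yE compNr compNl.
Qed.

(** Rotated, this is the axiom on morphisms of triangles; the third component found
    there comes from a morphism [a] because the suspension is full. *)
Lemma tri_mor_left A B C A' B' C'
    (f : hom T A B) (g : hom T B C) (h : hom T C (susp T A))
    (f' : hom T A' B') (g' : hom T B' C') (h' : hom T C' (susp T A'))
    (b : hom T B B') (c : hom T C C') :
  tri f g h -> tri f' g' h' -> c \oc g = g' \oc b ->
  exists a : hom T A A', tri_morphism f g h f' g' h' a b c.
Proof.
move=> /tri_rotl t /tri_rotl t' sq; have [d [dE bE]] := tri_mor t t' sq.
have [a aE] := eqv_fun_full d; subst d; exists a; split=> //.
apply: (faithful_inj (@eqv_fun_faithful _ _ _ (susp T))); rewrite !fmapM.
by move: bE; rewrite compNl compNr => /oppr_inj.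
Qed.

(** The cone of [w], shifted back along the suspension. *)
Lemma tri_with_last A C (w : hom T C (susp T A)) :
  exists B (f : hom T A B) (g : hom T B C), tri f g w.
Proof.
have [D [x [y t]]] := tri_cone w; pose B := eqv_inv (susp T) D.
have [e' [e'e ee']] := nt_iso (eqv_counit (susp T)) D.
set e : hom T (susp T B) D := eqv_counit (susp T) D in e'e ee'.
have [f fE] := eqv_fun_full (e' \oc x : hom T (susp T A) (susp T B)).
have [g gE] := eqv_fun_full (y \oc e : hom T (susp T B) (susp T C)).
exists B, (- f), (- g); do 2 apply/tri_rot; rewrite !fmapN !opprK fE gE.
apply: (tri_iso (is_iso_idm C) (is_iso_idm (susp T A)) (c := e') _ _ _ _ t).
- by exists e.
- by rewrite comp1m compm1.
- by rewrite compm1.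
- by rewrite fmap1 comp1m -compA ee' compm1.
Qed.

End Triangulated.

Section Serre.
Variables (k : fieldType) (T : tricat k) (S : serre_functor T).
Hypothesis hfin : hom_finite T.
Implicit Types A B C : T.

Lemma spair0 A B (u : hom T B (S A)) : spair S (0 : hom T A B) u = 0.
Proof.
have := spair_lin (s := S) 1 (0 : hom T A B) 0 u; rewrite scale1r addr0 mul1r.
by move/eqP; rewrite -subr_eq0 opprD addNKr oppr_eq0 => /eqP.
Qed.

Lemma spair_sum A B n (c : 'I_n -> k) (f : 'I_n -> hom T A B) (u : hom T B (S A)) :
  spair S (\sum_i c i *: f i) u = \sum_i c i * spair S (f i) u.
Proof.
elim/big_rec2: _ => [|i x y _ <-]; first exact: spair0.
exact: spair_lin.
Qed.

(** The dual basis of a basis of [Hom(B, S A)] lies in [Hom(A, B)]. *)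
Lemma serre_dual_basis A B : exists n (b : 'I_n -> hom T B (S A)) (f : 'I_n -> hom T A B),
  forall u, u = \sum_i spair S (f i) u *: b i.
Proof.
have [m /coordinates [n [b [c cE]]]] := spanned_hom_finite B (S A) hfin.
have [f fE] := choice (fun i => spair_surj (s := S) (c i)).
by exists n, b, f => u; rewrite {1}(cE u); apply: eq_bigr => i _; rewrite fE.
Qed.

Lemma serre_nondeg A B (u : hom T B (S A)) :
  (forall f : hom T A B, spair S f u = 0) -> u = 0.
Proof.
move=> u0; have [n [b [f fE]]] := serre_dual_basis A B; rewrite (fE u).
by rewrite big1 // => i _; rewrite u0 scale0r.
Qed.

Lemma serre_represent A B (phi : {scalar hom T A B}) :
  exists u : hom T B (S A), forall f, spair S f u = phi f.
Proof.
have [n [b [f fE]]] := serre_dual_basis A B.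
exists (\sum_i phi (f i) *: b i) => g.
have gE : g = \sum_i spair S g (b i) *: f i.
  apply: (spair_inj (s := S)) => u; rewrite spair_sum {1}(fE u) linear_sum.
  by apply: eq_bigr => i _; rewrite linearZ /= mulrC.
rewrite [in RHS]gE !linear_sum; apply: eq_bigr => i _ /=.
by rewrite !linearZ /= mulrC.
Qed.

Definition tau_susp A : hom T (susp T (ar_tau S A)) (S A) := eqv_counit (susp T) (S A).

Lemma tau_susp_iso A : is_iso (tau_susp A).
Proof. exact: (nt_iso (eqv_counit (susp T))). Qed.

Lemma ar_tau_iso A B : iso A B -> iso (ar_tau S A) (ar_tau S B).
Proof. by move=> AB; apply/fmap_iso/fmap_iso. Qed.

Lemma ar_tau_reflect A B : iso (ar_tau S A) (ar_tau S B) -> iso A B.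
Proof.
move=> /(ff_reflect (@eqv_inv_full _ _ _ _) (@eqv_inv_faithful _ _ _ _)).
exact: (ff_reflect (@eqv_fun_full _ _ _ _) (@eqv_fun_faithful _ _ _ _)).
Qed.

Lemma ar_tau_surj B : exists A, iso (ar_tau S A) B.
Proof.
exists (eqv_inv S (susp T B)); apply: (iso_trans (B := eqv_inv (susp T) (susp T B))).
  by apply: fmap_iso; exists (eqv_counit S (susp T B)); exact: (nt_iso (eqv_counit S)).
by apply: iso_sym; exists (eqv_unit (susp T) B); exact: (nt_iso (eqv_unit (susp T))).
Qed.

Hypothesis hsplit : split_idempotents T.

Lemma indec_localP A : indecomposable A <-> local_obj A.
Proof.
split=> [indA|]; last exact: local_indec.
have [n sp] := spanned_hom_finite A A hfin.
exact: (fitting sp (indec_idem_trivial hsplit indA)).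
Qed.

Lemma local_tau A : local_obj A -> local_obj (ar_tau S A).
Proof.
move=> /local_idem_trivial /(ff_idem_trivial (@eqv_fun_full _ _ _ S) (@eqv_fun_faithful _ _ _ S)).
move=> /(ff_idem_trivial (@eqv_inv_full _ _ _ (susp T)) (@eqv_inv_faithful _ _ _ (susp T))).
by move/idem_trivial_indec/indec_localP.
Qed.

Lemma local_tau_inv A : local_obj (ar_tau S A) -> local_obj A.
Proof.
move=> /local_idem_trivial /(faithful_idem_trivial (@eqv_inv_faithful _ _ _ (susp T))).
move=> /(faithful_idem_trivial (@eqv_fun_faithful _ _ _ S)).
by move/idem_trivial_indec/indec_localP.
Qed.

End Serre.

(** * The quotient by a class of objects *)

Section Quotient.
Variables (k : fieldType) (T : tricat k) (X : Xclass T).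
Hypotheses (hfin : hom_finite T) (hsplit : split_idempotents T).
Implicit Types A B C D M N : T.

Definition quot_functor : klinfunctor T (TX_cat X) := quotient_functor (factor_ideal X).

Local Notation U := quot_functor.

Lemma quot_full : full U.
Proof. exact: quotient_full. Qed.

Lemma quot_eq0 A B (f : hom T A B) : fmap U f = 0 <-> factors_through X f.
Proof. exact: (quotient_eq0 (factor_ideal X)). Qed.

Lemma quot_eq A B (f g : hom T A B) : fmap U f = fmap U g <-> factors_through X (f - g).
Proof. exact: (lpi_eq (factor_submod X A B)). Qed.

Lemma X_retract A D (i : hom T A D) (p : hom T D A) : X D -> p \oc i = idm A -> X A.
Proof.
by move=> XD /(retract_direct_sum hsplit) [B BD]; apply: X_summand BD XD.
Qed.

Lemma X_quot_zero A : X A <-> @is_zero _ (TX_cat X) A.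
Proof.
rewrite /is_zero -(fmap1 U) quot_eq0; split=> [XA|[N [XN [u [v uv]]]]].
  by exists A; split=> //; exists (idm A), (idm A); rewrite comp1m.
exact: X_retract XN (esym uv).
Qed.

(** Otherwise [A] would be a direct summand of [N]. *)
Lemma through_X_not_iso A N (a : hom T A N) (b : hom T N A) :
  ~ X A -> X N -> ~ is_iso (b \oc a).
Proof.
by move=> nX XN [h [hba _]]; apply: nX; apply: (X_retract (i := a) (p := h \oc b)); rewrite -?compA.
Qed.

Lemma local_quot A : local_obj A -> ~ X A -> @local_obj _ (TX_cat X) A.
Proof.
move=> [nz loc] nX; split=> [/X_quot_zero//|f].
have [g <-] := quot_full f; have [gi|[n gn]] := loc g; [left|right].
  exact: (fmap_is_iso U gi).
by exists n; rewrite -(fmap_epow U) gn fmap0.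
Qed.

Lemma quot_reflect_iso A (f : hom T A A) : local_obj A -> ~ X A ->
  is_iso (fmap U f) <-> is_iso f.
Proof.
move=> locA nX; split=> [fi|]; last exact: (fmap_is_iso U).
have [//|[n fn]] := locA.2 f; case: (nilpotent_not_iso (n := n) _ _ fi).
  by move/X_quot_zero.
by rewrite -fmap_epow fn fmap0.
Qed.

(** Isomorphisms of local objects outside X are reflected, since a nilpotent
    endomorphism cannot become invertible in the quotient. *)
Lemma quot_iso_lift A B : local_obj A -> local_obj B -> ~ X A ->
  iso (U A) (U B) -> iso A B.
Proof.
move=> lA lB nX [f [g [gf fg]]]; have [f' fE] := quot_full f; have [g' gE] := quot_full g.
exists f'; apply: (local_iso lA lB (g := g')); apply/(quot_reflect_iso _ lA nX).
by rewrite fmapM fE gE gf; apply: is_iso_idm.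
Qed.

Lemma iso_quot A B : iso A B -> iso (U A) (U B).
Proof. exact: (fmap_iso U). Qed.

(** Among the objects isomorphic to [C] in the quotient, one with the smallest
    endomorphism algebra in [T] has no superfluous summand, so it is
    indecomposable already in [T]. *)
Lemma quot_indec_lift (C : TX_cat X) : indecomposable C ->
  exists C' : T, [/\ local_obj C', ~ X C' & iso (U C') C].
Proof.
move=> indC.
pose P n := `[< exists C' : T, iso (U C') C /\ spanned n (hom T C' C') >].
have exP : exists n, P n.
  have [n sp] := spanned_hom_finite (C : T) C hfin.
  by exists n; apply/asboolP; exists C; split=> //; apply: iso_refl.
have [n /asboolP [C' [isoC sp]] nmin] := ex_minnP exP.
have [nz ind] := indec_iso (iso_sym isoC) indC.
have nX : ~ X C' by move/X_quot_zero.
exists C'; split=> //; apply/(indec_localP hfin hsplit); split=> [z|].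
  by apply: nz; apply: (fmap_zero U).
have key B D : direct_sum B D C' -> is_zero (U D) -> is_zero D.
  move=> BDC zD; apply: contrapT => nzD.
  have [m nE spB] := direct_sum_spanned BDC nzD sp.
  have /nmin : P m.
    apply/asboolP; exists B; split=> //; apply: iso_trans isoC.
    exact: (direct_sum_zero_iso (fmap_direct_sum U BDC)).
  by rewrite nE ltnn.
move=> B D BDC; have [zB|zD] := ind _ _ (fmap_direct_sum U BDC).
  by left; apply: key (direct_sum_sym BDC) zB.
by right; apply: key BDC zD.
Qed.

Lemma quot_indecP (C : TX_cat X) : indecomposable C <-> local_obj C.
Proof.
split=> [/quot_indec_lift [C' [lC nX isoC]]|]; last exact: local_indec.
exact: iso_of_local (local_quot lC nX) isoC.
Qed.

(** * The triangles of the quotient *)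

Variable S : serre_functor T.
Hypothesis htau : forall B : T, X B <-> exists A : T, X A /\ iso B (ar_tau S A).

Lemma X_tau A : X A -> X (ar_tau S A).
Proof. by move=> XA; apply/htau; exists A; split=> //; apply: iso_refl. Qed.

Lemma X_tau_inv A : X (ar_tau S A) -> X A.
Proof.
by move=> /htau [B [XB /ar_tau_reflect AB]]; apply: X_iso XB; apply: iso_sym.
Qed.

(** Serre duality turns maps from [N] in X into [susp M] to functionals on maps
    from [M] into [tau N], which is again in X. *)
Lemma X_mono_susp_inj M M' N (mu : hom T M M') (b : hom T N (susp T M)) :
  X_mono X mu -> X N -> fmap (susp T) mu \oc b = 0 -> b = 0.
Proof.
move=> Xmu XN mub; apply: (spair_inj (s := S)) => u; rewrite spair0.
have [e [e1 e2]] := tau_susp_iso S N.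
have [u' u'E] := eqv_fun_full (e \oc u).
have [y yE] := Xmu _ (X_tau XN) u'; subst u'.
have -> : u = (tau_susp S N \oc fmap (susp T) y) \oc fmap (susp T) mu.
  by rewrite -compA -fmapM u'E compA e2 comp1m.
by rewrite -spair_natr mub spair0.
Qed.

Variable E : envelopes X.
Local Notation sg := (sigma_map E).

Lemma env_X_mono M : X_mono X (env1 E M).
Proof. by move=> N XN f; have [_ /(_ _ XN)] := env_pre E M; apply. Qed.

Lemma X_to_sigma M N (b : hom T N (sigma E M)) : X N -> env3 E M \oc b = 0.
Proof.
move=> XN; apply: (X_mono_susp_inj (@env_X_mono M) XN).
by rewrite compA (tri_comp0_3 (env_tri E M)) comp0l.
Qed.

(** Thus [env2 E M] is an X-precover of [sigma E M], and whether a morphism into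
    [sigma E M] dies in the quotient can be tested in T. *)
Lemma to_sigma_eq0 A M (b : hom T A (sigma E M)) :
  fmap U b = 0 <-> env3 E M \oc b = 0.
Proof.
split=> [/quot_eq0 [N [XN [u [v ->]]]]|/(tri_lift2 (env_tri E M)) [y ->]].
  by rewrite compA X_to_sigma // comp0l.
apply/quot_eq0; exists (env E M); split; first by have [] := env_pre E M.
by exists y, (env2 E M).
Qed.

Lemma sigma_lift_exists M N (mu : hom T M N) :
  exists s : hom T (sigma E M) (sigma E N), sigma_lift mu s.
Proof.
have [XN _] := env_pre E N.
have [xi xiE] := (env_pre E M).2 _ XN (env1 E N \oc mu).
have [s [s1 s2]] := tri_mor (env_tri E M) (env_tri E N) (esym xiE).
by exists s, xi; split.
Qed.

(** The difference of two lifts of the same morphism of the quotient lifts a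
    morphism through X, hence through [env1 E M], and so is killed by [env3 E N]. *)
Lemma sigma_mapE M N (mu : hom T M N)
    (s : hom T (sigma E M) (sigma E N)) : sigma_lift mu s -> sg (fmap U mu) = fmap U s.
Proof.
move=> ls; rewrite /sigma_map; set P := [set _ | _]%classic.
have : P (xget 0 P) by apply: (@xgetPex _ 0 P); exists s, mu.
case=> mu' [/quot_eq [N0 [XN0 [a [b ab]]]] [xi' [_ _ s'3]]].
have [xi [_ _ s3]] := ls.
have [a' aE] := (env_pre E M).2 _ XN0 a; subst a.
apply/eqP; rewrite -subr_eq0; apply/eqP.
rewrite -[LHS](fmapB U); apply/to_sigma_eq0.
rewrite compBr -s'3 -s3 -compBl -fmapB ab !fmapM -!compA.
by rewrite (tri_comp0_3 (env_tri E M)) !comp0r.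
Qed.

Lemma sigma_lift_comp M N P (nu : hom T N P) (mu : hom T M N)
    (s : hom T (sigma E M) (sigma E N)) (t : hom T (sigma E N) (sigma E P)) :
  sigma_lift mu s -> sigma_lift nu t -> sigma_lift (nu \oc mu) (t \oc s).
Proof.
move=> [xi [a1 a2 a3]] [zeta [b1 b2 b3]]; exists (zeta \oc xi); split.
- by rewrite -compA a1 compA b1 compA.
- by rewrite -compA a2 compA b2 compA.
- by rewrite fmapM -compA a3 compA b3 compA.
Qed.

Lemma sigma_map1 M : sg (idm (U M)) = idm (U (sigma E M)).
Proof.
rewrite -!(fmap1 U); apply: sigma_mapE.
by exists (idm _); split; rewrite ?fmap1 ?comp1m ?compm1.
Qed.

Lemma sigma_map0 M N : sg (0 : hom (TX_cat X) M N) = 0.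
Proof.
rewrite -!(fmap0 U); apply: sigma_mapE.
by exists 0; split; rewrite ?fmap0 ?comp0l ?comp0r.
Qed.

Lemma sigma_mapM (M N P : TX_cat X) (g : hom (TX_cat X) N P) (f : hom (TX_cat X) M N) :
  sg (g \oc f) = sg g \oc sg f.
Proof.
have [mu <-] := quot_full f; have [nu <-] := quot_full g.
have [s sP] := sigma_lift_exists mu; have [t tP] := sigma_lift_exists nu.
rewrite -(fmapM U) (sigma_mapE (sigma_lift_comp sP tP)) (sigma_mapE sP) (sigma_mapE tP).
exact: (fmapM U).
Qed.

Lemma sigma_map_iso (M N : TX_cat X) (f : hom (TX_cat X) M N) : is_iso f -> is_iso (sg f).
Proof. by move=> [g [gf fg]]; exists (sg g); rewrite -!sigma_mapM gf fg !sigma_map1. Qed.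

Lemma std_tri_comp0 (M N P : T) (u : hom (TX_cat X) M N) (v : hom (TX_cat X) N P)
    (w : hom (TX_cat X) P (sigma E M)) : TX_std_tri u v w -> w \oc v = 0.
Proof.
move=> [mu [nu [p [n [pi [_ _ [_ sq _] [_ -> ->]]]]]]].
rewrite -[LHS](fmapM U pi nu) sq; apply/quot_eq0; exists (env E M).
by split; [have [] := env_pre E M|exists n, (env2 E M)].
Qed.

Lemma std_tri_fill (M N P M' N' P' : T)
    (u : hom (TX_cat X) M N) (v : hom (TX_cat X) N P) (w : hom (TX_cat X) P (sigma E M))
    (u' : hom (TX_cat X) M' N') (v' : hom (TX_cat X) N' P')
    (w' : hom (TX_cat X) P' (sigma E M'))
    (b : hom (TX_cat X) N N') (c : hom (TX_cat X) P P') :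
  TX_std_tri u v w -> TX_std_tri u' v' w' -> c \oc v = v' \oc b ->
  exists a : hom (TX_cat X) M M', sg a \oc w = w' \oc c.
Proof.
move=> [mu [nu [p [n [pi [_ t [_ _ piE] [_ -> ->]]]]]]].
move=> [mu' [nu' [p' [n' [pi' [Xmu' t' [_ _ piE'] [_ -> ->]]]]]]].
have [b0 <-] := quot_full b; have [c0 <-] := quot_full c => sq.
have /quot_eq [N0 [XN0 [x [y xy]]]] : fmap U (c0 \oc nu) = fmap U (nu' \oc b0).
  by rewrite !fmapM.
(* The error of the square in T lifts along nu', so that b0 can be corrected. *)
have [y' yE] : exists y', y = nu' \oc y'.
  apply: (tri_lift2 t'); apply: (X_mono_susp_inj Xmu' XN0).
  by rewrite compA (tri_comp0_3 t') comp0l.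
have sq' : c0 \oc nu = nu' \oc (b0 + y' \oc x).
  by rewrite compDr compA -yE -xy addrC subrK.
have [a [_ _ pE]] := tri_mor_left t t' sq'; exists (fmap U a).
have [s sP] := sigma_lift_exists a; rewrite (sigma_mapE sP).
have [xi [_ _ s3]] := sP.
apply/eqP; rewrite -subr_eq0; apply/eqP.
rewrite -[X in X - _](fmapM U) -[X in _ - X](fmapM U) -[LHS](fmapB U).
apply/to_sigma_eq0; rewrite compBr !compA -s3 -compA -piE -piE'.
by rewrite !fmap1 !comp1m -pE subrr.
Qed.

Lemma TX_tri_comp0 (M N P : TX_cat X) u v w : @TX_tri k T X E M N P u v w -> w \oc v = 0.
Proof.
move=> [M' [N' [P' [u' [v' [w' [a [b [c [st [[ai bi ci] [_ sq2 sq3]]]]]]]]]]]].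
apply: (cancel_iso_r bi); rewrite comp0l -compA -sq2 compA -sq3 -compA.
by rewrite (std_tri_comp0 st) comp0r.
Qed.

Lemma TX_tri_iso (M N P M' P' : TX_cat X) u v w (a : hom (TX_cat X) M M')
    (a' : hom (TX_cat X) M' M) (c : hom (TX_cat X) P P') (c' : hom (TX_cat X) P' P) :
  @TX_tri k T X E M N P u v w -> is_iso a -> a' \oc a = idm M -> is_iso c -> c' \oc c = idm P ->
  @TX_tri k T X E M' N P' (u \oc a') (c \oc v) (sg a \oc w \oc c').
Proof.
move=> [M1 [N1 [P1 [u1 [v1 [w1 [a1 [b1 [c1 [st [[ai bi ci] [sq1 sq2 sq3]]]]]]]]]]]] Ia a'a Ic c'c.
exists M1, N1, P1, u1, v1, w1, (a \oc a1), b1, (c \oc c1); split=> //; split.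
  by split=> //; apply: is_iso_comp.
split.
- by rewrite sq1 -!compA (compA a') a'a comp1m.
- by rewrite -!compA sq2.
- by rewrite sigma_mapM -!compA sq3 (compA c') c'c comp1m.
Qed.

(** Follows from [std_tri_fill] along the isomorphisms of triangles; the uniqueness
    of AR triangles rests on it. *)
Lemma TX_tri_fill (M N P M' N' P' : TX_cat X) u v w u' v' w'
    (b : hom (TX_cat X) N N') (c : hom (TX_cat X) P P') :
  @TX_tri k T X E M N P u v w -> @TX_tri k T X E M' N' P' u' v' w' -> c \oc v = v' \oc b ->
  exists a : hom (TX_cat X) M M', sg a \oc w = w' \oc c.
Proof.
move=> [M1 [N1 [P1 [u1 [v1 [w1 [a1 [b1 [c1 [st1 [[ai bi ci] [_ sq2 sq3]]]]]]]]]]]].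
move=> [M2 [N2 [P2 [u2 [v2 [w2 [a2 [b2 [c2 [st2 [[ai' bi' ci'] [_ sq2' sq3']]]]]]]]]]]] sq.
have [b2' [b2'b b2b']] := bi'; have [c2' [c2'c c2c']] := ci'.
have [a1' [a1'a a1a']] := ai.
have sq' : (c2' \oc c \oc c1) \oc v1 = v2 \oc (b2' \oc b \oc b1).
  apply: (cancel_iso_l ci'); rewrite !compA c2c' comp1m sq2'.
  by rewrite -(compA c) sq2 compA sq -(compA v' b2) b2b' compm1.
have [a aE] := std_tri_fill st1 st2 sq'; exists (a2 \oc a \oc a1').
apply: (cancel_iso_r ci); rewrite -compA -sq3 compA -sigma_mapM.
rewrite -(compA _ a1') a1'a compm1 sigma_mapM -compA aE !compA sq3'.
by rewrite -(compA w' c2) c2c' compm1.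
Qed.

End Quotient.

(** * Auslander-Reiten triangles *)

Section ARTriangles.
Variables (k : closedFieldType) (T : tricat k) (S : serre_functor T).
Hypotheses (hfin : hom_finite T) (hsplit : split_idempotents T).
Implicit Types A B C D M N : T.

(** The connecting morphism is Serre dual to the residue functional on [End C];
    Serre duality on both sides shows which composites with it vanish. *)
Lemma ar_exists C : local_obj C ->
  exists B (u : hom T (ar_tau S C) B) (v : hom T B C) (w : hom T C (susp T (ar_tau S C))),
    [/\ tri u v w, w <> 0,
        forall D (t : hom T D C), (forall s, t \oc s <> idm C) -> w \oc t = 0
      & forall D (f : hom T (ar_tau S C) (ar_tau S D)),
          (forall (z : hom T C D) (g : hom T D C), ~ is_iso (g \oc z)) ->
          fmap (susp T) f \oc w = 0].
Proof.
move=> locC; have [n sp] := spanned_hom_finite C C hfin.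
have [phi [phi1 phi0]] := residue_functional locC sp.
have [w0 w0E] := serre_represent S hfin phi.
have [e [e1 e2]] := tau_susp_iso S C.
have [B [u [v t]]] := tri_with_last (e \oc w0 : hom T C (susp T (ar_tau S C))).
exists B, u, v, (e \oc w0); split=> //.
- move=> ew0; have : w0 = 0 by rewrite -[w0]comp1m -e2 -compA ew0 comp0r.
  move=> w00; have := oner_neq0 k; rewrite -phi1 -w0E w00 linear0.
  by rewrite eqxx.
- move=> D d nd; rewrite -compA.
  suff -> : w0 \oc d = 0 by rewrite comp0r.
  apply: (serre_nondeg (S := S) hfin) => f; rewrite -spair_natr w0E phi0 // => -[h [_ fh]].
  by apply: (nd (f \oc h)); rewrite compA.
- move=> D f nf; have [x xE] := eqv_inv_full f; have [z zE] := eqv_fun_full x.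
  subst f x.
  have nat : fmap S z \oc tau_susp S C =
      tau_susp S D \oc fmap (susp T) (fmap (eqv_inv (susp T)) (fmap S z)).
    exact: (nt_nat (eqv_counit (susp T)) (fmap S z)).
  apply: (cancel_iso_l (tau_susp_iso S D)); rewrite comp0r !compA -nat.
  rewrite -(compA (fmap S z)) e2 compm1; apply: (serre_nondeg (S := S) hfin) => g.
  by rewrite -spair_natl w0E phi0.
Qed.

Variable X : Xclass T.
Hypothesis htau : forall B : T, X B <-> exists A : T, X A /\ iso B (ar_tau S A).
Variable E : envelopes X.
Local Notation U := (quot_functor X).

(** Since a local object outside X is no summand of an object of X, the first
    morphism of its AR triangle is an X-monomorphism. The connecting morphism stays
    nonzero in the quotient by [to_sigma_eq0]. *)
Lemma quot_ar_triangle C : local_obj C -> ~ X C ->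
  exists B (u : hom (TX E) (ar_tau S C) B) (v : hom (TX E) B C)
         (w : hom (TX E) C (ptsusp (p := TX E) (ar_tau S C))), ar_triangle u v w.
Proof.
move=> locC nX; have [B [u [v [w [t nz wt wf]]]]] := ar_exists locC.
have Xu : X_mono X u.
  move=> N XN f; have [D [XD ND]] := (htau N).1 XN; have [i [i' [i'i ii']]] := ND.
  have : fmap (susp T) (i \oc f) \oc w = 0.
    by apply: wf => z g; apply: (through_X_not_iso hsplit nX XD).
  move=> /(tri_extend0 t) [y yE]; exists (i' \oc y).
  by rewrite -compA -yE compA i'i comp1m.
have [XM envM] := env_pre E (ar_tau S C).
have [n nE] := Xu _ XM (env1 E (ar_tau S C)).
have [|pi [pi1 pi2]] := tri_mor t (env_tri E (ar_tau S C)) (a := idm _) (b := n).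
  by rewrite compm1 nE.
exists B, (fmap U u), (fmap U v), (fmap U pi); split.
- exists (ar_tau S C), B, C, (fmap U u), (fmap U v), (fmap U pi).
  exists (idm _), (idm _), (idm _); split; last first.
    split; first by split; apply: is_iso_idm.
    split; rewrite ?comp1m ?compm1 //.
    by rewrite (sigma_map1 htau); apply: comp1m.
  exists u, v, w, n, pi; split=> //.
  by split; rewrite ?comp1m ?compm1 // nE.
- have nXt : ~ X (ar_tau S C) by move/(X_tau_inv htau).
  exact: (local_indec (local_quot hsplit (local_tau S hfin hsplit locC) nXt)).
- exact: (local_indec (local_quot hsplit locC nX)).
- move/(to_sigma_eq0 htau) => pi0; apply: nz.
  by rewrite -[w]comp1m -(fmap1 (susp T)) pi2 pi0.
move=> D d nd; have [d0 dE] := quot_full d; subst d.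
have wd0 : w \oc d0 = 0.
  by apply: wt => s ds; apply: nd; exists (fmap U s); rewrite -[LHS](fmapM U) ds.
have [y yE] := tri_lift2 t wd0; exists (fmap U y).
by rewrite yE; apply: (fmapM U).
Qed.

Lemma ar_triangle_iso (A B C A' C' : TX E) (u : hom (TX E) A B) (v : hom (TX E) B C)
    (w : hom (TX E) C (ptsusp (p := TX E) A)) :
  ar_triangle u v w -> iso A A' -> iso C C' ->
  exists (u' : hom (TX E) A' B) (v' : hom (TX E) B C')
         (w' : hom (TX E) C' (ptsusp (p := TX E) A')), ar_triangle u' v' w'.
Proof.
move=> [t iA iC nz as_] [a ai] [c ci]; have [a' [a'a aa']] := ai.
have [c' [c'c cc']] := ci.
pose sa : hom (TX E) (ptsusp (p := TX E) A) (ptsusp (p := TX E) A') := sigma_map E a.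
have sai : is_iso sa by apply: (sigma_map_iso htau).
exists (u \oc a'), (c \oc v), (sa \oc w \oc c'); split.
- exact: (TX_tri_iso htau t ai a'a ci c'c).
- by apply: indec_iso iA; exists a.
- by apply: indec_iso iC; exists c.
- move=> h; apply: nz; apply: (cancel_iso_l sai); rewrite comp0r.
  by apply: (cancel_iso_r (f := c')); [exists c|rewrite h comp0l].
move=> D d nd; have [|y yE] := as_ D (c' \oc d).
  move=> [s ds]; apply: nd; exists (s \oc c'); apply: (cancel_iso_r ci).
  rewrite comp1m -!compA c'c compm1 -[LHS]comp1m -cc' -!compA (compA c').
  by rewrite ds compm1.
by exists y; rewrite -compA -yE compA cc' comp1m.
Qed.

(** Each of two AR triangles ending in [C] factors through the other, and the
    composite endomorphism of [A] fixes the nonzero connecting morphism. *)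
Lemma ar_triangle_unique (A B A' B' C : TX E) (u : hom (TX E) A B) (v : hom (TX E) B C)
    (w : hom (TX E) C (ptsusp (p := TX E) A)) (u' : hom (TX E) A' B') (v' : hom (TX E) B' C)
    (w' : hom (TX E) C (ptsusp (p := TX E) A')) :
  ar_triangle u v w -> ar_triangle u' v' w' -> iso A A'.
Proof.
have nonsplit A1 B1 (u1 : hom (TX E) A1 B1) (v1 : hom (TX E) B1 C) w1 :
    ar_triangle u1 v1 w1 -> ~ exists s, v1 \oc s = idm C.
  move=> [t _ _ nz _] [s vs]; apply: nz.
  by rewrite -[w1]compm1 -vs compA (TX_tri_comp0 t) comp0l.
move=> ar ar'; have nv := nonsplit _ _ _ _ _ ar; have nv' := nonsplit _ _ _ _ _ ar'.
move: ar ar' => [t iA iC nz lift] [t' iA' _ nz' lift'].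
have [h hE] := lift' _ _ nv; have [h' h'E] := lift _ _ nv'.
have [|a aE] := TX_tri_fill htau t t' (b := h) (c := idm C).
  by rewrite comp1m.
have [|a' a'E] := TX_tri_fill htau t' t (b := h') (c := idm C).
  by rewrite comp1m.
have lA := (quot_indecP hfin hsplit A).1 iA.
have lA' := (quot_indecP hfin hsplit A').1 iA'.
exists a; apply: (local_iso lA lA' (g := a')).
have fixw : sigma_map E (a' \oc a) \oc w = w.
  by rewrite (sigma_mapM htau) -compA aE compA a'E !compm1.
have [//|[n an]] := lA.2 (a' \oc a); case: nz.
suff : sigma_map E (epow (a' \oc a) n) \oc w = w.
  by rewrite an (sigma_map0 htau) comp0l => <-.
elim: (n) => [|m IH] /=.
  by rewrite (sigma_map1 htau); exact: (@comp1m k (TX_cat X) C (sigma E A) w).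
rewrite (sigma_mapM htau) -[RHS]fixw -[in RHS]IH.
exact/esym/(@compA k (TX_cat X)).
Qed.

Lemma quot_has_ar_triangles : has_ar_triangles (TX E).
Proof.
have lift := quot_indec_lift hfin hsplit.
split=> [C /lift [C' [lC nX CC]]|A /lift [A' [lA nX AA]]].
  have [B [u [v [w ar]]]] := quot_ar_triangle lC nX.
  have [u' [v' [w' ar']]] := ar_triangle_iso ar (iso_refl _) CC.
  by exists (ar_tau S C'), B, u', v', w'.
have [C CA] := ar_tau_surj S A'.
have lC : local_obj C.
  by apply: (local_tau_inv (S := S) hfin hsplit); apply: iso_of_local lA (iso_sym CA).
have nXC : ~ X C.
  by move=> XC; apply: nX; apply: X_iso CA (X_tau htau XC).
have [B [u [v [w ar]]]] := quot_ar_triangle lC nXC.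
have [u' [v' [w' ar']]] :=
  ar_triangle_iso ar (iso_trans (iso_quot X CA) AA) (iso_refl _).
by exists B, C, u', v', w'.
Qed.

(** * Comparison of the two quivers *)

Lemma quot_ar_translateP A B : local_obj A -> ~ X A -> local_obj B -> ~ X B ->
  (exists A' B' : TX E, [/\ iso (U A) A', iso (U B) B' & ar_translate A' B']) <->
  iso B (ar_tau S A).
Proof.
move=> lA nA lB nB; split=> [[A' [B' [AA BB [Y [u [v [w ar]]]]]]]|BtA].
  have [Y' [u' [v' [w' ar']]]] := quot_ar_triangle lA nA.
  have [u1 [v1 [w1 ar1]]] := ar_triangle_iso ar (iso_refl _) (iso_sym AA).
  apply: (quot_iso_lift hsplit lB (local_tau S hfin hsplit lA) nB).
  exact: iso_trans BB (ar_triangle_unique ar1 ar').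
have [Y [u [v [w ar]]]] := quot_ar_triangle lA nA.
exists A, (ar_tau S A); split; [exact: iso_refl|exact: (iso_quot X BtA)|].
by exists Y, u, v, w.
Qed.

Lemma quot_rad A B (f : hom T A B) : local_obj A -> ~ X A ->
  rad (fmap U f) <-> rad f.
Proof.
move=> lA nX; split=> rf g.
  by apply/(quot_reflect_iso hsplit _ lA nX); rewrite fmapB fmap1 fmapM; apply: rf.
have [h <-] := quot_full g; rewrite -(fmapM U) -(fmap1 U) -(fmapB U).
exact/(fmap_is_iso U)/rf.
Qed.

(** A morphism through an object of X is a composite of two radical morphisms, so
    that passing to the quotient leaves rad / rad^2 unchanged. *)
Lemma quot_rad2 A B (h : hom T A B) : local_obj A -> ~ X A -> local_obj B -> ~ X B ->
  rad2 (fmap U h) <-> rad2 h.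
Proof.
move=> lA nA lB nB.
have radr Z (g : hom T Z B) : rad (fmap U g) <-> rad g.
  rewrite !rad_sym; split=> rg f.
    by apply/(quot_reflect_iso hsplit _ lB nB); rewrite fmapB fmap1 fmapM; apply: rg.
  have [f' <-] := quot_full f; rewrite -(fmapM U) -(fmap1 U) -(fmapB U).
  exact/(fmap_is_iso U)/rg.
split=> [[n [Z [g [f [rgf hE]]]]]|[n [Z [g [f [rgf ->]]]]]]; last first.
  exists n, Z, (fun i => fmap U (g i)), (fun i => fmap U (f i)); split.
    by move=> i; have [rf rg] := rgf i; split; [apply/quot_rad|apply/radr].
  by rewrite (fmap_sum U); apply: eq_bigr => i _; rewrite (fmapM U).
pose f0 i := projT1 (cid (quot_full (f i))); pose g0 i := projT1 (cid (quot_full (g i))).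
have f0E i : fmap U (f0 i) = f i := projT2 (cid (quot_full (f i))).
have g0E i : fmap U (g0 i) = g i := projT2 (cid (quot_full (g i))).
have /quot_eq [N [XN [a [b ab]]]] : fmap U h = fmap U (\sum_i g0 i \oc f0 i).
  rewrite hE (fmap_sum U); apply: eq_bigr => i _.
  by rewrite (fmapM U) f0E g0E.
have -> : h = b \oc a + \sum_i g0 i \oc f0 i by rewrite -ab subrK.
apply: rad2_add1.
- by apply/radP => // c ca; apply: nA; apply: X_retract ca.
- by apply/radP_r => // c bc; apply: nB; apply: X_retract bc.
exists n, Z, g0, f0; split=> // i; have [rf rg] := rgf i.
by split; [apply/(quot_rad _ lA nA); rewrite f0E|apply/radr; rewrite g0E].
Qed.

Lemma quot_irr_dim A B : local_obj A -> ~ X A -> local_obj B -> ~ X B ->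
  irr_dim (U A) (U B) = irr_dim A B.
Proof.
move=> lA nA lB nB; symmetry; apply: (irr_dim_transfer (L := fmap U (A := A) (B := B))).
- by move=> a f g; apply: fmap_lin.
- exact: quot_full.
- by move=> f; apply: iff_sym; apply: quot_rad.
- by move=> f; apply: iff_sym; apply: quot_rad2.
Qed.

End ARTriangles.


Lemma sval_inj (A : Type) (P : A -> Prop) (x y : {a | P a}) : sval x = sval y -> x = y.
Proof. by case: x y => [x Px] [y Py] /= xy; apply: eq_exist. Qed.

Section IndClass.
Variables (k : fieldType) (C : klincat k).
Implicit Types c d : ind_class C.

Definition class_of (A : C) (indA : indecomposable A) : ind_class C :=
  exist _ (iso A) (ex_intro _ A (conj indA erefl)).

Lemma ind_reprP c : indecomposable (ind_repr c) /\ sval c = iso (ind_repr c).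
Proof. exact: (projT2 (cid (svalP c))). Qed.

Lemma ind_class_iso c A : sval c A <-> iso (ind_repr c) A.
Proof. by have [_ ->] := ind_reprP c. Qed.

Lemma ind_class_inj c d : iso (ind_repr c) (ind_repr d) -> c = d.
Proof.
move=> cd; apply: sval_inj; have [_ ->] := ind_reprP c; have [_ ->] := ind_reprP d.
exact: iso_classE.
Qed.

Lemma ind_repr_class A (indA : indecomposable A) : iso A (ind_repr (class_of indA)).
Proof. by have [_ /= ->] := ind_reprP (class_of indA); apply: iso_refl. Qed.

End IndClass.

Lemma inj_surj_bijective (A B : Type) (f : A -> B) :
  injective f -> (forall b, exists a, f a = b) -> bijective f.
Proof.
move=> inj surj; exists (fun b => projT1 (cid (surj b))) => [a|b].
  exact/inj/(projT2 (cid (surj (f a)))).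
exact: (projT2 (cid (surj b))).
Qed.

Section QuiverIso.
Variables (k : closedFieldType) (T : tricat k) (S : serre_functor T).
Hypotheses (hfin : hom_finite T) (hsplit : split_idempotents T).
Variable X : Xclass T.
Hypothesis htau : forall B : T, X B <-> exists A : T, X A /\ iso B (ar_tau S A).
Variable E : envelopes X.
Local Notation U := (quot_functor X).
Local Notation G := (ar_quiver (fun A B : T => iso B (ar_tau S A))).
Local Notation G' := (ar_quiver (@ar_translate k (TX E))).

Lemma quot_ar_quiver :
  exists phi : tq_delete (fun x : G => exists A, sval x A /\ X A) -> G',
    tq_isom phi /\ forall x M, sval (sval x) M -> sval (phi x) M.
Proof.
pose D := tq_delete (fun x : G => exists A, sval x A /\ X A).
pose r (x : D) : T := ind_repr (sval x).
have lr x : local_obj (r x).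
  by apply/(indec_localP hfin hsplit); have [] := ind_reprP (sval x).
have nr x : ~ X (r x).
  move=> XA; apply: (svalP x); exists (r x); split=> //.
  by apply/ind_class_iso/iso_refl.
pose phi (x : D) : G' := class_of (local_indec (local_quot hsplit (lr x) (nr x))).
have phiP x : iso (U (r x)) (ind_repr (phi x)) by apply: ind_repr_class.
exists phi; split; last first.
  by move=> x M /ind_class_iso xM; apply: (iso_quot X xM).
split.
- apply: inj_surj_bijective => [x y xy|c].
    apply/sval_inj/ind_class_inj; apply: (quot_iso_lift hsplit (lr x) (lr y) (nr x)).
    by apply: iso_trans (phiP x) _; rewrite xy; apply: iso_sym.
  have [indc _] := ind_reprP c; have [A [lA nA Ac]] := quot_indec_lift hfin hsplit indc.
  pose x0 : G := class_of (local_indec lA).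
  have Ax0 : iso A (ind_repr x0) by apply: ind_repr_class.
  have nx0 : ~ exists A, sval x0 A /\ X A.
    by move=> [B [AB XB]]; apply: nA; apply: X_iso XB; apply: iso_sym.
  exists (exist _ x0 nx0); apply: ind_class_inj.
  apply: iso_trans (iso_sym (phiP _)) _; apply: iso_trans Ac.
  by apply: (iso_quot X); apply: iso_sym.
- move=> x y /=; rewrite -(irr_dim_iso (phiP x) (phiP y)).
  exact: (quot_irr_dim hsplit (lr x) (nr x) (lr y) (nr y)).
- move=> x z; have := quot_ar_translateP hfin hsplit htau E (lr x) (nr x) (lr z) (nr z).
  move=> eqv; split=> [/eqv BtA|[A [B [xA zB BtA]]]].
    by exists (r x), (r z); split=> //; apply/ind_class_iso/iso_refl.
  apply/eqv; apply: iso_trans ((ind_class_iso _ _).1 zB) _; apply: iso_trans BtA _.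
  by apply/ar_tau_iso/iso_sym/ind_class_iso.
Qed.

End QuiverIso.

(** * Path categories *)

Lemma existT_inj (A : Type) (P : A -> Type) x (a b : P x) :
  existT P x a = existT P x b -> a = b.
Proof.
move=> e; rewrite -[b](projT2_eq e) (Prop_irrelevance (projT1_eq e) erefl) //.
Qed.

Lemma cons_inj (A : Type) (a b : A) (s t : seq A) : a :: s = b :: t -> a = b /\ s = t.
Proof. by case. Qed.

Lemma gen_ideal_min k (C : klincat k) (R : forall A B : C, hom C A B -> Prop) (J : ideal C) :
  (forall A B (r : hom C A B), R A B r -> J A B r) ->
  forall A B (f : hom C A B), gen_ideal R A B f -> J A B f.
Proof. by move=> RJ A B f; apply. Qed.

Lemma gen_ideal_mem k (C : klincat k) (R : forall A B : C, hom C A B -> Prop) A B r :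
  R A B r -> gen_ideal R A B r.
Proof. by move=> Rr I RI; apply: RI. Qed.

Section Paths.
Variable G : tquiver.
Implicit Types x y z : G.

Fixpoint plen x y (p : qpath x y) : nat :=
  if p is PCons _ _ _ _ p' then (plen p').+1 else 0.

Lemma plen_pcat x y z (p : qpath x y) (q : qpath y z) : plen (pcat p q) = (plen p + plen q)%N.
Proof. by elim: p q => //= x1 y1 z1 a p IH q; rewrite IH. Qed.

Definition arrow_path x y (a : arrow x y) : qpath x y := PCons a (PNil y).

Lemma plen_arrow x y (a : arrow x y) : plen (arrow_path a) = 1%N.
Proof. by []. Qed.

Fixpoint pflat x y (p : qpath x y) : seq {x : G & {y : G & arrow x y}} :=
  if p is PCons x y _ a p' then existT _ x (existT _ y a) :: pflat p' else [::].

(** Lists of arrows with their end points can be compared without transport along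
    equalities of vertices. *)
Lemma pflat_inj x y (p q : qpath x y) : pflat p = pflat q -> p = q.
Proof.
have nilP x1 y1 (r : qpath x1 y1) : pflat r = [::] ->
    forall e : x1 = y1, r = ecast w (qpath x1 w) e (PNil x1).
  by case: r => //= x2 _ e; rewrite (Prop_irrelevance e erefl).
elim: p q => [x0|x1 y1 z1 a p IH] q; first by move/esym/nilP/(_ erefl).
case: q y1 a p IH => [//|x2 y2 z2 b q] y1 a p IH pq.
have [e0 epq] := @cons_inj _ _ _ _ _ pq; have e := existT_inj e0.
have ey := projT1_eq e; simpl in ey; subst y2.
by rewrite -(existT_inj e) (IH _ epq).
Qed.

Lemma arrow_path_inj x y : injective (@arrow_path x y).
Proof.
move=> a b /(congr1 (@pflat x y)) e; have [e0 _] := @cons_inj _ _ _ _ _ e.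
exact: existT_inj (existT_inj e0).
Qed.

Lemma plen0P x y (p : qpath x y) : plen p = 0%N -> x = y.
Proof. by case: p. Qed.

Lemma plen0_nil x (p : qpath x x) : plen p = 0%N -> p = PNil x.
Proof.
have flat0 x1 y1 (q : qpath x1 y1) : plen q = 0%N -> pflat q = [::] by case: q.
by move=> p0; apply: pflat_inj; rewrite flat0.
Qed.

Lemma plen1P x y (p : qpath x y) : plen p = 1%N -> exists a, p = arrow_path a.
Proof.
by case: p => // x1 y1 z1 a p; case: p a => // y2 a _; exists a.
Qed.

Lemma last_arrow x z (p : qpath x z) : (0 < plen p)%N ->
  exists y (q : qpath x y) (a : arrow y z), p = pcat q (arrow_path a).
Proof.
elim: p => // x1 y1 z1 a p IH _; case: (posnP (plen p)) => [p0|/IH].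
  case: p a p0 IH => // y2 a _ _; exists x1, (PNil x1), a => //.
by move=> [y [q [b ->]]]; exists y, (PCons a q), b.
Qed.

Variable k : fieldType.
Local Notation P := (path_category k G).
Local Notation I s := (@gen_ideal k P (is_mesh (G := G) s)).

Definition arr x y (a : arrow x y) : hom P x y := << arrow_path a >>.

Lemma path_hom_ind x y (Q : hom P x y -> Prop) : Q 0 ->
  (forall a p g, Q g -> Q (a *: (<< p >> : hom P x y) + g)) -> forall f, Q f.
Proof. exact: malg_lin_ind. Qed.

Lemma path_lin_eq (V : lmodType k) x y (L L' : hom P x y -> V) :
  (forall a f g, L (a *: f + g) = a *: L f + L g) ->
  (forall a f g, L' (a *: f + g) = a *: L' f + L' g) ->
  (forall p, L << p >> = L' << p >>) -> forall f, L f = L' f.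
Proof. exact: malg_lin_eq. Qed.

(** The filtration of the path category by the powers of the arrow ideal. *)
Definition order_ge n x y (f : hom P x y) := forall p, (plen p < n)%N -> f@_p = 0.

Lemma order_ge_ind n x y (Q : hom P x y -> Prop) : Q 0 ->
  (forall a p g, (n <= plen p)%N -> Q g -> Q (a *: << p >> + g)) ->
  forall f, order_ge n f -> Q f.
Proof.
move=> Q0 QS f fn; rewrite [f]monalgE.
have : all (fun p => n <= plen p)%N (enum_fset (msupp f)).
  apply/allP => p pf; rewrite leqNgt; apply/negP => /fn.
  by apply/eqP; rewrite mcoeff_neq0.
elim: (enum_fset _) => [|p r IH] /=; first by rewrite big_nil.
move=> /andP [np nr]; rewrite big_cons; set c := f@_p.
have -> : << c *g p >> = c *: << p >> :> {malg k[qpath x y]}.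
  by apply/malgP => q; rewrite mcoeffZ !mcoeffU mulr_natr.
exact: QS np (IH nr).
Qed.

Lemma order_ge_lin n x y a (f g : hom P x y) :
  order_ge n f -> order_ge n g -> order_ge n (a *: f + g).
Proof. by move=> fn gn p pn; rewrite mcoeffD mcoeffZ fn ?gn // mulr0 addr0. Qed.

Definition order_submod n x y : submodule (hom P x y) :=
  @Submodule k (hom P x y) (@order_ge n x y) (fun p _ => mcoeff0 p) (@order_ge_lin n x y).

Lemma order_ge_sum n x y J (r : seq J) (F : J -> hom P x y) :
  (forall j, order_ge n (F j)) -> order_ge n (\sum_(j <- r) F j).
Proof.
move=> Fn; elim/big_ind: _ => // [p _|f g fn gn]; first exact: mcoeff0.
exact: (submodD (S := order_submod n x y)).
Qed.

Lemma order_geS m n x y (f : hom P x y) : (n <= m)%N -> order_ge m f -> order_ge n f.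
Proof. by move=> nm fm p pn; apply: fm; apply: leq_trans pn nm. Qed.

Lemma coef_path x y (p q : qpath x y) : (<< p >> : hom P x y)@_q = (p == q)%:R.
Proof. by rewrite mcoeffU. Qed.

Lemma order_ge_path n x y (p : qpath x y) : (n <= plen p)%N -> order_ge n (<< p >> : hom P x y).
Proof.
move=> np q qn; rewrite coef_path; case: eqP => // pq.
by move: qn; rewrite -pq ltnNge np.
Qed.

Lemma path_compE x y z (p : qpath x y) (q : qpath y z) :
  (<< q >> : hom P y z) \oc (<< p >> : hom P x y) = << pcat p q >>.
Proof. exact: path_compU. Qed.

Lemma order_ge_comp m n x y z (g : hom P y z) (f : hom P x y) :
  order_ge m g -> order_ge n f -> order_ge (n + m)%N (g \oc f).
Proof.
move=> gm fn; move: g gm; apply: order_ge_ind => [|a q g mq gn].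
  by rewrite comp0l => p _; apply: mcoeff0.
rewrite comp_linl; apply: order_ge_lin gn; move: f fn.
apply: order_ge_ind => [|b p f np fn]; first by rewrite comp0r => p _; apply: mcoeff0.
rewrite comp_linr; apply: order_ge_lin fn; rewrite path_compE.
by apply: order_ge_path; rewrite plen_pcat leq_add.
Qed.

Lemma order_ge0 x y (f : hom P x y) : order_ge 0 f. Proof. by []. Qed.

Definition order_ideal (n : nat) : ideal P.
Proof.
exists (order_submod n) => x y z g f h.
  by have := order_ge_comp (@order_ge0 _ _ g) h; rewrite addn0.
by have := order_ge_comp h (@order_ge0 _ _ f); rewrite add0n.
Defined.

(** The coefficient of the trivial path. It is 0 for [x <> y], so that the lemmas
    below hold for all pairs of vertices. *)
Definition coef0 x y (f : hom P x y) : k :=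
  if pselect (x = y) is left e then f@_(ecast w (qpath x w) e (PNil x)) else 0.

Lemma coef0_lin x y a (f g : hom P x y) : coef0 (a *: f + g) = a * coef0 f + coef0 g.
Proof.
rewrite /coef0; case: pselect => [e|_]; last by rewrite mulr0 addr0.
by rewrite mcoeffD mcoeffZ.
Qed.

Lemma coef0_0 x y : coef0 (0 : hom P x y) = 0.
Proof. by rewrite /coef0; case: pselect => // e; rewrite mcoeff0. Qed.

Lemma coef0E x (f : hom P x x) : coef0 f = f@_(PNil x).
Proof.
rewrite /coef0; case: pselect => // e.
by rewrite (Prop_irrelevance e erefl).
Qed.

Lemma coef0_path x y (p : qpath x y) : (0 < plen p)%N -> coef0 (<< p >> : hom P x y) = 0.
Proof.
move=> p0; rewrite /coef0; case: pselect => // e; rewrite coef_path; case: eqP => // pe.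
by move: p0; rewrite pe; case: _ / e {pe}.
Qed.

Lemma order_ge1P x y (f : hom P x y) : order_ge 1 f <-> coef0 f = 0.
Proof.
split=> [f1|f0 p]; last first.
  rewrite ltnS leqn0 => /eqP p0; have e := plen0P p0; subst y.
  by rewrite (plen0_nil p0) -coef0E.
rewrite /coef0; case: pselect => // e; rewrite f1 //.
by case: _ / e.
Qed.

Lemma order0_endo x y (f : hom P x y) : ~ order_ge 1 f ->
  x = y.
Proof.
move=> nf; apply: contrapT => xy; apply: nf; apply/order_ge1P.
by rewrite /coef0; case: pselect.
Qed.

Lemma coef0_idm x : coef0 (@idm k P x) = 1.
Proof. by rewrite coef0E coef_path eqxx. Qed.

Lemma order_ge1_sub x (f : hom P x x) : order_ge 1 (f - coef0 f *: @idm k P x).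
Proof.
by apply/order_ge1P; rewrite addrC -scaleNr coef0_lin coef0_idm mulr1 addNr.
Qed.

Lemma order_ge2P x y (f : hom P x y) :
  order_ge 2 f <-> order_ge 1 f /\ forall a, f@_(arrow_path a) = 0.
Proof.
split=> [f2|[f1 fa] p]; first by split=> [|a]; [apply: order_geS f2|apply: f2].
rewrite ltnS leq_eqVlt => /orP [/eqP /plen1P [a ->] //|]; exact: f1.
Qed.

(** A sum over all arrows into [u] is a single sum over these pairs. *)
Definition in_arrows u : Type := {y : G & arrow y u}.

Lemma coef1_comp_l z y u (a : arrow y u) (b : arrow z u) (m : hom P z y) :
  (arr a \oc m)@_(arrow_path b) =
  if pselect (existT (fun y => arrow y u) y a = existT _ z b) then coef0 m else 0.
Proof.
suff path (p : qpath z y) : (arr a \oc (<< p >> : hom P z y))@_(arrow_path b) =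
    if pselect (existT (fun y => arrow y u) y a = existT _ z b)
    then coef0 (<< p >> : hom P z y) else 0.
  move: m; apply: path_hom_ind => [|c p g IH].
    by rewrite comp0r mcoeff0; case: pselect => /= _; rewrite ?coef0_0.
  rewrite comp_linr mcoeffD mcoeffZ IH path; case: pselect => /= _; first by rewrite coef0_lin.
  by rewrite mulr0 addr0.
rewrite path_compE coef_path; case: (posnP (plen p)) => [p0|p0]; last first.
  rewrite coef0_path //; case: eqP => [pa|_]; last by case: pselect.
  by have := congr1 (@plen z u) pa; rewrite plen_pcat !plen_arrow addn1 => -[pl]; rewrite pl in p0.
have e := plen0P p0; subst z; rewrite (plen0_nil p0) /= coef0E coef_path eqxx.
case: eqP => [/arrow_path_inj ->|ab]; case: pselect => /= [ex|nex] //.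
by rewrite (existT_inj ex) in ab.
Qed.

Lemma coef1_comp_r z y u (a : arrow u y) (b : arrow u z) (m : hom P y z) :
  (m \oc arr a)@_(arrow_path b) =
  if pselect (existT (fun y => arrow u y) y a = existT _ z b) then coef0 m else 0.
Proof.
suff path (p : qpath y z) : ((<< p >> : hom P y z) \oc arr a)@_(arrow_path b) =
    if pselect (existT (fun y => arrow u y) y a = existT _ z b)
    then coef0 (<< p >> : hom P y z) else 0.
  move: m; apply: path_hom_ind => [|c p g IH].
    by rewrite comp0l mcoeff0; case: pselect => /= _; rewrite ?coef0_0.
  rewrite comp_linl mcoeffD mcoeffZ IH path; case: pselect => /= _; first by rewrite coef0_lin.
  by rewrite mulr0 addr0.
rewrite path_compE coef_path; case: (posnP (plen p)) => [p0|p0]; last first.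
  rewrite coef0_path //; case: eqP => [pa|_]; last by case: pselect.
  by have := congr1 (@plen u z) pa; rewrite plen_pcat !plen_arrow add1n => -[pl]; rewrite pl in p0.
have e := plen0P p0; subst z; rewrite (plen0_nil p0) pcat0 coef0E coef_path eqxx.
case: eqP => [/arrow_path_inj ->|ab]; case: pselect => /= [ex|nex] //.
by rewrite (existT_inj ex) in ab.
Qed.

(** The coordinates in the basis of arrows are the coefficients at these paths. *)
Lemma order_dim x y : quotient_has_dim (@order_ge 1 x y) (order_submod 2 x y) (tq_arr x y).
Proof.
have coefE (c : 'rV[k]_(tq_arr x y)) (f : hom P x y) j :
    (f - \sum_i c 0 i *: arr i)@_(arrow_path j) = f@_(arrow_path j) - c 0 j.
  rewrite mcoeffB (raddf_sum (mcoeff (arrow_path j))) /= (bigD1 j) //= mcoeffZ coef_path.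
  rewrite eqxx mulr1 big1 ?addr0 // => i ij; rewrite mcoeffZ coef_path.
  case: eqP => [/arrow_path_inj e|_]; last by rewrite mulr0.
  by rewrite e eqxx in ij.
have sum1 (c : 'rV[k]_(tq_arr x y)) : order_ge 1 (\sum_i c 0 i *: arr i).
  by apply: order_ge_sum => i p p0; rewrite mcoeffZ (order_ge_path (n := 1)) ?mulr0.
exists (fun a => arr a); split=> [a|f f1]; first exact: order_ge_path.
exists (\row_i f@_(arrow_path i)); split=> [|c].
  apply/order_ge2P; split=> [|a]; last by rewrite coefE mxE subrr.
  exact: (@submodD _ _ (order_submod 1 x y) _ _ f1
    (@submodN _ _ (order_submod 1 x y) _ (sum1 _))).
move=> /order_ge2P [_ c0]; apply/rowP => j; rewrite mxE.
by apply/eqP; rewrite -subr_eq0 -coefE c0.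
Qed.

(** * Truncation and the mesh ideal *)

Definition trunc n x y (f : hom P x y) : hom P x y :=
  lext (fun p => if (plen p < n)%N then << p >> else 0 : hom P x y) f.

Lemma trunc_lin n x y a (f g : hom P x y) :
  trunc n (a *: f + g) = a *: trunc n f + trunc n g.
Proof. exact: lext_lin. Qed.

Lemma trunc_path n x y (p : qpath x y) :
  trunc n (<< p >> : hom P x y) = if (plen p < n)%N then << p >> else 0.
Proof. exact: lextU. Qed.

Lemma trunc0 n x y : trunc n (0 : hom P x y) = 0.
Proof. exact: lext0. Qed.

Lemma trunc_order n x y (f : hom P x y) : order_ge n f -> trunc n f = 0.
Proof.
move: f; apply: order_ge_ind => [|a p g np tg]; first exact: trunc0.
by rewrite trunc_lin tg trunc_path ltnNge np /= scaler0 addr0.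
Qed.

Lemma trunc_id x y (f : hom P x y) : exists n, forall m, (n <= m)%N -> trunc m f = f.
Proof.
move: f; apply: path_hom_ind => [|a p g [n nP]]; first by exists 0%N => m _; apply: trunc0.
exists (maxn n (plen p).+1) => m; rewrite geq_max => /andP [nm pm].
by rewrite trunc_lin trunc_path pm nP.
Qed.

Lemma trunc_comp_l n x y z (q : qpath y z) (f : hom P x y) :
  trunc n ((<< q >> : hom P y z) \oc f) = (<< q >> : hom P y z) \oc trunc (n - plen q) f.
Proof.
move: f; apply: path_lin_eq => [a f g|a f g|p].
- by rewrite comp_linr trunc_lin.
- by rewrite trunc_lin comp_linr.
rewrite path_compE !trunc_path plen_pcat ltn_subRL addnC.
by case: ifP; rewrite ?path_compE ?comp0r.
Qed.

Lemma trunc_comp_r n x y z (g : hom P y z) (p : qpath x y) :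
  trunc n (g \oc (<< p >> : hom P x y)) = trunc (n - plen p) g \oc (<< p >> : hom P x y).
Proof.
move: g; apply: path_lin_eq => [a f g|a f g|q].
- by rewrite comp_linl trunc_lin.
- by rewrite trunc_lin comp_linl.
rewrite path_compE !trunc_path plen_pcat ltn_subRL.
by case: ifP; rewrite ?path_compE ?comp0l.
Qed.

(** Holds for any quiver: a sum with infinite support is 0. *)
Lemma mesh_ind s u v (t : tq_trans u v) (Q : hom P v u -> Prop) :
  Q 0 -> (forall f g, Q f -> Q g -> Q (f + g)) ->
  (forall y (a : arrow y u), Q (arr a \oc arr (pol s t a))) -> Q (mesh k s t).
Proof.
move=> Q0 QD Qa; rewrite /mesh; elim/big_ind: _ => // y _.
elim/big_ind: _ => // a _; have := Qa y a.
by rewrite path_compE.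
Qed.

Variable s : polarization G.

Lemma mesh_order x y (f : hom P x y) : I s x y f -> order_ge 2 f.
Proof.
apply: (gen_ideal_min (J := order_ideal 2)) => v u r [t ->].
apply: mesh_ind => [p _|g h|z a]; first exact: mcoeff0.
  exact: (submodD (S := order_submod 2 v u)).
by rewrite path_compE; apply: order_ge_path.
Qed.

(** The mesh relations are homogeneous, so the truncations of the elements of the
    ideal that they generate stay in it. *)
Lemma mesh_trunc n x y (f : hom P x y) : I s x y f -> I s x y (trunc n f).
Proof.
have [J JE] : exists J : ideal P, forall x y f,
    J x y f <-> forall n, I s x y (trunc n f).
  unshelve eexists; first unshelve eexists.
  - move=> x1 y1; exists (fun f => forall n, I s x1 y1 (trunc n f)).
      by move=> m; rewrite trunc0; apply: submod0.
    by move=> a g h gI hI m; rewrite trunc_lin; apply: submodP.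
  - move=> x1 y1 z1 g h hI m; change (I s x1 z1 (trunc m (g \oc h))).
    move: g; apply: path_hom_ind => [|a p g gI].
      by rewrite comp0l trunc0; apply: submod0.
    rewrite comp_linl trunc_lin; apply: submodP gI.
    by rewrite trunc_comp_l; apply: ideal_compl.
  - move=> x1 y1 z1 g h gI m; change (I s x1 z1 (trunc m (g \oc h))).
    move: h; apply: path_hom_ind => [|a p h hI].
      by rewrite comp0r trunc0; apply: submod0.
    rewrite comp_linr trunc_lin; apply: submodP hI.
    by rewrite trunc_comp_r; apply: ideal_compr.
  - by [].
move=> fI; move: n; apply/JE; move: fI; apply: gen_ideal_min => v u r [t ->].
apply/JE => n.
have truncD m x1 y1 (g h : hom P x1 y1) : trunc m (g + h) = trunc m g + trunc m h.
  by rewrite -[g]scale1r trunc_lin !scale1r.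
have [n2|n2] := ltnP 2 n.
  have -> : trunc n (mesh k s t) = mesh k s t.
    apply: (mesh_ind (Q := fun f => trunc n f = f)) => [|g h gE hE|y1 a]; first exact: trunc0.
      by rewrite truncD gE hE.
    by rewrite path_compE trunc_path /= n2.
  by apply: gen_ideal_mem; exists t.
have -> : trunc n (mesh k s t) = 0.
  apply: (mesh_ind (Q := fun f => trunc n f = 0)) => [|g h gE hE|y1 a]; first exact: trunc0.
    by rewrite truncD gE hE addr0.
  by rewrite path_compE trunc_path /= ltnNge n2.
exact: submod0.
Qed.

(** * Locally finite quivers *)

Definition locally_finite :=
  forall u, exists r : seq {classic G}, forall y, arrow y u -> y \in r.

Definition enumerates u (L : seq {classic in_arrows u}) :=
  uniq L /\ forall e : in_arrows u, (e : {classic in_arrows u}) \in L.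

Definition arrows_into u (r : seq {classic G}) : seq {classic in_arrows u} :=
  [seq existT (fun y => arrow y u) y a | y <- r, a <- enum 'I_(tq_arr y u)].

Lemma arrows_into_uniq u r : uniq r -> uniq (arrows_into u r).
Proof.
move=> ur; apply: (@allpairs_uniq_dep {classic G} (fun y => 'I_(tq_arr y u)) {classic in_arrows u}
  (fun y a => existT _ y a)) => // [y _|[y a] [y' a'] _ _ //].
exact: enum_uniq.
Qed.

Lemma arrows_into_mem u r (e : in_arrows u) : (tag e : {classic G}) \in r ->
  (e : {classic in_arrows u}) \in arrows_into u r.
Proof.
case: e => y a /= yr;
apply/(@allpairsPdep {classic G} (fun y => 'I_(tq_arr y u)) {classic in_arrows u}
  (fun y a => existT _ y a)); exists y, a; split=> //.
by rewrite mem_enum.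
Qed.

Lemma enumeration_exists u : locally_finite -> exists L, @enumerates u L.
Proof.
move=> /(_ u) [r rP]; exists (arrows_into u (undup r)); split=> [|[y a]].
  exact/arrows_into_uniq/undup_uniq.
by apply: arrows_into_mem; rewrite mem_undup; apply: rP.
Qed.

Lemma mesh_sum u v (t : tq_trans u v) L : enumerates L ->
  mesh k s t = \sum_(e <- L) arr (tagged (e : in_arrows u)) \oc
                             arr (pol s t (tagged (e : in_arrows u))).
Proof.
move=> [uL memL].
pose start (e : {classic in_arrows u}) : {classic G} := tag (e : in_arrows u).
pose r : seq {classic G} := undup (map start L).
have rP (y : G) (a : arrow y u) : (y : {classic G}) \in r.
  by rewrite mem_undup; apply/mapP; exists (existT _ y a : in_arrows u).
have -> : mesh k s t = \sum_(y <- r) \sum_(a < tq_arr y u) arr a \oc arr (pol s t a).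
  rewrite /mesh (fsbigE r) ?undup_uniq //.
    apply: eq_big => [y|y _]; first by rewrite in_setT.
    by apply: eq_bigr => a _; rewrite path_compE.
  move=> y _ yr; rewrite big1 // => a _.
  by have := rP y a; rewrite (negbTE yr).
rewrite (perm_big (arrows_into u r)) /=; last first.
  apply: uniq_perm => // [|e]; first exact/arrows_into_uniq/undup_uniq.
  rewrite memL; apply/esym/arrows_into_mem; case: e => y a; exact: rP.
rewrite big_allpairs_dep /=; apply: eq_bigr => y _.
by rewrite big_enum.
Qed.

(** Grouping the paths of positive length by their last arrow. *)
Lemma last_arrow_sum u w L (f : hom P w u) : enumerates L -> order_ge 1 f ->
  exists c : forall e : in_arrows u, hom P w (tag e),
    f = \sum_(e <- L) arr (tagged (e : in_arrows u)) \oc c e.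
Proof.
move=> [uL memL]; move: f; apply: order_ge_ind => [|a p g p0 [c ->]].
  by exists (fun=> 0); rewrite big1 // => e _; rewrite comp0r.
have [y [q [b pE]]] := last_arrow p0.
pose x0 : in_arrows u := existT _ y b.
pose d (e1 : in_arrows u) : hom P w (tag e1) :=
  if pselect (x0 = e1) is left e then ecast i (hom P w (tag i)) e (<< q >> : hom P w (tag x0))
  else 0.
exists (fun e => a *: d e + c e).
under [RHS]eq_bigr => e _ do rewrite comp_linr.
rewrite big_split /=; congr (_ + _); rewrite -scaler_sumr; congr (_ *: _).
have dx0 : d x0 = << q >>.
  rewrite /d; case: pselect => // e.
  by rewrite (Prop_irrelevance e erefl).
rewrite (bigD1_seq (x0 : {classic in_arrows u}) (memL x0) uL) dx0 big1 => [|e1 e10].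
  by rewrite -[RHS]/(arr b \oc (<< q >> : hom P w y) + 0) addr0 pE; apply/esym/path_compE.
suff -> : d e1 = 0 by apply: (comp0r (C := P)).
by rewrite /d; case: pselect => // e; rewrite e eqxx in e10.
Qed.

End Paths.

(** * Categories presented by a mesh category *)

Section MeshModel.
Variables (k : closedFieldType) (G : tquiver) (s : polarization G).
Variables (T : tricat k) (S : serre_functor T).
Hypotheses (hfin : hom_finite T) (hsplit : split_idempotents T).
Local Notation P := (path_category k G).
Variable W : klinfunctor P T.
Hypothesis Wfull : full W.
Hypothesis Wker : forall x y (f : hom P x y),
  fmap W f = 0 <-> @gen_ideal k P (is_mesh (G := G) s) x y f.
Hypothesis Wdense : forall A : T, exists n (t : 'I_n -> G), is_nsum (fun l => W (t l)) A.
Implicit Types u v w x y z : G.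

Lemma W_order2 x y (f g : hom P x y) : fmap W f = fmap W g -> order_ge 2 (f - g).
Proof. by move=> fg; apply/(@mesh_order _ _ s)/Wker; rewrite fmapB fg subrr. Qed.

Lemma W_order x y (f g : hom P x y) n : (n <= 2)%N -> fmap W f = fmap W g ->
  order_ge n f -> order_ge n g.
Proof.
move=> n2 fg fn; rewrite -[g](subrK f).
apply: (submodD (S := order_submod k n x y)) fn.
by apply: order_geS n2 (W_order2 (esym fg)).
Qed.

Lemma coef0_comp x (g f : hom P x x) : coef0 (g \oc f) = coef0 g * coef0 f.
Proof.
have gE : g = coef0 g *: @idm k P x + (g - coef0 g *: @idm k P x) by rewrite addrC subrK.
have /order_ge1P g1 : order_ge 1 ((g - coef0 g *: @idm k P x) \oc f).
  by have := order_ge_comp (order_ge1_sub g) (order_ge0 f); rewrite add0n.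
by rewrite {1}gE compDl compZl comp1m coef0_lin g1 addr0.
Qed.

Lemma coef0_sub x y (f g : hom P x y) : coef0 (f - g) = coef0 f - coef0 g.
Proof. by rewrite addrC -scaleN1r coef0_lin mulN1r addrC. Qed.

Lemma W_coef0 x y (f g : hom P x y) : fmap W f = fmap W g -> coef0 f = coef0 g.
Proof.
move=> fg; apply/eqP; rewrite -subr_eq0 -coef0_sub; apply/eqP/order_ge1P.
exact: order_geS (W_order2 fg).
Qed.

Lemma W_nonzero x : ~ is_zero (W x).
Proof.
move=> z; have /W_coef0 : fmap W (@idm k P x) = fmap W 0 by rewrite fmap1 z fmap0.
by rewrite coef0_idm coef0_0 => /eqP; rewrite oner_eq0.
Qed.

(** An idempotent of positive order equals all its powers, which have arbitrarily
    large order; since the relations are homogeneous, it vanishes. *)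
Lemma W_idem0 x (f : hom P x x) : order_ge 1 f ->
  fmap W f \oc fmap W f = fmap W f -> fmap W f = 0.
Proof.
move=> f1 ee; have [N NP] := trunc_id f.
have fN n : order_ge n (epow f n).
  by elim: n => [//|n IH]; have := order_ge_comp f1 IH; rewrite addn1.
have fE : trunc N.+1 (epow f N.+1 - f) = - f.
  by rewrite [epow _ _ - f]addrC -scaleN1r trunc_lin NP // trunc_order // addr0 scaleN1r.
apply/Wker; rewrite -[f]opprK -fE.
apply: submodN; apply: mesh_trunc; apply/Wker.
by rewrite fmapB fmap_epow idem_epow // subrr.
Qed.

Lemma W_local x : local_obj (W x).
Proof.
have [n sp] := spanned_hom_finite (W x) (W x) hfin.
apply: (fitting sp); split=> [|e ee]; first exact: W_nonzero.
have [f fE] := Wfull e; subst e.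
have cc : coef0 f * coef0 f = coef0 f.
  by rewrite -coef0_comp; apply: W_coef0; rewrite fmapM.
have [/order_ge1P f1|c0] := eqVneq (coef0 f) 0; first by left; apply: W_idem0.
have c1 : coef0 f = 1 by apply: (mulfI c0); rewrite cc mulr1.
right; apply/esym/eqP; rewrite -subr_eq0 -(fmap1 W) -fmapB; apply/eqP/W_idem0.
  by apply/order_ge1P; rewrite coef0_sub coef0_idm c1 subrr.
by rewrite fmapB fmap1; have [] := idem_complement ee.
Qed.

(** An isomorphism has a nonzero coefficient at a trivial path, as the product with
    its inverse has; conversely a nonzero multiple of the identity plus a morphism
    of positive order is invertible. *)
Lemma W_rad x y (f : hom P x y) : rad (fmap W f) <-> order_ge 1 f.
Proof.
split=> [rf|f1]; last first.
  apply/(rad_not_iso _ (W_local x) (W_local y)) => -[g [gf _]].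
  have [h hE] := Wfull g; subst g; move: gf; rewrite -fmapM -(fmap1 W) => /W_coef0.
  have /order_ge1P -> : order_ge 1 (h \oc f).
    by have := order_ge_comp (order_ge0 h) f1; rewrite addn0.
  by rewrite coef0_idm => /esym/eqP; rewrite oner_eq0.
apply: contrapT => nf; have e := order0_endo nf; subst y.
have c0 : coef0 f != 0 by apply/eqP => /order_ge1P.
have lx := W_local x.
have r1 : rad (fmap W (f - coef0 f *: @idm k P x)).
  apply/(rad_not_iso _ lx lx) => -[g [gf _]].
  have [h hE] := Wfull g; subst g; move: gf; rewrite -fmapM -(fmap1 W) => /W_coef0.
  rewrite coef0_comp (_ : coef0 (f - _) = 0) ?mulr0.
    by rewrite coef0_idm => /esym/eqP; rewrite oner_eq0.
  exact/order_ge1P/order_ge1_sub.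
have /(rad_not_iso _ lx lx) : rad (fmap W f) by [].
apply; have -> : fmap W f = coef0 f *: (idm (W x) -
    (- (coef0 f)^-1 *: idm (W x)) \oc fmap W (f - coef0 f *: @idm k P x)).
  rewrite compZl comp1m scaleNr opprK scalerDr scalerA divff // scale1r.
  by rewrite fmapB fmapZ fmap1 addrC subrK.
exact/is_iso_scale/r1.
Qed.

Lemma W_iso_inj x y : iso (W x) (W y) -> x = y.
Proof.
move=> [g gi]; have [f fE] := Wfull g; subst g.
apply: (@order0_endo _ k x y f) => /W_rad /(rad_not_iso _ (W_local x) (W_local y)).
by apply.
Qed.

(** Decompose [Z] into images of vertices and apply [W_rad] to the components. *)
Lemma W_rad2_factor x y (Z : T) (f : hom T (W x) Z) (g : hom T Z (W y)) :
  rad f -> rad g -> exists2 h : hom P x y, order_ge 2 h & fmap W h = g \oc f.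
Proof.
move=> rf rg; have [n [t [i [p [_ _ ip]]]]] := Wdense Z.
pose a l := projT1 (cid (Wfull (p l \oc f))); pose b l := projT1 (cid (Wfull (g \oc i l))).
have aE l : fmap W (a l) = p l \oc f := projT2 (cid (Wfull (p l \oc f))).
have bE l : fmap W (b l) = g \oc i l := projT2 (cid (Wfull (g \oc i l))).
exists (\sum_l b l \oc a l).
  apply: order_ge_sum => l.
  have a1 : order_ge 1 (a l) by apply/W_rad; rewrite aE; apply: rad_comp_l.
  have b1 : order_ge 1 (b l) by apply/W_rad; rewrite bE; apply: rad_comp_r.
  exact: order_ge_comp b1 a1.
rewrite fmap_sum -[g]compm1 -ip comp_sumr comp_suml; apply: eq_bigr => l _.
by rewrite fmapM aE bE !compA.
Qed.

Lemma W_rad2 x y (f : hom P x y) : rad2 (fmap W f) <-> order_ge 2 f.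
Proof.
split=> [[n [Z [g [h [rgh fE]]]]]|].
  have hP l := W_rad2_factor (rgh l).1 (rgh l).2.
  pose a l := s2val (cid2 (hP l)).
  have a2 l : order_ge 2 (a l) := s2valP (cid2 (hP l)).
  have aE l : fmap W (a l) = g l \oc h l := s2valP' (cid2 (hP l)).
  apply: (@W_order _ _ (\sum_l a l)) => //; last exact: order_ge_sum.
  by rewrite fE fmap_sum; apply: eq_bigr => l _; rewrite aE.
move: f; apply: order_ge_ind => [|c p g]; first by rewrite fmap0; apply: rad2_0.
case: p g => [//|x1 y1 z1 a p] g p2 rg; rewrite fmap_lin.
have -> : << PCons a p >> = (<< p >> : hom P y1 z1) \oc arr k a by rewrite path_compE.
rewrite fmapM -compZl; apply: rad2_add1 rg.
  by apply/W_rad/order_ge_path.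
by rewrite -fmapZ; apply/W_rad => q q0; rewrite mcoeffZ (_ : _@_q = 0) ?mulr0 //;
  apply: order_ge_path q0.
Qed.

Lemma W_irr_dim x y : irr_dim (W x) (W y) = tq_arr x y.
Proof.
have dims n : quotient_has_dim (@order_ge _ k 1 x y) (@order_ge _ k 2 x y) n <->
    quotient_has_dim (@rad _ _ (W x) (W y)) (@rad2 _ _ (W x) (W y)) n.
  apply: (quotient_dim_transfer (L := fmap W (A := x) (B := y))).
  - by move=> a f g; apply: fmap_lin.
  - exact: Wfull.
  - by move=> f; apply: iff_sym; apply: W_rad.
  - by move=> f; apply: iff_sym; apply: W_rad2.
rewrite /irr_dim; set D := [set _ | _]%classic.
have : D (xget 0%N D) by apply: xgetPex; exists (tq_arr x y); apply/dims/order_dim.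
move=> /dims d; apply/eqP; rewrite eqn_leq.
by rewrite !(quotient_dim_le (P := @order_ge _ k 1 x y) (Q := order_submod k 2 x y)) //;
  apply: order_dim.
Qed.

(** A radical map into [W u] factors through the middle term of the AR triangle
    ending in [W u], so an arrow can only start at a summand of that term. *)
Lemma W_locally_finite : locally_finite G.
Proof.
move=> u; have lu := W_local u.
have [B [a [v [w [t nz wt _]]]]] := ar_exists S hfin lu.
have rv : rad v.
  apply/radP_r => // c vc; apply: nz.
  by rewrite -[w]compm1 -vc compA (tri_comp0_2 t) comp0l.
have [n [tt [i [p [_ _ ip]]]]] := Wdense B.
exists [seq (tt l : {classic G}) | l <- enum 'I_n] => y b.
apply/mapP; apply: contrapT => ny.
have rb : rad (fmap W (arr k b)) by apply/W_rad/order_ge_path.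
have [h hE] := tri_lift2 t (wt _ _ ((radP_r _ lu).1 rb)).
have : rad2 (fmap W (arr k b)).
  exists n, (fun l => W (tt l)), (fun l => v \oc i l), (fun l => p l \oc h).
  split=> [l|].
    split; last exact: rad_comp_r.
    apply/(rad_not_iso _ (W_local _) (W_local _)) => phi.
    apply: ny; exists l; first by rewrite mem_enum.
    by apply: W_iso_inj; exists (p l \oc h).
  rewrite hE -[v in LHS]compm1 -ip comp_sumr comp_suml.
  by apply: eq_bigr => l _; rewrite !compA.
move=> /W_rad2 /(_ (arrow_path b) isT) /eqP.
by rewrite coef_path eqxx oner_eq0.
Qed.

(** The morphism of the mesh into the middle term of the AR triangle of [W u] lifts
    to a morphism [W v -> tau (W u)]; if that one were radical, the starting
    arrows of the mesh would be in rad^2. *)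
Lemma W_translate u v y0 (b0 : arrow y0 u) : tq_trans u v -> iso (W v) (ar_tau S (W u)).
Proof.
move=> tuv; have lu := W_local u.
have [B [a [c [w [t nz wt _]]]]] := ar_exists S hfin lu.
have rc : rad c.
  apply/radP_r => // d cd; apply: nz.
  by rewrite -[w]compm1 -cd compA (tri_comp0_2 t) comp0l.
have [L [uL memL]] := enumeration_exists u W_locally_finite.
pose alpha (e : in_arrows u) : hom T (W (tag e)) (W u) := fmap W (arr k (tagged e)).
have ralpha e : rad (alpha e) by apply/W_rad/order_ge_path.
have hP e := tri_lift2 t (wt _ _ ((radP_r _ lu).1 (ralpha e))).
pose h e := projT1 (cid (hP e)).
have hE e : alpha e = c \oc h e := projT2 (cid (hP e)).
have [h' cE] : exists h' : forall e : in_arrows u, hom T B (W (tag e)),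
    c = \sum_(e <- L) alpha e \oc h' e.
  have [n [tt [i [p [_ _ ip]]]]] := Wdense B.
  pose g l := projT1 (cid (Wfull (c \oc i l))).
  have gE l : fmap W (g l) = c \oc i l := projT2 (cid (Wfull (c \oc i l))).
  have g1 l : order_ge 1 (g l) by apply/W_rad; rewrite gE; apply: rad_comp_r.
  pose d l := projT1 (cid (last_arrow_sum (conj uL memL) (g1 l))).
  have dE l : g l = \sum_(e <- L) arr k (tagged (e : in_arrows u)) \oc d l e :=
    projT2 (cid (last_arrow_sum (conj uL memL) (g1 l))).
  exists (fun e => \sum_l fmap W (d l e) \oc p l).
  rewrite -[LHS]compm1 -ip comp_sumr.
  under [RHS]eq_bigr => e _ do rewrite comp_sumr.
  rewrite exchange_big /=; apply: eq_bigr => l _.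
  rewrite compA -gE dE fmap_sum comp_suml; apply: eq_bigr => e _.
  by rewrite fmapM compA.
pose m e1 e2 := projT1 (cid (Wfull (h' e1 \oc h e2))).
have mE e1 e2 : fmap W (m e1 e2) = h' e1 \oc h e2 := projT2 (cid (Wfull (h' e1 \oc h e2))).
pose e0 : in_arrows u := existT _ y0 b0.
(* Modulo paths of length 2, the arrow b0 is the combination of the arrows e with
   coefficients coef0 (m e e0). *)
have m00 : coef0 (m e0 e0) = 1.
  have /W_order2 : fmap W (arr k b0) =
      fmap W (\sum_(e <- L) arr k (tagged (e : in_arrows u)) \oc m e e0).
    rewrite fmap_sum -[LHS]/(alpha e0) hE {1}cE comp_suml; apply: eq_bigr => e _.
    by rewrite fmapM mE compA.
  move=> /(_ (arrow_path b0) isT).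
  rewrite mcoeffB coef_path eqxx (raddf_sum (mcoeff (arrow_path b0))).
  rewrite (bigD1_seq (e0 : {classic in_arrows u}) (memL e0) uL) /= coef1_comp_l.
  case: pselect => //= _; rewrite big1 => [|e ne].
    by rewrite addr0 => /eqP; rewrite subr_eq0 => /eqP <-.
  rewrite coef1_comp_l; case: pselect => //= ee.
  by case: e ne ee => y b ne ee; rewrite ee eqxx in ne.
have sum0 : c \oc (\sum_(e <- L) h e \oc fmap W (arr k (pol s tuv (tagged (e : in_arrows u))))) = 0.
  rewrite comp_sumr.
  under eq_bigr => e _ do rewrite compA -hE -fmapM.
  rewrite -fmap_sum -(mesh_sum k s tuv (conj uL memL)); apply/Wker.
  by apply: gen_ideal_mem; exists tuv.
(* The images of the starting arrows, taken together, factor through a. *)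
have [mm mmE] := tri_lift t sum0.
have lt := local_tau S hfin hsplit lu.
apply: contrapT => niso.
have rmm : rad mm.
  by apply/(rad_not_iso _ (W_local v) lt) => mi; apply: niso; exists mm.
have ra : rad a.
  apply/radP => // r ra; apply: nz.
  rewrite -[w]comp1m -(fmap1 (susp T)) -ra fmapM -compA.
  by rewrite (tri_comp0_3 t) comp0r.
(* Applying h' e0 recovers the arrow pol s tuv b0 modulo longer paths. *)
have : rad2 (h' e0 \oc (a \oc mm)) by apply: rad2_comp_l; apply: rad2_comp.
rewrite -mmE comp_sumr.
under eq_bigr => e _ do rewrite compA -mE -fmapM.
rewrite -fmap_sum => /W_rad2 /(_ (arrow_path (pol s tuv b0)) isT).
rewrite (raddf_sum (mcoeff (arrow_path (pol s tuv b0)))).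
rewrite (bigD1_seq (e0 : {classic in_arrows u}) (memL e0) uL) /= coef1_comp_r.
case: pselect => //= _; rewrite big1 => [|e ne].
  by rewrite addr0 m00 => /eqP; rewrite oner_eq0.
rewrite coef1_comp_r; case: pselect => //= ee.
case: e ne ee => y b ne ee; have ey := projT1_eq ee; simpl in ey; subst y.
have bb : b = b0 := bij_inj (pol_bij s tuv y0) (existT_inj ee).
by rewrite bb eqxx in ne.
Qed.

End MeshModel.

(** * Deleting vertices of a translation quiver *)

Section Deletion.
Variables (k : fieldType) (G G' : tquiver) (s : polarization G) (psi : G' -> G).
Hypothesis psi_inj : injective psi.
Hypothesis psi_tq_arr : forall x y, tq_arr (psi x) (psi y) = tq_arr x y.
Hypothesis psi_trans : forall (x z : G') y (a : arrow y (psi x)),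
  tq_trans x z <-> tq_trans (psi x) (psi z).
Hypothesis mesh_arr : forall x z : G', tq_trans x z -> forall y : G', tq_arr y x = tq_arr z y.
Hypothesis Gfin : locally_finite G.
Local Notation P := (path_category k G).
Local Notation P' := (path_category k G').

Definition psi_arrow x y (a : arrow x y) : arrow (psi x) (psi y) :=
  cast_ord (esym (psi_tq_arr x y)) a.
Definition psi_arrowV x y (a : arrow (psi x) (psi y)) : arrow x y := cast_ord (psi_tq_arr x y) a.

Lemma psi_arrowK x y : cancel (@psi_arrow x y) (@psi_arrowV x y).
Proof. exact: cast_ordKV. Qed.

Lemma psi_arrowVK x y : cancel (@psi_arrowV x y) (@psi_arrow x y).
Proof. exact: cast_ordK. Qed.

(** The translations of [G'] and [G] agree at the vertices with an arrow into them.
    Where they differ, the sets of arrows are empty, and the equality of their sizes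
    provides the bijection. *)
Definition del_pol x z (t : tq_trans x z) y (a : arrow y x) : arrow z y :=
  if pselect (tq_trans (psi x) (psi z)) is left h then psi_arrowV (pol s h (psi_arrow a))
  else cast_ord (mesh_arr t y) a.

Lemma del_pol_bij x z (t : tq_trans x z) y : bijective (@del_pol x z t y).
Proof.
rewrite /del_pol; case: pselect => [h|_] /=; last first.
  by exists (cast_ord (esym (mesh_arr t y))); [apply: cast_ordK|apply: cast_ordKV].
have b1 : bijective (@psi_arrow y x).
  by exists (@psi_arrowV y x); [apply: psi_arrowK|apply: psi_arrowVK].
have b2 : bijective (@psi_arrowV z y).
  by exists (@psi_arrow z y); [apply: psi_arrowVK|apply: psi_arrowK].
exact: bij_comp b2 (bij_comp (pol_bij s h (psi y)) b1).
Qed.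

Definition del_polarization : polarization G' := Polarization del_pol_bij.
Local Notation s' := del_polarization.
Local Notation I := (@gen_ideal k P (is_mesh (G := G) s)).
Local Notation I' := (@gen_ideal k P' (is_mesh (G := G') s')).

Lemma del_polE x z (t : tq_trans x z) (h : tq_trans (psi x) (psi z)) y (a : arrow y x) :
  psi_arrow (pol s' t a) = pol s h (psi_arrow a).
Proof.
rewrite /= /del_pol; case: pselect => // h'.
by rewrite (Prop_irrelevance h' h) psi_arrowVK.
Qed.

Fixpoint psi_path x y (p : qpath x y) : qpath (psi x) (psi y) :=
  match p with
  | PNil x => PNil (psi x)
  | PCons _ _ _ a p' => PCons (psi_arrow a) (psi_path p')
  end.

Lemma psi_pcat x y z (p : qpath x y) (q : qpath y z) :
  psi_path (pcat p q) = pcat (psi_path p) (psi_path q).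
Proof. by elim: p q => //= x1 y1 z1 a p IH q; rewrite IH. Qed.

Definition psi_flat (e : {x : G' & {y : G' & arrow x y}}) : {x : G & {y : G & arrow x y}} :=
  existT _ (psi (tag e)) (existT _ (psi (tag (tagged e))) (psi_arrow (tagged (tagged e)))).

Lemma psi_flat_inj : injective psi_flat.
Proof.
move=> [x [y a]] [x' [y' a']] e.
have /= /psi_inj ex := projT1_eq e; subst x'; have e1 := existT_inj e.
have /= /psi_inj ey := projT1_eq e1; subst y'.
by have /(can_inj (@psi_arrowK _ _)) /= -> := existT_inj e1.
Qed.

Lemma psi_path_inj x y : injective (@psi_path x y).
Proof.
have flat x1 y1 (p : qpath x1 y1) : pflat (psi_path p) = map psi_flat (pflat p).
  by elim: p => //= x2 y2 z2 a p ->.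
move=> p q pq; apply/pflat_inj/(inj_map psi_flat_inj).
by rewrite -!flat pq.
Qed.

Definition kept (u : G) := exists x, psi x = u.

Fixpoint kept_path u v (p : qpath u v) : Prop :=
  match p with
  | PNil u => kept u
  | PCons u _ _ _ p' => kept u /\ kept_path p'
  end.

Lemma kept_path_start u v (p : qpath u v) : kept_path p -> kept u.
Proof. by case: p => //= u1 v1 w1 a p []. Qed.

Lemma kept_path_pcat u v w (p : qpath u v) (q : qpath v w) :
  kept_path (pcat p q) <-> kept_path p /\ kept_path q.
Proof.
elim: p q => [u1|u1 v1 w1 a p IH] q /=; last by rewrite IH; tauto.
by split=> [kq|[]//]; split=> //; apply: kept_path_start kq.
Qed.

Lemma kept_psi_path x y (p : qpath x y) : kept_path (psi_path p).
Proof. by elim: p => [x1|x1 y1 z1 a p IH] /=; [exists x1|split=> //; exists x1]. Qed.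

(** Comparing [pflat] instead of the paths avoids transport in the induction. *)
Lemma kept_path_lift x y (p : qpath (psi x) (psi y)) : kept_path p -> exists q, psi_path q = p.
Proof.
suff lift u v (r : qpath u v) : kept_path r -> forall x1 y1, psi x1 = u -> psi y1 = v ->
    exists q : qpath x1 y1, pflat (psi_path q) = pflat r.
  move=> /lift /(_ x y erefl erefl) [q qE]; exists q; exact: pflat_inj.
elim: r => [u1|u1 v1 w1 a r IH] /= kr x1 y1.
  by move=> <- /psi_inj ->; exists (PNil x1).
case: kr => _ kr ex ey; subst u1; have [z1 ez] := kept_path_start kr; subst v1.
have [q qE] := IH kr z1 y1 erefl ey.
by exists (PCons (psi_arrowV a) q); rewrite /= psi_arrowVK qE.
Qed.

Lemma dropped_path u v (p : qpath u v) : ~ kept_path p ->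
  exists w (p1 : qpath u w) (p2 : qpath w v), ~ kept w /\ p = pcat p1 p2.
Proof.
elim: p => [u1|u1 v1 w1 a p IH] /= np; first by exists u1, (PNil u1), (PNil u1).
have [ku|nk] := pselect (kept u1); last by exists u1, (PNil u1), (PCons a p).
have [|w [p1 [p2 [nw ->]]]] := IH; first by move=> kp; apply: np.
by exists w, (PCons a p1), p2.
Qed.

(** The inclusion of the path category of [G'], and its one-sided inverse on
    morphisms, which kills the paths through deleted vertices. *)
Definition incl_map x y (f : hom P' x y) : hom P (psi x) (psi y) :=
  lext (fun p => << psi_path p >> : hom P (psi x) (psi y)) f.

Lemma incl_lin x y a (f g : hom P' x y) : incl_map (a *: f + g) = a *: incl_map f + incl_map g.
Proof. exact: lext_lin. Qed.

Lemma incl_path x y (p : qpath x y) : incl_map (<< p >> : hom P' x y) = << psi_path p >>.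
Proof. exact: lextU. Qed.

Lemma incl0 x y : incl_map (0 : hom P' x y) = 0.
Proof. exact: lext0. Qed.

Lemma inclM x y z (g : hom P' y z) (f : hom P' x y) :
  incl_map (g \oc f) = incl_map g \oc incl_map f.
Proof.
move: f; apply: path_lin_eq => [a f f'|a f f'|p].
- by rewrite (@comp_linr k P') incl_lin.
- by rewrite incl_lin (@comp_linr k P).
move: g; apply: path_lin_eq => [a g g'|a g g'|q].
- by rewrite (@comp_linl k P') incl_lin.
- by rewrite incl_lin (@comp_linl k P).
by rewrite path_compE !incl_path path_compE psi_pcat.
Qed.

Definition incl : klinfunctor P' P :=
  @KLinFunctor k P' P psi incl_map incl_lin (fun x => incl_path (PNil x)) inclM.

Definition restr_path x y (p : qpath (psi x) (psi y)) : hom P' x y :=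
  if pselect (exists q, psi_path q = p) is left e then << projT1 (cid e) >> else 0.

Definition restr x y (f : hom P (psi x) (psi y)) : hom P' x y := lext (@restr_path x y) f.

Lemma restr_lin x y a (f g : hom P (psi x) (psi y)) :
  restr (a *: f + g) = a *: restr f + restr g.
Proof. exact: lext_lin. Qed.

Lemma restr0 x y : restr (0 : hom P (psi x) (psi y)) = 0.
Proof. exact: lext0. Qed.

Lemma restrD x y (f g : hom P (psi x) (psi y)) : restr (f + g) = restr f + restr g.
Proof. by rewrite -[f]scale1r restr_lin !scale1r. Qed.

Lemma restr_psi_path x y (p : qpath x y) : restr (<< psi_path p >> : hom P _ _) = << p >>.
Proof.
rewrite [LHS]lextU /restr_path; case: pselect => [e|[]]; last by exists p.
by congr << _ >>; apply: psi_path_inj; exact: (projT2 (cid e)).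
Qed.

Lemma restr_dropped x y (p : qpath (psi x) (psi y)) : ~ kept_path p ->
  restr (<< p >> : hom P _ _) = 0.
Proof.
move=> np; rewrite [LHS]lextU /restr_path; case: pselect => // -[q qp].
by case: np; rewrite -qp; apply: kept_psi_path.
Qed.

Lemma restrK x y (f : hom P' x y) : restr (incl_map f) = f.
Proof.
move: f; apply: path_hom_ind => [|a p f IH]; first by rewrite incl0 restr0.
by rewrite incl_lin restr_lin IH incl_path restr_psi_path.
Qed.

Lemma restrM x y z (g : hom P (psi y) (psi z)) (f : hom P (psi x) (psi y)) :
  restr (g \oc f) = restr g \oc restr f.
Proof.
move: f; apply: path_lin_eq => [a f f'|a f f'|p].
- by rewrite (@comp_linr k P) restr_lin.
- by rewrite restr_lin (@comp_linr k P').
move: g; apply: path_lin_eq => [a g g'|a g g'|q].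
- by rewrite (@comp_linl k P) restr_lin.
- by rewrite restr_lin (@comp_linl k P').
rewrite path_compE; have [kp|nkp] := pselect (kept_path p); last first.
  rewrite (restr_dropped nkp) (comp0r (C := P')) restr_dropped //.
  by move/kept_path_pcat => [].
have [kq|nkq] := pselect (kept_path q); last first.
  rewrite (restr_dropped nkq) (comp0l (C := P')) restr_dropped //.
  by move/kept_path_pcat => [].
have [p' <-] := kept_path_lift kp; have [q' <-] := kept_path_lift kq.
by rewrite -psi_pcat !restr_psi_path path_compE.
Qed.

Lemma restr_through x y w (g : hom P w (psi y)) (f : hom P (psi x) w) : ~ kept w ->
  restr (g \oc f) = 0.
Proof.
move=> nw; move: f; apply: (path_lin_eq (L' := fun=> 0)) => [a f f'|a f f'|p].
- by rewrite (@comp_linr k P) restr_lin.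
- by rewrite scaler0 addr0.
move: g; apply: (path_lin_eq (L' := fun=> 0)) => [a g g'|a g g'|q].
- by rewrite (@comp_linl k P) restr_lin.
- by rewrite scaler0 addr0.
rewrite path_compE restr_dropped //.
by move/kept_path_pcat => [_ /kept_path_start].
Qed.

(** * Meshes of the smaller quiver *)

Lemma del_locally_finite : locally_finite G'.
Proof.
move=> x; have [r rP] := Gfin (psi x).
have [r' r'P] : exists r' : seq {classic G'}, forall y : G',
    (psi y : {classic G}) \in r -> (y : {classic G'}) \in r'.
  elim: (r) => [|v r1 [r' IH]]; first by exists [::].
  have [[y yv]|nv] := pselect (kept v).
    exists ((y : {classic G'}) :: r') => z; rewrite !inE.
    move=> /orP [/eqP|/IH ->]; last by rewrite orbT.
    by rewrite -yv => /psi_inj ->; rewrite eqxx.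
  exists r' => z; rewrite inE => /orP [/eqP zv|/IH//].
  by case: nv; exists z.
by exists r' => y a; apply: r'P; apply: rP (psi_arrow a).
Qed.

Definition psi_in_arrow x (e : in_arrows x) : in_arrows (psi x) :=
  existT _ (psi (tag e)) (psi_arrow (tagged e)).

Lemma psi_in_arrow_inj x : injective (@psi_in_arrow x).
Proof.
move=> [y a] [y' a'] e; have /= /psi_inj ey := projT1_eq e; subst y'.
by have /(can_inj (@psi_arrowK _ _)) /= -> := existT_inj e.
Qed.

Lemma psi_in_arrow_surj x (e : in_arrows (psi x)) : kept (tag e) -> exists e', psi_in_arrow e' = e.
Proof.
case: e => v a [y ey]; simpl in ey; subst v.
by exists (existT _ y (psi_arrowV a)); rewrite /psi_in_arrow /= psi_arrowVK.
Qed.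

(** The arrows into a kept vertex are those of the smaller quiver, on which the
    polarizations match by [del_polE], and those from deleted vertices. *)
Lemma mesh_split x z (t' : tq_trans x z) (t : tq_trans (psi x) (psi z)) :
  exists L : seq {classic in_arrows (psi x)},
    (forall e, e \in L -> ~ kept (tag (e : in_arrows (psi x)))) /\
    mesh k s t = incl_map (mesh k s' t') +
      \sum_(e <- L) arr k (tagged (e : in_arrows (psi x))) \oc
                    arr k (pol s t (tagged (e : in_arrows (psi x)))).
Proof.
have [L [uL memL]] := enumeration_exists (psi x) Gfin.
have [L' [uL' memL']] := enumeration_exists x del_locally_finite.
pose Lp : seq {classic in_arrows (psi x)} :=
  [seq (psi_in_arrow (e : in_arrows x) : {classic in_arrows (psi x)}) | e <- L'].
exists [seq e <- L | e \notin Lp]; split=> [e|].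
  rewrite mem_filter => /andP [/negP ne _] /psi_in_arrow_surj [e' ee]; apply: ne.
  apply/(@mapP {classic in_arrows x} {classic in_arrows (psi x)} (@psi_in_arrow x)).
  by exists e'.
rewrite (mesh_sum k s t (conj uL memL)) (mesh_sum k s' t' (conj uL' memL')).
have uLp : uniq Lp.
  rewrite (@map_inj_uniq {classic in_arrows x} {classic in_arrows (psi x)}) //.
  exact: psi_in_arrow_inj.
have perm : perm_eq L (Lp ++ [seq e <- L | e \notin Lp]).
  apply: uniq_perm => // [|e].
    rewrite cat_uniq filter_uniq // andbT uLp.
    by apply/hasPn => e; rewrite mem_filter => /andP [].
  rewrite memL mem_cat mem_filter memL andbT.
  by case: (e \in Lp).
rewrite (perm_big _ perm) big_cat big_map /=; congr (_ + _).
rewrite -[RHS]/(fmap incl _) fmap_sum; apply: eq_bigr => e _.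
by rewrite fmapM /= !incl_path /= (del_polE t' t).
Qed.

Lemma mesh_no_arrow (Q : tquiver) (sg : polarization Q) (x z : Q) (t : tq_trans x z) :
  (forall y, arrow y x -> False) -> mesh k sg t = 0.
Proof.
move=> na; apply: (mesh_ind (Q := fun f => f = 0)) => // [f g -> ->|y a].
  by rewrite addr0.
by case: (na y a).
Qed.

(** The morphisms with all two-sided multiples restricting into the mesh ideal form
    an ideal of the path category, and it contains the meshes by [mesh_split]. *)
Lemma restr_mesh x y (f : hom P (psi x) (psi y)) : I (psi x) (psi y) f -> I' x y (restr f).
Proof.
have [J JE] : exists J : ideal P, forall u v f, J u v f <->
    forall x y (g : hom P (psi x) u) (h : hom P v (psi y)), I' x y (restr (h \oc f \oc g)).
  unshelve eexists; first unshelve eexists.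
  - move=> u v; exists (fun f => forall x y (g : hom P (psi x) u) (h : hom P v (psi y)),
        I' x y (restr (h \oc f \oc g))).
      move=> x1 y1 g h; rewrite (comp0r (C := P)) (comp0l (C := P)) restr0.
      exact: submod0.
    move=> a f1 f2 I1 I2 x1 y1 g h; rewrite comp_linr comp_linl restr_lin.
    by apply: submodP.
  - move=> u v w g h hI x1 y1 g1 h1.
    by have := hI _ _ g1 (h1 \oc g); rewrite !compA.
  - move=> u v w g h gI x1 y1 g1 h1.
    by have := gI _ _ (h \oc g1) h1; rewrite !compA.
  - by [].
move=> fI; suff /JE/(_ x y (@idm k P (psi x)) (@idm k P (psi y))) : J (psi x) (psi y) f.
  by rewrite comp1m compm1.
move: fI; apply: gen_ideal_min => v u r [t ->]; apply/JE => x1 y1 g h.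
have [[w ew]|nu] := pselect (kept u); last first.
  by rewrite -compA restr_through //; apply: submod0.
have [[w' ew']|nv] := pselect (kept v); last first.
  by rewrite restr_through //; apply: submod0.
subst u v; rewrite !restrM; apply/ideal_compr/ideal_compl.
have [[y2 [a]]|na] := pselect (exists y, inhabited (arrow y (psi w))); last first.
  rewrite mesh_no_arrow ?restr0; first exact: submod0.
  by move=> y2 a; apply: na; exists y2; constructor.
have t' := (psi_trans w' a).2 t.
have [L [nL ->]] := mesh_split t' t; rewrite restrD restrK.
rewrite [X in _ + X](_ : _ = 0).
  by rewrite addr0; apply: gen_ideal_mem; exists t'.
rewrite big_seq; elim/big_rec: _ => [|e f1 /nL ne IH]; first exact: restr0.
by rewrite restrD IH addr0 restr_through.
Qed.

Section Functor.
Variables (D : klincat k) (V : klinfunctor P D).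
(** [V] behaves like the composite of [path_category k G -> T -> T_X], where the
    deleted vertices are those that go to X. *)
Hypothesis Vmesh : forall x y (f : hom P x y), I x y f -> fmap V f = 0.
Hypothesis Vzero : forall u, ~ kept u -> is_zero (V u).
Hypothesis Vfull : full V.
Hypothesis Vker : forall x y (f : hom P x y), fmap V f = 0 ->
  exists n (t : 'I_n -> G) (g : forall l, hom P (t l) y) (h : forall l, hom P x (t l)),
    (forall l, ~ kept (t l)) /\ I x y (f - \sum_l g l \oc h l).

Definition del_functor : klinfunctor P' D := comp_functor V incl.

Lemma V_through x y w (g : hom P w y) (f : hom P x w) : ~ kept w -> fmap V (g \oc f) = 0.
Proof. by move=> /Vzero z; rewrite fmapM (zero_hom (fmap V f)) ?comp0r //; right. Qed.

Lemma del_functor_full : full del_functor.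
Proof.
move=> x y g; have [f <-] := Vfull g; exists (restr f).
rewrite /=; move: f {g}; apply: path_hom_ind => [|a p f IH].
  by rewrite restr0 incl0.
rewrite restr_lin incl_lin !fmap_lin IH; congr (_ *: _ + _).
have [/kept_path_lift [q <-]|np] := pselect (kept_path p).
  by rewrite restr_psi_path incl_path.
rewrite restr_dropped // incl0 fmap0; have [w [p1 [p2 [nw ->]]]] := dropped_path np.
by rewrite -path_compE V_through.
Qed.

(** A morphism killed by [V] differs from one of the mesh ideal by a morphism through
    deleted vertices, and [restr] kills the latter. *)
Lemma del_functor_ker x y (f : hom P' x y) : fmap del_functor f = 0 <-> I' x y f.
Proof.
split=> [/Vker [n [t [g [h [nt /restr_mesh fI]]]]]|].
  move: fI; suff -> : restr (incl_map f - \sum_l g l \oc h l) = f by [].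
  rewrite addrC -scaleN1r restr_lin restrK scaleN1r.
  suff -> : restr (\sum_l g l \oc h l) = 0 by rewrite oppr0 add0r.
  elim/big_rec: _ => [|l f1 _ IH]; first exact: restr0.
  by rewrite restrD IH addr0 restr_through.
have [J JE] : exists J : ideal P', forall x y f, J x y f <-> fmap del_functor f = 0.
  unshelve eexists; first unshelve eexists.
  - move=> x1 y1; exists (fun f => fmap del_functor f = 0); first exact: fmap0.
    by move=> a f1 f2 e1 e2; rewrite fmap_lin e1 e2 scaler0 addr0.
  - move=> x1 y1 z1 g1 f1 e1; change (fmap del_functor f1 = 0) in e1.
    by change (fmap del_functor (g1 \oc f1) = 0); rewrite fmapM e1 comp0r.
  - move=> x1 y1 z1 g1 f1 e1; change (fmap del_functor g1 = 0) in e1.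
    by change (fmap del_functor (g1 \oc f1) = 0); rewrite fmapM e1 comp0l.
  - by [].
move=> fI; apply/JE; move: fI; apply: gen_ideal_min => z w r [t' ->]; apply/JE.
have [[y' [a]]|na] := pselect (exists y, inhabited (arrow y (psi w))); last first.
  rewrite mesh_no_arrow ?fmap0 // => y' a; apply: na; exists (psi y').
  by constructor; apply: psi_arrow.
have t := (psi_trans z a).1 t'; have [L [nL mE]] := mesh_split t' t.
have : fmap V (mesh k s t) = 0 by apply: Vmesh; apply: gen_ideal_mem; exists t.
rewrite mE fmapD [X in _ + X](_ : _ = 0) ?addr0 //.
rewrite big_seq fmap_sum big1 // => e /nL ne.
by rewrite V_through.
Qed.

End Functor.
End Deletion.

(** * Additive closures *)

Section AddExtension.
Variables (k : fieldType) (C D : klincat k) (F : klinfunctor C D).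
Hypothesis addD : additive_cat D.
Hypotheses (Ffull : full F) (Ffaithful : faithful F).
Hypothesis Fdense : forall A : D, exists n (t : 'I_n -> C), is_nsum (fun l => F (t l)) A.

Lemma nsum_ext m n (t : 'I_m -> D) (u : 'I_n -> D) (A B : D)
    (i : forall l, hom D (t l) A) (p : forall l, hom D A (t l))
    (j : forall l, hom D (u l) B) (q : forall l, hom D B (u l)) (f g : hom D A B) :
  \sum_l i l \oc p l = idm A -> \sum_l j l \oc q l = idm B ->
  (forall l r, q r \oc f \oc i l = q r \oc g \oc i l) -> f = g.
Proof.
move=> ip jq fg; rewrite -[f]comp1m -[g]comp1m -[f]compm1 -[g]compm1 -jq -ip.
rewrite !comp_suml; apply: eq_bigr => r _; rewrite !comp_sumr; apply: eq_bigr => l _.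
have fgp : q r \oc (f \oc (i l \oc p l)) = q r \oc (g \oc (i l \oc p l)).
  by rewrite !compA fg.
by rewrite -!compA fgp.
Qed.

(** A formal direct sum goes to a chosen direct sum of images, and a matrix of
    morphisms to the morphism with these components. *)
Lemma add_closure_equivalence : inhabited (equivalence D (add_closure C)).
Proof.
pose o (s : add_obj C) : D := projT1 (cid (nsum_exists addD (fun l => F (s l)))).
have oP (s : add_obj C) : is_nsum (fun l => F (s l)) (o s) :=
  projT2 (cid (nsum_exists addD (fun l => F (s l)))).
pose i s := projT1 (cid (oP s)).
pose p s := projT1 (cid (projT2 (cid (oP s)))).
have pi (s : add_obj C) l : p s l \oc i s l = idm _.
  by have [h _ _] := projT2 (cid (projT2 (cid (oP s)))); apply: h.
have pi0 (s : add_obj C) l r : l != r -> p s l \oc i s r = 0.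
  by have [_ h _] := projT2 (cid (projT2 (cid (oP s)))); apply: h.
have ip (s : add_obj C) : \sum_l i s l \oc p s l = idm _.
  by have [_ _ h] := projT2 (cid (projT2 (cid (oP s)))); apply: h.
pose m s t (f : add_hom s t) : hom D (o s) (o t) :=
  \sum_l \sum_r i t r \oc fmap F (f l r) \oc p s l.
have mE s t (f : add_hom s t) l r : p t r \oc m s t f \oc i s l = fmap F (f l r).
  rewrite /m comp_sumr comp_suml (bigD1 l) //= [X in _ + X]big1 ?addr0 => [|l' ll'].
    rewrite comp_sumr comp_suml (bigD1 r) //= [X in _ + X]big1 ?addr0 => [|r' rr'].
      by rewrite !compA pi comp1m -compA pi compm1.
    by rewrite !compA pi0 1?eq_sym // !comp0l.
  rewrite comp_sumr comp_suml big1 // => r' _.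
  by rewrite -!compA pi0 // !comp0r.
have m_lin s t a f g : m s t (a *: f + g) = a *: m s t f + m s t g.
  apply: (nsum_ext (ip s) (ip t)) => l r.
  by rewrite mE comp_linr comp_linl !mE -fmap_lin.
have m1 (s : add_obj C) : m s s (add_idm (s := s)) = idm (o s).
  apply: (nsum_ext (ip s) (ip s)) => l r; rewrite mE compm1.
  have [->|lr] := eqVneq l r; first by rewrite add_idmE fmap1 pi.
  by rewrite add_idm_neq // fmap0 pi0 // eq_sym.
have mM s t u g f : m s u (add_comp g f) = m t u g \oc m s t f.
  apply: (nsum_ext (ip s) (ip u)) => l r; rewrite mE fmap_sum.
  rewrite -[m t u g]compm1 -ip comp_sumr comp_suml comp_sumr comp_suml.
  apply: eq_bigr => j _; rewrite fmapM -!mE !compA //.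
pose H := @KLinFunctor k (add_closure C) D o m m_lin m1 mM.
apply: (@ff_ess_equivalence _ _ _ H) => [s t g|s t f f0|A].
- pose f l r := projT1 (cid (Ffull (p t r \oc g \oc i s l))).
  have fE l r : fmap F (f l r) = p t r \oc g \oc i s l :=
    projT2 (cid (Ffull (p t r \oc g \oc i s l))).
  exists f; apply: (nsum_ext (ip s) (ip t)) => l r.
  by rewrite [LHS]mE fE.
- apply: add_homP => l r; apply: Ffaithful.
  by rewrite -mE [m s t f]f0 comp0r comp0l.
have [n [t tA]] := Fdense A; exists (AddObj t).
exact: nsum_unique (oP (AddObj t)) tA.
Qed.

End AddExtension.

Section AddEmbedding.
Variables (k : fieldType) (C : klincat k).

Definition add_embed : klinfunctor C (add_closure C).
Proof.
unshelve refine (@KLinFunctor k C (add_closure C)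
  (fun x => @AddObj k C 1 (fun=> x)) (fun x y f => fun i j => f) _ _ _) => //.
- move=> A; apply: add_homP => i j; rewrite (ord1 i) (ord1 j).
  by rewrite [RHS](@add_idmE k C (AddObj (fun=> A)) ord0).
- by move=> A B E g f; apply: add_homP => i j; rewrite [RHS]big_ord1.
Defined.

Lemma add_embed_full : full add_embed.
Proof.
move=> A B g; exists (g ord0 ord0); apply: add_homP => i j.
by rewrite (ord1 i) (ord1 j).
Qed.

Lemma add_embed_faithful : faithful add_embed.
Proof.
move=> A B f f0; pose o x : add_obj C := @AddObj k C 1 (fun=> x).
exact: (congr1 (fun h : add_hom (o A) (o B) => h ord0 ord0) f0).
Qed.

Lemma add_obj_nsum (s : add_closure C) :
  is_nsum (fun l => add_embed ((s : add_obj C) l)) s.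
Proof.
have idid i j : \sum_l add_idm (s := s) l j \oc add_idm (s := s) i l = add_idm (s := s) i j.
  by have := comp1m (idm s); move/(congr1 (fun f : add_hom s s => f i j)).
have sumE n (t u : add_obj C) (f : 'I_n -> add_hom t u) i j :
    (\sum_l f l : hom (add_closure C) t u) i j = \sum_l f l i j.
  elim/big_rec2: _ => [//|l x y _ <-] //.
exists (fun l => (fun _ j => add_idm (s := s) l j) : hom (add_closure C) (add_embed (s l)) s),
  (fun l => (fun i _ => add_idm (s := s) i l) : hom (add_closure C) s (add_embed (s l))); split.
- move=> l; apply: add_homP => i j; rewrite [LHS]idid add_idmE (ord1 i) (ord1 j).
  by rewrite [RHS](@add_idmE k C (AddObj (fun=> s l)) ord0).
- move=> l r lr; apply: add_homP => i j; rewrite [LHS]idid.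
  by rewrite add_idm_neq // eq_sym.
apply: add_homP => i j; rewrite [LHS]sumE -[RHS]idid; apply: eq_bigr => l _.
by rewrite [LHS]big_ord1.
Qed.

End AddEmbedding.

(** For an additive category, being the additive closure of a quotient [C / I] is
    the same as receiving a full functor from [C] with kernel [I] and dense image. *)
Section Presentation.
Variables (k : fieldType) (C D : klincat k) (I : ideal C).

Lemma equivalence_of_presentation (H : klinfunctor C D) : additive_cat D -> full H ->
  (forall A B (f : hom C A B), fmap H f = 0 <-> I A B f) ->
  (forall A : D, exists n (t : 'I_n -> C), is_nsum (fun l => H (t l)) A) ->
  inhabited (equivalence D (add_closure (quotient_category I))).
Proof.
move=> addD fuH kerH dense; pose Q := quotient_category I.
pose m (A B : Q) (f : hom Q A B) : hom D (H A) (H B) := fmap H (repr f).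
have mE A B (f : hom C A B) : m A B (qpi I f) = fmap H f.
  by apply/eqP; rewrite -subr_eq0 -fmapB; apply/eqP/kerH/repr_lpi.
have m_lin (A B : Q) a (f g : hom Q A B) : m A B (a *: f + g) = a *: m A B f + m A B g.
  by rewrite -(qpi_repr f) -(qpi_repr g) -qpi_lin !mE fmap_lin.
have m1 (A : Q) : m A A (idm A) = idm (H A) by rewrite [LHS]mE fmap1.
have mM (A B E : Q) (g : hom Q B E) (f : hom Q A B) : m A E (g \oc f) = m B E g \oc m A B f.
  rewrite -(qpi_repr f) -(qpi_repr g).
  transitivity (m A E (qpi I (repr g \oc repr f))).
    exact: (congr1 (m A E) (qcompE I _ _)).
  by rewrite !mE fmapM.
pose H1 := @KLinFunctor k Q D H m m_lin m1 mM.
apply: (@add_closure_equivalence k Q D H1) => [//|A B g|A B f f0|//].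
  by have [f <-] := fuH A B g; exists (qpi I f); apply: mE.
by rewrite -(qpi_repr f); apply/(quotient_eq0 I)/kerH.
Qed.

Lemma presentation_of_equivalence : equivalence D (add_closure (quotient_category I)) ->
  exists W : klinfunctor C D, [/\ full W,
    forall A B (f : hom C A B), fmap W f = 0 <-> I A B f
  & forall A : D, exists n (t : 'I_n -> C), is_nsum (fun l => W (t l)) A].
Proof.
move=> F; pose q := quotient_functor I; pose e := @add_embed k (quotient_category I).
exists (comp_functor (eqv_inv F) (comp_functor e q)); split.
- exact: full_comp (@eqv_inv_full _ _ _ F) (full_comp (@add_embed_full _ _) (@quotient_full _ _ I)).
- move=> A B f; split=> [f0|/quotient_eq0 f0]; last first.
    by rewrite /= [qpi I f]f0 !fmap0.
  apply/quotient_eq0/(@add_embed_faithful k (quotient_category I)).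
  exact: (@eqv_inv_faithful _ _ _ F).
move=> A; have nA := fmap_nsum (eqv_inv F) (add_obj_nsum (eqv_fun F A)).
exists (add_size (eqv_fun F A)), (fun l => (eqv_fun F A : add_obj _) l).
have [v [vu uv]] := nt_iso (eqv_unit F) A; set u := eqv_unit F A in vu uv.
have [i [p [pi pi0 ip]]] := nA.
exists (fun l => v \oc i l), (fun l => p l \oc u); split=> [l|l r lr|].
- by rewrite compA -(compA (p l)) uv compm1 pi.
- by rewrite compA -(compA (p l)) uv compm1 pi0.
under eq_bigr => l _ do rewrite compA -(compA v).
by rewrite -comp_suml -comp_sumr ip compm1.
Qed.

End Presentation.

(** * Standardness of the quotient *)

Section Standard.
Variables (k : closedFieldType) (T : tricat k) (S : serre_functor T).
Hypotheses (hfin : hom_finite T) (hsplit : split_idempotents T).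
Variable X : Xclass T.
Hypothesis htau : forall B : T, X B <-> exists A : T, X A /\ iso B (ar_tau S A).
Variable E : envelopes X.
Local Notation U := (quot_functor X).
Local Notation G := (ar_quiver (fun A B : T => iso B (ar_tau S A))).
Local Notation G' := (ar_quiver (@ar_translate k (TX E))).

Lemma quot_additive : additive_cat (TX_cat X).
Proof.
have [[Z z] dsum] := tadd T; split; first by exists Z; apply: (fmap_zero U).
by move=> A B; have [D ABD] := dsum A B; exists D; apply: (fmap_direct_sum U).
Qed.

Lemma quot_standard : standard T G -> standard (TX E) G'.
Proof.
move=> [s [F]]; have [W [Wfull Wker Wdense]] := presentation_of_equivalence F.
have lW := W_local hfin Wfull Wker.
(* The equivalence may send [A] to a vertex other than its own: [psi] records which
   vertex of G presents an indecomposable of the quotient. *)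
have exW (x : G') : exists u : G, iso (U (W u)) (ind_repr x).
  have [ind _] := ind_reprP x.
  have it := local_idem_trivial ((quot_indecP hfin hsplit _).1 ind).
  have [n [t nA]] := Wdense (ind_repr x).
  by have [l lA] := idem_trivial_nsum it (fmap_nsum U nA); exists (t l).
pose psi x : G := projT1 (cid (exW x)).
have psiP x : iso (U (W (psi x))) (ind_repr x) := projT2 (cid (exW x)).
have nX x : ~ X (W (psi x)).
  move=> /(X_quot_zero X hsplit) z; have [[nz _] _] := ind_reprP x; apply: nz.
  have [f [g [_ fg]]] := psiP x.
  by rewrite /is_zero -fg (zero_hom f) ?comp0l //; left.
have psi_inj : injective psi.
  move=> x y xy; apply: ind_class_inj; apply: iso_trans (psiP y).
  by rewrite -xy; apply: iso_sym.
have psi_dim x y : irr_dim (W (psi x)) (W (psi y)) = tq_arr x y.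
  rewrite -(quot_irr_dim hsplit (lW _) (nX x) (lW _) (nX y)).
  exact: irr_dim_iso (psiP x) (psiP y).
have psi_tq_arr x y : tq_arr (psi x) (psi y) = tq_arr x y.
  by rewrite -psi_dim (W_irr_dim hfin Wfull Wker Wdense).
have transP (x z : G') : tq_trans x z <-> iso (W (psi z)) (ar_tau S (W (psi x))).
  rewrite -(quot_ar_translateP hfin hsplit htau E (lW _) (nX x) (lW _) (nX z)).
  split=> -[A [B [xA zB AB]]]; exists A, B; split=> //.
  - by apply: iso_trans (psiP x) _; apply/ind_class_iso.
  - by apply: iso_trans (psiP z) _; apply/ind_class_iso.
  - by apply/ind_class_iso; apply: iso_trans xA; apply: iso_sym.
  - by apply/ind_class_iso; apply: iso_trans zB; apply: iso_sym.
have translate := W_translate S hfin hsplit Wfull Wker Wdense.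
have psi_trans (x z : G') y (a : arrow y (psi x)) :
    tq_trans x z <-> tq_trans (psi x) (psi z).
  rewrite transP; split=> [zx|]; last exact: translate a.
  have ltau : local_obj (ar_tau S (ind_repr (psi x))).
    by apply: local_tau => //; apply/(indec_localP hfin hsplit); have [] := ind_reprP (psi x).
  pose v : G := class_of (local_indec ltau).
  have uv : tq_trans (psi x) v.
    exists (ind_repr (psi x)), (ar_tau S (ind_repr (psi x))); split; last exact: iso_refl.
      by apply/ind_class_iso/iso_refl.
    exact: iso_refl.
  suff -> : psi z = v by [].
  apply: (W_iso_inj hfin Wfull Wker); apply: iso_trans zx _.
  exact/iso_sym/(translate _ _ _ a).
(* At the vertices that belong to the objects W (psi x) and W (psi z) themselves, the
   translation of G is tau, so the bijections of s compare the numbers of arrows. *)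
have mesh_arr (x z : G') : tq_trans x z -> forall y : G', tq_arr y x = tq_arr z y.
  move=> /transP zx y.
  pose c u : G := class_of (local_indec (lW u)).
  have cP u : iso (W u) (ind_repr (c u)) by apply: ind_repr_class.
  have dimc u v : tq_arr (c u) (c v) = irr_dim (W u) (W v).
    by apply: irr_dim_iso; apply: iso_sym.
  have t : tq_trans (c (psi x)) (c (psi z)).
    by exists (W (psi x)), (W (psi z)); split=> //; apply: iso_refl.
  have := bij_eq_card (pol_bij s t (c (psi y))).
  by rewrite !card_ord !dimc !psi_dim.
have Gfin := W_locally_finite S hfin Wfull Wker Wdense.
have keptP u : kept psi u <-> ~ X (W u).
  split=> [[x <-] //|nXu].
  have lu := local_quot hsplit (lW u) nXu.
  pose x : G' := class_of (local_indec lu).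
  exists x; apply: (W_iso_inj hfin Wfull Wker).
  apply: (quot_iso_lift hsplit (lW _) (lW _) (nX x)); apply: iso_trans (psiP x) _.
  exact/iso_sym/ind_repr_class.
have dropP u : ~ kept psi u -> X (W u).
  by move=> nk; apply: contrapT => /keptP.
pose V := comp_functor U W.
have Vmesh x y (f : hom (path_category k G) x y) :
    @gen_ideal k (path_category k G) (is_mesh (G := G) s) x y f -> fmap V f = 0.
  by move=> /Wker /= ->; apply: (fmap0 U).
have Vzero u : ~ kept psi u -> is_zero (V u) by move/dropP/(X_quot_zero X hsplit).
have Vfull : full V.
  by move=> x y g; have [g1 <-] := quot_full g; have [f <-] := Wfull _ _ g1; exists f.
have Vker x y (f : hom (path_category k G) x y) : fmap V f = 0 ->
    exists n (t : 'I_n -> G) (g : forall l, hom (path_category k G) (t l) y)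
           (h : forall l, hom (path_category k G) x (t l)),
      (forall l, ~ kept psi (t l)) /\
      @gen_ideal k (path_category k G) (is_mesh (G := G) s) x y (f - \sum_l g l \oc h l).
  move=> /quot_eq0 [N [XN [u [v uv]]]]; have [n [t [i [p [pi _ ip]]]]] := Wdense N.
  pose g l := projT1 (cid (Wfull _ _ (v \oc i l))).
  have gE l : fmap W (g l) = v \oc i l := projT2 (cid (Wfull _ _ (v \oc i l))).
  pose h l := projT1 (cid (Wfull _ _ (p l \oc u))).
  have hE l : fmap W (h l) = p l \oc u := projT2 (cid (Wfull _ _ (p l \oc u))).
  exists n, t, g, h; split=> [l /keptP|].
    by apply; apply: (X_retract hsplit XN (pi l)).
  apply/Wker; rewrite fmapB uv -[v]compm1 -ip comp_sumr comp_suml fmap_sum.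
  apply/eqP; rewrite subr_eq0; apply/eqP; apply: eq_bigr => l _.
  by rewrite fmapM gE hE !compA.
exists (del_polarization s psi_tq_arr mesh_arr).
apply: (@equivalence_of_presentation k (path_category k G') (TX_cat X) _
  (del_functor psi_tq_arr V)).
- exact: quot_additive.
- exact: (del_functor_full psi_inj Vzero Vfull).
- move=> x y f.
  exact: (del_functor_ker psi_inj psi_tq_arr psi_trans mesh_arr Gfin Vmesh Vzero Vker f).
move=> A; have [n [t nA]] := Wdense A.
have [m [f [nz nA']]] := nsum_drop_zero (fmap_nsum U nA).
have exx l : kept psi (t (f l)) by apply/keptP => /(X_quot_zero X hsplit); apply: nz.
exists m, (fun l => projT1 (cid (exx l))).
rewrite (_ : (fun l => _) = fun l => U (W (t (f l)))) //.
by apply/funext => l /=; rewrite (projT2 (cid (exx l))).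
Qed.

End Standard.

Theorem theorem3p2 (k : closedFieldType) (T : tricat k) (S : serre_functor T)
    (hfin : hom_finite T) (hsplit : split_idempotents T)
    (X : Xclass T) (E : envelopes X)
    (htau : forall B : T, X B <-> exists A : T, X A /\ iso B (ar_tau S A)) :
  let G := ar_quiver (fun A B : T => iso B (ar_tau S A)) in
  let G' := ar_quiver (@ar_translate k (TX E)) in
  [/\ has_ar_triangles (TX E),
      exists phi : tq_delete (fun x : G => exists A, sval x A /\ X A) -> G',
        tq_isom phi /\ forall x M, sval (sval x) M -> sval (phi x) M
    & standard T G -> standard (TX E) G'].
Proof.
split; first exact: quot_has_ar_triangles hfin hsplit X htau E.
  exact: quot_ar_quiver hfin hsplit X htau E.
exact: quot_standard hfin hsplit X htau E.
Qed.
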